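(* Let $k\ge1$ and $q=(q_1,\dots,q_k)\in(0,1)^k$. Let $Z=(Z(t);t\ge0)$ be a continuous-time $k$-dimensional random walk started from the origin, with independent components, whose $i$-th component jumps by $+1$ at rate $q_i^{-1}$ and by $-1$ at rate $q_i$. Let $\tilde Z$ be a random walk independent of $Z$ and with the same law as $-Z$, and let $\bar Z(t)=(Z_1(t),\tilde Z_1(t),Z_2(t),\tilde Z_2(t),\dots,Z_k(t),\tilde Z_k(t))$. Let $Z^\dagger$ be the Doob $h$-transform, started from the origin, of $Z$ killed on leaving $\mathcal W_0^k$, with harmonic function $h_{2k}(x)=q_1^{-x_1}\cdots q_k^{-x_k}Sp^{2k}_x(q)$, $x\in\mathcal W_0^k$. Then, as processes, $$\left(Z_k^\dagger(t);t\ge0\right)\overset{\mathrm{dist}}{=}\left(\sup_{0\le t_1\le\dots\le t_{2k+1}=t}\ \sum_{i=1}^{2k}\left(\bar Z_i(t_{i+1})-\bar Z_i(t_i)\right);t\ge0\right).$$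
   Context: $\mathbb Z_+=\{0,1,2,\dots\}$; $\mathcal W_0^k=\{z\in\mathbb Z^k:0\le z_1\le\dots\le z_k\}$. For $x,y\in\mathbb R^m$, $x\prec y$ means $x_1\le y_1\le x_2\le\dots\le y_{m-1}\le x_m\le y_m$. For $x\in\mathbb R^m$, $y\in\mathbb R^{m+1}$, $x\preceq y$ means $y_i\le x_i\le y_{i+1}$ for $1\le i\le m$. Symplectic patterns: $\mathbb K^0_{2k}$ is the set of $(x^1,\dots,x^{2k})$ with $x^{2i-1},x^{2i}\in\mathbb Z_+^i$ and $x^{2i-1}\prec x^{2i}$ for $1\le i\le k$, and $x^{2i}\preceq x^{2i+1}$ for $1\le i\le k-1$. With $|z|=\sum_i z_i$ and $|x^0|=0$, put $w^q_{2k}(x)=\prod_{i=1}^kq_i^{2|x^{2i-1}|-|x^{2i-2}|-|x^{2i}|}$. The symplectic Schur function is $Sp^{2k}_z(q)=\sum_{x\in\mathbb K^0_{2k}:\,x^{2k}=z}w^q_{2k}(x)$ for $z\in\mathcal W_0^k$. The $h$-transform $Z^\dagger$ is the Markov process on $\mathcal W_0^k$ whose rate of jumping from $x$ to $x\pm e_i$ (when both lie in $\mathcal W_0^k$; $e_i$ the $i$-th standard basis vector) is the rate of the corresponding jump of $Z$ multiplied by $h_{2k}(x\pm e_i)/h_{2k}(x)$, that is, $Sp^{2k}_{x\pm e_i}(q)/Sp^{2k}_x(q)$; all other off-diagonal rates vanish and the total rate of leaving $x$ is $\sum_{i=1}^k(q_i+q_i^{-1})$. $Z_k^\dagger$ is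 its $k$-th (largest) component.
   Formalization: The exponent in h_{2k} is corrected: with +1 jumps at rate 1/q_i the harmonic function is q_1^{x_1}...q_k^{x_k} Sp_x(q), not q_1^{-x_1}...q_k^{-x_k} Sp_x(q); Z^dagger has rates Sp_{x±e_i}/Sp_x. *)

(* Defs.v *)
From HB Require Import structures.
From mathcomp Require Import all_boot all_order all_algebra.
From mathcomp Require Import all_classical all_reals all_analysis.
From mathcomp Require Import ring.
Set Implicit Arguments.
Unset Strict Implicit.
Unset Printing Implicit Defensive.
Import Order.TTheory GRing.Theory Num.Theory.
Import numFieldNormedType.Exports.
Local Open Scope classical_set_scope.
Local Open Scope ring_scope.

(** * Processes in continuous time

    A process is a map [X : R -> T -> S]; only its values at times [0 <= t]
    are ever used.  The state space [S] carries a class [M] of measurable sets: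
    [discrete_measurable] for countable [S], [measurable] for [\bar R]. *)

Section Processes.
Variable R : realType.

Definition path_sigma (S : Type) (M : set (set S)) : set (set (R -> S)) :=
  <<s [set C | exists t B, [/\ 0 <= t, M B & C = [set f | B (f t)]]] >>.

Definition path_event (T S : Type) (X : R -> T -> S) (A : set (R -> S)) :
  set T := [set w | A (fun t => X t w)].

Definition measurable_process d (T : measurableType d) (S : Type)
    (M : set (set S)) (X : R -> T -> S) : Prop :=
  forall t B, 0 <= t -> M B -> measurable (X t @^-1` B).

(* X and Y, possibly on different probability spaces, are stochastic processes
   which induce the same law on path space. *)
Definition same_law d d' (T : measurableType d) (T' : measurableType d')
    (S : Type) (M : set (set S)) (P : probability T R) (X : R -> T -> S)
    (P' : probability T' R) (Y : R -> T' -> S) : Prop :=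
  [/\ measurable_process M X, measurable_process M Y &
      forall A, path_sigma M A -> P (path_event X A) = P' (path_event Y A)].

Definition indep_processes d (T : measurableType d) (P : probability T R)
    (S S' : Type) (M : set (set S)) (M' : set (set S'))
    (X : R -> T -> S) (Y : R -> T -> S') : Prop :=
  forall A B, path_sigma M A -> path_sigma M' B ->
    P (path_event X A `&` path_event Y B)
    = (P (path_event X A) * P (path_event Y B))%E.

(* Taking some of the [A i] to be [setT] gives the product rule for all
   subfamilies. *)
Definition mutually_indep_processes d (T : measurableType d)
    (P : probability T R) (I : finType) (S : Type) (M : set (set S))
    (X : I -> R -> T -> S) : Prop :=
  forall A : I -> set (R -> S), (forall i, path_sigma M (A i)) ->
    P (\bigcap_(i in [set: I]) path_event (X i) (A i))
    = (\prod_i fine (P (path_event (X i) (A i))))%:E.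

(* Right-continuity and existence of left limits, in a discrete state space. *)
Definition cadlag_paths (T S : Type) (X : R -> T -> S) : Prop :=
  forall w t,
    (0 <= t -> \forall s \near t^'+, X s w = X t w) /\
    (0 < t -> exists x, \forall s \near t^'-, X s w = x).

(** ** Markov jump processes with given rates *)

(* [p t x y] is the transition function of a Markov chain on [S] with rates
   [Q]: [Q x y] is the rate of jumping from [x] to [y] when [x != y], and
   [- Q x x] is the total rate of leaving [x]. *)
Definition transition_function (S : choiceType) (Q : S -> S -> R)
    (p : R -> S -> S -> R) : Prop :=
  [/\ forall t x y, 0 <= t -> 0 <= p t x y,
      forall t x, 0 <= t -> \esum_(y in [set: S]) (p t x y)%:E = 1%E,
      forall x y, p 0 x y = (x == y)%:R,
      forall s t x z, 0 <= s -> 0 <= t ->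
        (p (s + t) x z)%:E = \esum_(y in [set: S]) (p s x y * p t y z)%:E
    & forall x y, (p t x y - (x == y)%:R) / t @[t --> 0^'+] --> Q x y].

(* [fdd p s x [:: (t1, y1); ...; (tn, yn)]]
   = p_{t1 - s}(x, y1) p_{t2 - t1}(y1, y2) ... p_{tn - t(n-1)}(y(n-1), yn) *)
Fixpoint fdd (S : Type) (p : R -> S -> S -> R) (s : R) (x : S)
    (l : seq (R * S)) : R :=
  if l is (t, y) :: l' then p (t - s) x y * fdd p t y l' else 1.

(* Since [p 0] is the identity, the case [l = [:: (0, x0)]] of the last clause
   says that X starts at x0 almost surely. *)
Definition markov_jump_process d (T : measurableType d) (P : probability T R)
    (S : countType) (Q : S -> S -> R) (x0 : S) (X : R -> T -> S) : Prop :=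
  [/\ measurable_process (@discrete_measurable S) X,
      cadlag_paths X &
      exists2 p, transition_function Q p &
        forall l : seq (R * S), path <=%R 0 (unzip1 l) ->
          P [set w | all (fun ty => X ty.1 w == ty.2) l] = (fdd p 0 x0 l)%:E].

(* Nearest-neighbour walk on the integers, up at rate a and down at rate b. *)
Definition walk_rates (a b : R) (x y : int) : R :=
  if y == x + 1 then a
  else if y == x - 1 then b
  else if y == x then - (a + b) else 0.

End Processes.

(** * Symplectic patterns and symplectic Schur functions *)

(* The relation between two rows of the same length:
   x_1 <= y_1 <= x_2 <= ... <= x_m <= y_m. *)
Definition interlace_eq (x y : seq nat) : Prop :=
  (forall i, (i < size x)%N -> (nth 0%N x i <= nth 0%N y i)%N) /\
  (forall i, (i.+1 < size x)%N -> (nth 0%N y i <= nth 0%N x i.+1)%N).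

(* The relation between rows of lengths m and m + 1. *)
Definition interlace_lt (x y : seq nat) : Prop :=
  forall i, (i < size x)%N -> (nth 0%N y i <= nth 0%N x i <= nth 0%N y i.+1)%N.

(* A pattern is the list of its rows x^1, ..., x^{2k}; [level x j] is x^j for
   1 <= j, and the empty row for j = 0. *)
Definition level (x : seq (seq nat)) (j : nat) : seq nat :=
  nth [::] ([::] :: x) j.

Definition symplectic_pattern (k : nat) (x : seq (seq nat)) : Prop :=
  [/\ size x = k.*2,
      forall i, (1 <= i <= k)%N ->
        size (level x i.*2.-1) = i /\ size (level x i.*2) = i,
      forall i, (1 <= i <= k)%N ->
        interlace_eq (level x i.*2.-1) (level x i.*2) &
      forall i, (1 <= i < k)%N ->
        interlace_lt (level x i.*2) (level x i.*2.+1)].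

Section Symplectic.
Variables (R : realType) (k : nat).

(* The indices i = 1, ..., k are shifted down to 0, ..., k - 1. *)
Definition pattern_weight (q : 'I_k -> R) (x : seq (seq nat)) : R :=
  \prod_(i < k) q i ^ (2 * (sumn (level x i.*2.+1))%:Z
                       - (sumn (level x i.*2))%:Z
                       - (sumn (level x i.*2.+2))%:Z).

(* The sum has finitely many terms, all entries of a pattern being bounded by
   the largest entry of its last row. *)
Definition Sp (q : 'I_k -> R) (z : {ffun 'I_k -> int}) : R :=
  \sum_(x \in [set x | symplectic_pattern k x
                       /\ map Posz (level x k.*2) = codom z])
    pattern_weight q x.

Definition in_chamber : pred {ffun 'I_k -> int} :=
  fun z => [forall i, 0 <= z i] &&
           [forall i : 'I_k, forall j : 'I_k, (i <= j)%N ==> (z i <= z j)].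

Definition chamber := {z : {ffun 'I_k -> int} | in_chamber z}.

Lemma in_chamber0 : in_chamber 0.
Proof.
apply/andP; split; first by apply/forallP => i; rewrite ffunE.
by apply/forallP => i; apply/forallP => j; apply/implyP; rewrite !ffunE.
Qed.

Definition chamber0 : chamber := exist _ 0 in_chamber0.

Definition basis_vec (i : 'I_k) : {ffun 'I_k -> int} :=
  [ffun j => (j == i)%:R].

Definition neighbours (x y : {ffun 'I_k -> int}) : bool :=
  [exists i, (y == x + basis_vec i) || (y == x - basis_vec i)].

(* Rates of the h-transform; see [dagger_ratesE] below for the comparison with
   the rates of the walk. *)
Definition dagger_rates (q : 'I_k -> R) (x y : chamber) : R :=
  if x == y then - \sum_(i < k) (q i + (q i)^-1)
  else if neighbours (val x) (val y) then Sp q (val y) / Sp q (val x) else 0.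

(* Jump rates (off the diagonal) of the k-dimensional walk whose i-th component
   jumps by +1 at rate 1 / q_i and by -1 at rate q_i. *)
Definition walk_jump_rate (q : 'I_k -> R) (x y : {ffun 'I_k -> int}) : R :=
  \sum_(i < k) ((y == x + basis_vec i)%:R * (q i)^-1
                + (y == x - basis_vec i)%:R * q i).

(* The sign of the exponent is the one for which the factors 1 / q_i and q_i of
   the jump rates above cancel. *)
Definition harmonic_h (q : 'I_k -> R) (x : {ffun 'I_k -> int}) : R :=
  (\prod_(i < k) q i ^ x i) * Sp q x.

Section DoobTransform.
Variables (q : 'I_k -> R) (x y : {ffun 'I_k -> int}).
Hypothesis q_gt0 : forall i, 0 < q i.

Lemma basis_vec_inj : injective basis_vec.
Proof.
by move=> i j /ffunP /(_ i); rewrite !ffunE eqxx; case: eqP.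
Qed.

Lemma basis_vec_neqN i j : basis_vec i != - basis_vec j.
Proof.
by apply/eqP => /ffunP /(_ i); rewrite !ffunE eqxx; case: eqP.
Qed.

Lemma prod_exprD_basis (z : {ffun 'I_k -> int}) (i : 'I_k) :
  \prod_(j < k) q j ^ (z + basis_vec i) j = (\prod_(j < k) q j ^ z j) * q i.
Proof.
rewrite (bigD1 i) //= [in RHS](bigD1 i) //= !ffunE eqxx.
rewrite exprzDr ?unitfE ?gt_eqF // expr1z -!mulrA; congr (_ * _).
rewrite mulrC; congr (_ * _); apply: eq_bigr => j /negPf ji.
by rewrite !ffunE ji addr0.
Qed.

Lemma jump_rate_prod :
  walk_jump_rate q x y * ((\prod_(j < k) q j ^ y j) / \prod_(j < k) q j ^ x j)
  = (neighbours x y)%:R.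
Proof.
have q0 i : q i != 0 by rewrite gt_eqF.
have p0 z : \prod_(j < k) q j ^ z j != 0.
  by apply/prodf_neq0 => j _; rewrite expfz_neq0.
case: (boolP (neighbours x y)) => [/existsP[i]|]; last first.
  rewrite negb_exists => /forallP nb; rewrite /walk_jump_rate big1 ?mul0r// => i _.
  by have := nb i; rewrite negb_or => /andP[/negPf-> /negPf->]; rewrite !mul0r addr0.
rewrite /walk_jump_rate (bigD1 i) //=.
move=> /orP[] /eqP yE; rewrite [X in _ + X]big1 ?addr0.
- rewrite {1 2}yE eqxx (inj_eq (addrI x)) (negPf (basis_vec_neqN i i)).
  by rewrite yE prod_exprD_basis mul0r addr0 mul1r; field; rewrite q0 p0.
- move=> j ji; rewrite yE !(inj_eq (addrI x)) (inj_eq basis_vec_inj).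
  by rewrite eq_sym (negPf ji) (negPf (basis_vec_neqN i j)) !mul0r addr0.
- have xE : x = y + basis_vec i by rewrite yE subrK.
  rewrite {1 2}yE eqxx (inj_eq (addrI x)) eq_sym (negPf (basis_vec_neqN i i)).
  by rewrite xE prod_exprD_basis mul0r add0r mul1r; field; rewrite q0 p0.
- move=> j ji; rewrite yE !(inj_eq (addrI x)) (inj_eq oppr_inj).
  rewrite (inj_eq basis_vec_inj) [i == j]eq_sym (negPf ji).
  by rewrite eq_sym (negPf (basis_vec_neqN j i)) !mul0r addr0.
Qed.

End DoobTransform.

Lemma dagger_ratesE (q : 'I_k -> R) (x y : chamber) :
  (forall i, 0 < q i) -> x != y ->
  dagger_rates q x y =
  walk_jump_rate q (val x) (val y)
  * (harmonic_h q (val y) / harmonic_h q (val x)).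
Proof.
move=> q0 /negPf xy; rewrite /dagger_rates xy /harmonic_h invfM mulrACA.
rewrite [RHS]mulrA jump_rate_prod //.
by case: ifP => _; rewrite ?mul1r ?mul0r.
Qed.

(** * The interlaced walks and the last passage functional *)

Lemma half_ord_subproof (j : 'I_k.*2) : (j./2 < k)%N.
Proof. by rewrite ltn_half_double. Qed.

Definition half_ord (j : 'I_k.*2) : 'I_k := Ordinal (half_ord_subproof j).

(* (Z_1, Z'_1, Z_2, Z'_2, ..., Z_k, Z'_k) *)
Definition interleaved (T : Type) (Z Z' : R -> T -> {ffun 'I_k -> int})
    (j : 'I_k.*2) (t : R) (w : T) : int :=
  (if odd j then Z' t w else Z t w) (half_ord j).

(* The times t_1, ..., t_{2k+1} are s 0, ..., s (2k). *)
Definition last_passage (T : Type) (Y : 'I_k.*2 -> R -> T -> int)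
    (t : R) (w : T) : \bar R :=
  ereal_sup [set v | exists s : nat -> R,
    [/\ 0 <= s 0%N,
        forall i, (i < k.*2)%N -> s i <= s i.+1,
        s k.*2 = t &
        v = ((\sum_(i < k.*2) (Y i (s i.+1) w - Y i (s i) w))%:~R : R)%:E]].

Definition largest_coord (hk : (0 < k)%N) (z : chamber) : int :=
  val z (Ordinal (etrans (ltn_predL k) hk)).

End Symplectic.

(* Main.v *)
(** The largest entries x^1_1 <= x^2_1 <= x^3_2 <= ... <= x^{2k}_k of the rows of a
    symplectic pattern can evolve autonomously: the j-th one
    follows the j-th component of [interleaved Z Zt] and is pushed up by the (j-1)-th.
    Solving this recursion on a grid of times gives the last passage functional restricted
    to that grid, and the grid values increase to the supremum by right-continuity.

    On the other side, let Gamma(z, .) be the law of this right edge for a random pattern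
    with bottom row z and weights w(x) / Sp_z.  The Schur function is invariant under
    q_i -> 1 / q_i (Bender-Knuth involution), and for the weights with 1 / q_i a level by
    level computation gives Q Gamma = Gamma B, where Q generates Z^dagger and B the edge.
    By a discrete Gronwall estimate the transition function of Z^dagger then satisfies
    p_t Gamma f = lim_n Gamma K_{t/2^n}^{2^n} f, where K_h is one step of the grid
    recursion with increments of the walks over time h.  Gamma(z, .) lives on edges with
    top entry z_k, so the finite-dimensional laws of Z^dagger_k and of the last passage
    functional agree. *)

Require Import Defs.
From HB Require Import structures.
From mathcomp Require Import all_boot all_order all_algebra.
From mathcomp Require Import finmap.
From mathcomp Require Import all_classical all_reals all_analysis.
From mathcomp Require Import measurable_realfun.
From mathcomp Require Import zify ring lra.
Import Order.TTheory GRing.Theory Num.Theory.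
Import numFieldNormedType.Exports.
Local Open Scope classical_set_scope.
Local Open Scope ring_scope.

(** * Interlacing rows *)

(** No process carrying both [Zdag] and the edge is built; only semigroups are compared. Since
    Gamma(z, .) determines the top entry, indicators of the top entry pass through Gamma, as in the
    Markov function criterion of Rogers and Pitman, and this allows an induction over several times.

    The rates force the inversion of the weights: the weight factor of a level is also the rate at
    which its edge coordinate jumps to the right. The weights q_i themselves would give rate q_1 to
    the first coordinate, whereas Z_1 jumps up at rate 1 / q_1.

    The obstacle is analytic. A transition function is given through its derivatives at time 0,
    entry by entry on an infinite space, so one-step errors are o(h) pointwise but not uniformly.
    What is uniform is a bound C on the total rates. After j iterations of the one-step inequality
    the remainder is at most (C t)^j / j!, and the collected errors come from finitely many states;
    j is chosen first, then h. The same estimate makes transition functions unique, whence the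
    spatial homogeneity of the walks. *)

(* Rows are listed from the largest entry down and continued by zeros. *)
Definition parts := nat -> int.
Definition up (j : nat) (z : parts) : parts := fun i => z i + ((i == j) : nat)%:Z.
Definition dn (j : nat) (z : parts) : parts := fun i => z i - ((i == j) : nat)%:Z.
Definition strip (m : nat) (z : parts) : Prop :=
  forall i, (z i.+1 <= z i) /\ ((m <= i)%N -> z i = 0).
Definition ilace (y z : parts) : Prop := forall i, z i.+1 <= y i <= z i.

Lemma upK j : cancel (up j) (dn j).
Proof. by move=> z; apply/funext => i; rewrite /up /dn addrK. Qed.

Lemma dnK j : cancel (dn j) (up j).
Proof. by move=> z; apply/funext => i; rewrite /up /dn subrK. Qed.

Lemma strip_ge0 m z i : strip m z -> 0 <= z i.
Proof.
move=> hz; have aux n : z (n + i)%N <= z i.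
  by elim: n => // n; apply: le_trans; exact: (hz _).1.
by have := aux m; rewrite (hz _).2 // leq_addr.
Qed.

Lemma strip_le0 m z i : strip m z -> z i <= z 0%N.
Proof. by move=> hz; elim: i => // n; apply: le_trans; exact: (hz _).1. Qed.

Section Moves.
Variables (m m' : nat) (y z : parts).
Hypotheses (hz : strip m z) (hy : strip m' y).

Ltac moves i j :=
  rewrite /up /dn /= ?eqSS;
  have [?|/negPf ?] := eqVneq i j; have [?|/negPf ?] := eqVneq i.+1 j;
  have [?|/negPf ?] := eqVneq i j.+1; subst; rewrite ?eqxx; lia.

Lemma strip_shift (e : nat -> int) (j n : nat) (x : parts) : strip n x -> (j < n)%N ->
  (forall i, x i.+1 + e i.+1 <= x i + e i) -> (forall i, i != j -> e i = 0) ->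
  strip n (fun i => x i + e i).
Proof.
move=> hx jn dec e0 i; split=> // ni.
by rewrite (hx i).2 // e0 ?add0r //; apply: contraTneq jn => <-; rewrite -leqNgt.
Qed.

Lemma strip_up j n x : strip n x -> (j < n)%N ->
  (forall i, up j x i.+1 <= up j x i) -> strip n (up j x).
Proof.
by move=> hx jn dec; apply: (strip_shift _ j) => // i /negPf ->.
Qed.

Lemma strip_dn j n x : strip n x -> (j < n)%N ->
  (forall i, dn j x i.+1 <= dn j x i) -> strip n (dn j x).
Proof.
by move=> hx jn dec; apply: (strip_shift _ j) => // i /negPf ->.
Qed.

(** Nothing lies above the largest entry, so this move is never blocked; it is the one upward move
    of [z] without a partner among the downward moves of [y]. *)
Lemma move_up0 : ilace y z -> (0 < m)%N -> strip m (up 0 z) /\ ilace y (up 0 z).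
Proof.
move=> yz m0; split; first apply: strip_up => //; move=> i;
  have := yz i; have [+ _] := hz i; clear; moves i 0%N.
Qed.

(** Raising entry j+1 of [z] and lowering entry j of [y] ([move_dny]) are blocked by the same
    equality, and so are lowering entry j of [z] and raising entry j of [y] ([move_dnz],
    [move_upy]). These pairs cancel in [two_level]. *)
Lemma move_upS j : ilace y z -> (j.+1 < m)%N ->
  (strip m (up j.+1 z) /\ ilace y (up j.+1 z)) <-> z j.+1 < y j.
Proof.
move=> yz jm; split; first by case=> _ /(_ j); rewrite /up eqxx; lia.
move=> h; split; first apply: strip_up => //; move=> i;
  have := yz i; have [+ _] := hz i; move: h; clear; moves i j.
Qed.

Lemma move_dny j : ilace y z -> (j < m')%N ->
  (strip m' (dn j y) /\ ilace (dn j y) z) <-> z j.+1 < y j.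
Proof.
move=> yz jm; split; first by case=> _ /(_ j); rewrite /dn eqxx; lia.
move=> h; split; first apply: strip_dn => //; move=> i;
  have := yz i; have := yz i.+1; have [+ _] := hy i; move: h; clear; moves i j.
Qed.

Lemma move_dnz j : ilace y z -> (j < m)%N ->
  (strip m (dn j z) /\ ilace y (dn j z)) <-> y j < z j.
Proof.
move=> yz jm; split; first by case=> _ /(_ j); rewrite /dn eqxx; lia.
move=> h; split; first apply: strip_dn => //; move=> i;
  have := yz i; have [+ _] := hz i; move: h; clear; moves i j.
Qed.

Lemma move_upy j : ilace y z -> (j < m')%N ->
  (strip m' (up j y) /\ ilace (up j y) z) <-> y j < z j.
Proof.
move=> yz jm; split; first by case=> _ /(_ j); rewrite /up eqxx; lia.
move=> h; split; first apply: strip_up => //; move=> i;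
  have := yz i; have := yz i.+1; have [+ _] := hy i; move: h; clear; moves i j.
Qed.

(** Pairs that do not interlace enter the sums when a move repairs them. A unit move repairs only
    one violated inequality, missed by exactly one, so a repair by moving [z] goes with a repair by
    moving [y]; see [break_up_dn] and [break_dn_up]. *)
Lemma break_up j : ~ ilace y z -> ilace y (up j z) -> y j = z j + 1.
Proof.
move=> nyz hu; apply/eqP; apply: contra_notT nyz => ne i.
move: ne; have := hu i; clear; moves i j.
Qed.

Lemma break_dny j : ~ ilace y z -> ilace (dn j y) z -> y j = z j + 1.
Proof.
move=> nyz hu; apply/eqP; apply: contra_notT nyz => ne i.
move: ne; have := hu i; clear; moves i j.
Qed.

Lemma break_dnz j : ~ ilace y z -> ilace y (dn j.+1 z) -> z j.+1 = y j + 1.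
Proof.
move=> nyz hu; apply/eqP; apply: contra_notT nyz => ne i.
move: ne; have := hu i; clear; moves i j.
Qed.

Lemma break_upy j : ~ ilace y z -> ilace (up j y) z -> z j.+1 = y j + 1.
Proof.
move=> nyz hu; apply/eqP; apply: contra_notT nyz => ne i.
move: ne; have := hu i; clear; moves i j.
Qed.

(** The largest entry occurs only as an upper bound, so lowering it repairs nothing. *)
Lemma break_dnz0 : ~ ilace y z -> ~ ilace y (dn 0 z).
Proof.
move=> nyz hu; apply: nyz => i; have := hu i; clear; moves i 0%N.
Qed.

Lemma break_up_dn j : ~ ilace y z -> (j < m)%N -> (j < m')%N ->
  (strip m (up j z) /\ ilace y (up j z)) <-> (strip m' (dn j y) /\ ilace (dn j y) z).
Proof.
move=> nyz jm jm'; split=> -[sh h].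
  have e := break_up j nyz h.
  split; first apply: strip_dn => //; move=> i; have := h i; have := h i.+1;
  have [+ _] := hz i; have [+ _] := hy i; move: e; clear; moves i j.
have e := break_dny j nyz h.
split; first apply: strip_up => //; move=> i; have := h i; have := h i.+1;
  have [+ _] := hz i; have [+ _] := hy i; move: e; clear; moves i j.
Qed.

Lemma break_dn_up j : ~ ilace y z -> (j.+1 < m)%N -> (j < m')%N ->
  (strip m (dn j.+1 z) /\ ilace y (dn j.+1 z)) <-> (strip m' (up j y) /\ ilace (up j y) z).
Proof.
move=> nyz jm jm'; split=> -[sh h].
  have e := break_dnz j nyz h.
  split; first apply: strip_up => //; move=> i; have := h i; have := h i.+1;
  have [+ _] := hz i; have [+ _] := hz i.+1;
  have [+ _] := hy i; move: e; clear; moves i j.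
have e := break_upy j nyz h.
split; first apply: strip_dn => //; move=> i; have := h i; have := h i.+1;
  have [+ _] := hz i; have [+ _] := hz i.+1; have [+ _] := hy i; have [+ _] := hy j; move: e; clear; moves i j.
Qed.

End Moves.

Definition box (m : nat) (N : int) : set parts := [set y | strip m y /\ y 0%N <= N].

Lemma finite_box m N : finite_set (box m N).
Proof.
pose F (f : {ffun 'I_m -> 'I_(absz N).+1}) : parts :=
  fun i => if insub i is Some o then (f o : nat)%:Z else 0.
apply: (@sub_finite_set _ _ (F @` [set: {ffun 'I_m -> 'I_(absz N).+1}])); last first.
  exact: finite_image.
move=> y [hy yN]; exists [ffun o : 'I_m => inord (absz (y o))]; first by [].
apply/funext => i; rewrite /F; case: insubP => [u _ <-|].
  have ? := strip_ge0 m y u hy; have ? := strip_le0 m y u hy.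
  by rewrite ffunE inordK /=; lia.
by rewrite -leqNgt => mi; rewrite (hy i).2.
Qed.

Definition wsum (k : nat) (z : parts) : int := \sum_(i < k) z i.

Lemma wsum_up k j z : (j < k)%N -> wsum k (up j z) = wsum k z + 1.
Proof.
move=> jk; rewrite /wsum big_split /=; congr (_ + _).
rewrite (bigD1 (Ordinal jk)) //= eqxx big1 ?addr0 // => i /negPf.
by rewrite -val_eqE /= => ->.
Qed.

Lemma wsum_dn k j z : (j < k)%N -> wsum k (dn j z) = wsum k z - 1.
Proof. by move=> jk; rewrite -{2}(dnK j z) wsum_up // addrK. Qed.

(** * Intertwining across a single level *)

Section TwoLevel.
Variables (R : realType) (k : nat).

Definition lower (m' : nat) (z : parts) : set parts := [set y | strip m' y /\ ilace y z].

(** [g] sees the row below together with the largest entry of [z], the only part of [z] that the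
    edge records. *)
Definition branch (m' : nat) (v : R) (g : parts -> int -> R) (z : parts) : R :=
  \sum_(y \in lower m' z) v ^ (wsum k z - wsum k y) * g y (z 0%N).

Definition nbsum (m : nat) (F : parts -> R) (z : parts) : R :=
  \sum_(j < m) (`[< strip m (up j z) >]%:R * F (up j z)
                + `[< strip m (dn j z) >]%:R * F (dn j z)).

Lemma sum_box m N (B : set parts) (F : parts -> R) : B `<=` box m N ->
  \sum_(y \in B) F y = \sum_(y <- fset_set (box m N)) `[< B y >]%:R * F y.
Proof.
move=> sB; transitivity (\sum_(y \in B) `[< B y >]%:R * F y).
  by apply: eq_fsbigr => y; rewrite inE => By; rewrite asboolT // mul1r.
apply: fsbig_fwiden => //=.
- by move=> y /sB yB; rewrite /= in_fset_set ?inE //; exact: finite_box.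
- by move=> y [_ nB] /=; rewrite asboolF // mul0r.
Qed.

Lemma lower_box m z : lower m z `<=` box m (z 0%N).
Proof. by move=> y [hy yz]; split=> //; case/andP: (yz 0%N). Qed.

Lemma box_le m N N' : N <= N' -> box m N `<=` box m N'.
Proof. by move=> le y [hy yN]; split=> //; exact: le_trans le. Qed.

(** With the moved row as summation variable, the move becomes a factor [v] in the weight. The moved
    row may exceed z_0 by one, whence the larger box. *)
Lemma shift_up (m' j : nat) (v : R) (F : parts -> R) z : v != 0 -> (j < k)%N ->
  \sum_(y \in lower m' z) `[< strip m' (up j y) >]%:R *
     (v ^ (wsum k z - wsum k y) * F (up j y))
  = \sum_(y <- fset_set (box m' (z 0%N + 1)))
      `[< strip m' y >]%:R * `[< strip m' (dn j y) /\ ilace (dn j y) z >]%:R *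
        (v ^ (wsum k z - wsum k y) * (v * F y)).
Proof.
move=> v0 jk.
pose B := [set y | strip m' y /\ strip m' (dn j y) /\ ilace (dn j y) z].
transitivity (\sum_(y \in B) v ^ (wsum k z - wsum k y) * (v * F y)); last first.
  rewrite (@sum_box m' (z 0%N + 1)).
    by apply: eq_bigr => y _; rewrite /B /= asbool_and -mulnb natrM.
  by move=> y [hy [_ /(_ 0%N)]]; rewrite /dn; split => //; lia.
rewrite [RHS](reindex_fsbig (up j) (lower m' z `&` [set y | strip m' (up j y)])).
  rewrite [RHS]fsbig_mkcondr; apply: eq_fsbigr => y _.
  case: ifPn; rewrite ?inE ?notin_setE /= => h; last by rewrite asboolF // mul0r.
  rewrite asboolT // mul1r wsum_up // mulrA opprD addrA; congr (_ * _).
  by rewrite -{3}(expr1z v) -expfzDr // subrK.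
split=> [y [[hy yz]] /= uy | y y' _ _ /(can_inj (upK j)) // | y [hy [hd hi]]].
  by split => //; rewrite upK.
by exists (dn j y); rewrite ?dnK //; split => //=; rewrite dnK.
Qed.

Lemma shift_dn (m' j : nat) (v : R) (F : parts -> R) z : v != 0 -> (j < k)%N ->
  \sum_(y \in lower m' z) `[< strip m' (dn j y) >]%:R *
     (v ^ (wsum k z - wsum k y) * F (dn j y))
  = \sum_(y <- fset_set (box m' (z 0%N + 1)))
      `[< strip m' y >]%:R * `[< strip m' (up j y) /\ ilace (up j y) z >]%:R *
        (v ^ (wsum k z - wsum k y) * (v^-1 * F y)).
Proof.
move=> v0 jk.
pose B := [set y | strip m' y /\ strip m' (up j y) /\ ilace (up j y) z].
transitivity (\sum_(y \in B) v ^ (wsum k z - wsum k y) * (v^-1 * F y)); last first.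
  rewrite (@sum_box m' (z 0%N + 1)).
    by apply: eq_bigr => y _; rewrite /B /= asbool_and -mulnb natrM.
  by move=> y [hy [_ /(_ 0%N)]]; rewrite /up; split => //; lia.
rewrite [RHS](reindex_fsbig (dn j) (lower m' z `&` [set y | strip m' (dn j y)])).
  rewrite [RHS]fsbig_mkcondr; apply: eq_fsbigr => y _.
  case: ifPn; rewrite ?inE ?notin_setE /= => h; last by rewrite asboolF // mul0r.
  rewrite asboolT // mul1r wsum_dn // mulrA; congr (_ * _).
  by rewrite -[X in _ * X](exprN1 v) -expfzDr //; congr (_ ^ _); ring.
split=> [y [[hy yz]] /= uy | y y' _ _ /(can_inj (dnK j)) // | y [hy [hd hi]]].
  by split => //; rewrite dnK.
by exists (up j y); rewrite ?upK //; split => //=; rewrite upK.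
Qed.

(* The coefficient of [g y] on both sides of [two_level]. *)
Lemma coef_up (m' m : nat) (g0 g1 v : R) (y z : parts) :
  (m = m'.+1 \/ m = m') -> (0 < m)%N ->
  strip m z -> strip m' y -> (y 0%N = z 0%N + 1 -> g1 = g0) ->
  \sum_(j < m) `[< strip m (up j z) /\ ilace y (up j z) >]%:R
      * (v * (if (j == 0 :> nat) then g1 else g0))
  = \sum_(j < m') `[< strip m' (dn j y) /\ ilace (dn j y) z >]%:R * (v * g0)
    + `[< ilace y z >]%:R
      * (v * g1 - ((m == m') && (0 < y m.-1))%:R * (v * g0)).
Proof.
move=> mm m0 hz hy g10.
have [yz|nyz] := pselect (ilace y z).
  rewrite (asboolT yz) mul1r.
  case: m m0 mm hz => // m _ mm hz; rewrite big_ord_recl /=.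
  rewrite asboolT ?mul1r; last exact: move_up0.
  rewrite [RHS]addrC -addrA; congr (_ + _).
  under eq_bigr => j _.
    rewrite (asbool_equiv_eq (@move_upS m.+1 y z hz j yz _)); last by rewrite /bump ltnS.
    over.
  case: mm => [[mm]|mm]; subst m'.
    rewrite gtn_eqF // mul0r oppr0 add0r; apply: eq_bigr => j _.
    by rewrite (asbool_equiv_eq (@move_dny m y z hy j yz _)).
  rewrite eqxx big_ord_recr /=.
  rewrite (asbool_equiv_eq (@move_dny m.+1 y z hy m yz _)) // asboolb (hz m.+1).2 //.
  rewrite [RHS]addrC addrK; apply: eq_bigr => j _.
  rewrite (asbool_equiv_eq (@move_dny m.+1 y z hy j yz _)) //.
  by rewrite (leq_trans (ltn_ord j)).
rewrite (asboolF nyz) mul0r addr0.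
have E (j : nat) : (j < m)%N -> (j < m')%N ->
  `[< strip m (up j z) /\ ilace y (up j z) >]%:R * (v * (if j == 0%N then g1 else g0))
  = `[< strip m' (dn j y) /\ ilace (dn j y) z >]%:R * (v * g0).
  move=> jm jm'; rewrite -(asbool_equiv_eq (@break_up_dn m m' y z hz hy j nyz jm jm')).
  (* A repair at index 0 means y_0 = z_0 + 1, where [g10] identifies the two values of [g]. *)
  case: asboolP => [[_ h]|_]; rewrite ?mul0r // !mul1r; case: eqP => // j0.
  by rewrite g10 // -j0; apply: break_up.
case: mm => mm; subst m; last by apply: eq_bigr => j _; rewrite E.
rewrite big_ord_recr /= [X in _ + X](_ : _ = 0) ?addr0.
  by apply: eq_bigr => j _; rewrite E // (leq_trans (ltn_ord j)).
rewrite asboolF ?mul0r // => -[_ h]; have := break_up _ _ _ nyz h.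
by have := strip_ge0 _ _ m' hz; rewrite (hy m').2 //; lia.
Qed.

(** Entries of equal index are partners here. What is left over is the effect on [g] of lowering z_0
    and, when [z] is the longer row, the last entry of [z], which can go down as long as it is
    positive. *)
Lemma coef_dn (m' m : nat) (g0 g1 v : R) (y z : parts) :
  (m = m'.+1 \/ m = m') -> (0 < m)%N ->
  strip m z -> strip m' y ->
  \sum_(j < m) `[< strip m (dn j z) /\ ilace y (dn j z) >]%:R
      * (v * (if (j == 0 :> nat) then g1 else g0))
  = \sum_(j < m') `[< strip m' (up j y) /\ ilace (up j y) z >]%:R * (v * g0)
    + `[< ilace y z >]%:R
      * (v * (y 0%N < z 0%N)%R%:R * (g1 - g0) + ((m == m'.+1) && (0 < z m.-1))%:R * (v * g0)).
Proof.
move=> mm m0 hz hy.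
have [yz|nyz] := pselect (ilace y z).
  rewrite (asboolT yz) mul1r.
  under eq_bigr => j _ do rewrite (asbool_equiv_eq (@move_dnz m y z hz j yz _)) // asboolb.
  under [in RHS]eq_bigr => j _ do
    rewrite (asbool_equiv_eq (@move_upy m' y z hy j yz _)) // asboolb.
  have -> : \sum_(j < m) (y j < z j)%R%:R * (v * (if (j == 0 :> nat) then g1 else g0))
     = \sum_(j < m) (y j < z j)%R%:R * (v * g0) + v * (y 0%N < z 0%N)%R%:R * (g1 - g0).
    case: m m0 {mm hz} => // m _; rewrite !big_ord_recl /=; ring.
  rewrite [RHS]addrCA [LHS]addrC; congr (_ + _).
  case: mm => mm; subst m; last by rewrite ltn_eqF // mul0r addr0.
  by rewrite big_ord_recr /= eqxx /= (hy m').2.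
rewrite (asboolF nyz) mul0r addr0.
case: m m0 mm hz => // m _ mm hz; rewrite big_ord_recl /=.
rewrite asboolF ?mul0r ?add0r; last by case=> _; exact: break_dnz0.
have E (j : nat) : (j < m)%N -> (j < m')%N ->
  `[< strip m.+1 (dn j.+1 z) /\ ilace y (dn j.+1 z) >]%:R * (v * g0)
  = `[< strip m' (up j y) /\ ilace (up j y) z >]%:R * (v * g0).
  by move=> jm jm'; rewrite -(asbool_equiv_eq (@break_dn_up m.+1 m' y z hz hy j nyz jm jm')).
case: mm => mm; first by case: mm => mm; subst m'; apply: eq_bigr => j _; rewrite E.
subst m'; rewrite [RHS]big_ord_recr /= [X in _ + X](_ : _ = 0) ?addr0.
  by apply: eq_bigr => j _; rewrite E // (leq_trans (ltn_ord j)).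
rewrite asboolF ?mul0r // => -[_ h]; have := break_upy _ _ _ nyz h.
by have := strip_ge0 _ _ m hy; rewrite (hz m.+1).2 //; lia.
Qed.

Lemma mem_box m N y : (y \in fset_set (box m N)) -> strip m y.
Proof. by rewrite in_fset_set ?inE; [case | exact: finite_box]. Qed.

Lemma branch_up m m' j v g z : v != 0 -> (j < k)%N ->
  `[< strip m (up j z) >]%:R * branch m' v g (up j z)
  = \sum_(y <- fset_set (box m' (z 0%N + 1)))
      v ^ (wsum k z - wsum k y) *
      (`[< strip m (up j z) /\ ilace y (up j z) >]%:R
        * (v * (if j == 0%N then g y (z 0%N + 1) else g y (z 0%N)))).
Proof.
move=> v0 jk; rewrite /branch (@sum_box m' (z 0%N + 1)).
  rewrite mulr_sumr; apply: eq_big_seq => y /mem_box hy.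
  rewrite /lower /= !asbool_and (asboolT hy) /=.
  rewrite mulrA -natrM mulnb wsum_up // addrAC expfzDr // expr1z.
  have -> : g y (up j z 0%N) = if j == 0%N then g y (z 0%N + 1) else g y (z 0%N).
    by rewrite /up eq_sym; case: eqP => _ //=; rewrite addr0.
  by ring.
move=> y [hy /(_ 0%N)/andP[_ h]]; split=> //; apply: le_trans h _.
by rewrite /up; case: eqP; lia.
Qed.

Lemma branch_dn m m' j v g z : v != 0 -> (j < k)%N ->
  `[< strip m (dn j z) >]%:R * branch m' v g (dn j z)
  = \sum_(y <- fset_set (box m' (z 0%N + 1)))
      v ^ (wsum k z - wsum k y) *
      (`[< strip m (dn j z) /\ ilace y (dn j z) >]%:R
        * (v^-1 * (if j == 0%N then g y (z 0%N - 1) else g y (z 0%N)))).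
Proof.
move=> v0 jk; rewrite /branch (@sum_box m' (z 0%N + 1)).
  rewrite mulr_sumr; apply: eq_big_seq => y /mem_box hy.
  rewrite /lower /= !asbool_and (asboolT hy) /=.
  rewrite mulrA -natrM mulnb wsum_dn // addrAC expfzDr // exprN1.
  have -> : g y (dn j z 0%N) = if j == 0%N then g y (z 0%N - 1) else g y (z 0%N).
    by rewrite /dn eq_sym; case: eqP => _ //=; rewrite subr0.
  by ring.
move=> y [hy /(_ 0%N)/andP[_ h]]; split=> //; apply: le_trans h _.
by rewrite /dn; case: eqP; lia.
Qed.

(** The hypothesis on [g] says that a top coordinate just below y_0 counts as y_0; it reconciles the
    two repairs at index 0. The last hypothesis balances the leaving rates of the two rows; its
    indicators account for the unpaired move of a last entry down to the wall at 0. *)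
Lemma two_level (m m' : nat) (v c : R) (c' : parts -> R) (g : parts -> int -> R) z :
  v != 0 -> (m = m'.+1 \/ m = m') -> (0 < m <= k)%N -> strip m z ->
  (forall y, strip m' y -> g y (y 0%N) = g y (y 0%N - 1)) ->
  (forall y, lower m' z y ->
     c + ((m == m') && (0 < y m.-1))%:R * v
     = c' y + v + ((m == m'.+1) && (0 < z m.-1))%:R * v^-1) ->
  nbsum m (branch m' v g) z - c * branch m' v g z
  = \sum_(y \in lower m' z) v ^ (wsum k z - wsum k y) *
     (nbsum m' (g^~ (z 0%N)) y - c' y * g y (z 0%N)
      + v * (g y (z 0%N + 1) - g y (z 0%N))
      + v^-1 * (y 0%N < z 0%N)%R%:R * (g y (z 0%N - 1) - g y (z 0%N))).
Proof.
move=> v0 mm /andP[m0 mk] hz hg hc.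
have m'k : (m' <= k)%N by case: mm => mm; lia.
set A := fset_set (box m' (z 0%N + 1)).
set wt := fun y => v ^ (wsum k z - wsum k y).
have lowA : lower m' z `<=` box m' (z 0%N + 1).
  by move=> y /lower_box; apply: box_le; lia.
have fin : finite_set (lower m' z) by apply: sub_finite_set lowA _; exact: finite_box.
have lhs : nbsum m (branch m' v g) z = \sum_(y <- A) wt y *
   (\sum_(j < m) (`[< strip m (up j z) /\ ilace y (up j z) >]%:R
        * (v * (if j == 0 :> nat then g y (z 0%N + 1) else g y (z 0%N))))
   + \sum_(j < m) (`[< strip m (dn j z) /\ ilace y (dn j z) >]%:R
        * (v^-1 * (if j == 0 :> nat then g y (z 0%N - 1) else g y (z 0%N))))).
  under [RHS]eq_bigr do rewrite -big_split mulr_sumr.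
  rewrite exchange_big /=; apply: eq_bigr => j _.
  have jk : (j < k)%N by apply: leq_trans (ltn_ord j) mk.
  by rewrite branch_up // branch_dn // -big_split; apply: eq_bigr => y _; rewrite mulrDr.
have rhs : \sum_(y \in lower m' z) wt y * nbsum m' (g^~ (z 0%N)) y
  = \sum_(y <- A) wt y *
   (\sum_(j < m') (`[< strip m' (dn j y) /\ ilace (dn j y) z >]%:R * (v * g y (z 0%N)))
   + \sum_(j < m') (`[< strip m' (up j y) /\ ilace (up j y) z >]%:R * (v^-1 * g y (z 0%N)))).
  under [RHS]eq_bigr do rewrite -big_split mulr_sumr.
  rewrite exchange_big /=.
  rewrite fsbig_finite //=; under eq_bigr do rewrite /nbsum mulr_sumr.
  rewrite exchange_big /=; apply: eq_bigr => j _.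
  have jk : (j < k)%N by apply: leq_trans (ltn_ord j) m'k.
  have := @shift_up m' j v (g^~ (z 0%N)) z v0 jk.
  have := @shift_dn m' j v (g^~ (z 0%N)) z v0 jk.
  rewrite !fsbig_finite //= -/A => E2 E1.
  under eq_bigr do rewrite mulrDr mulrCA [X in _ + X]mulrCA.
  rewrite big_split /= E1 E2 -big_split /=; apply: eq_big_seq => y /mem_box hy.
  by rewrite (asboolT hy) !mul1r /wt mulrDr; congr (_ + _); rewrite mulrCA.
rewrite lhs [X in _ - c * X](@sum_box m' (z 0%N + 1)) // -/A.
transitivity (\sum_(y \in lower m' z) wt y * nbsum m' (g^~ (z 0%N)) y +
  \sum_(y \in lower m' z) wt y * (- c' y * g y (z 0%N)
      + v * (g y (z 0%N + 1) - g y (z 0%N))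
      + v^-1 * (y 0%N < z 0%N)%R%:R * (g y (z 0%N - 1) - g y (z 0%N)))); last first.
  rewrite !fsbig_finite //= -big_split; apply: eq_bigr => y _ /=.
  by rewrite /wt -mulrDr; congr (_ * _); ring.
rewrite rhs [X in _ = _ + X](@sum_box m' (z 0%N + 1)) // -/A mulr_sumr -sumrB -big_split /=.
apply: eq_big_seq => y /mem_box hy.
rewrite (@coef_up m' m (g y (z 0%N))) //; last by move=> e; rewrite -e hg // e addrK.
rewrite (@coef_dn m' m (g y (z 0%N))) //.
have [yz|nyz] := pselect (ilace y z); last first.
  rewrite (asboolF nyz) asboolF; last by case.
  by rewrite !mul0r !addr0 mulr0 subr0.
have /hc {}hc : lower m' z y by split.
rewrite (asboolT yz) asboolT; last by split.
move: hc; set b1 := ((_ && _)%:R : R); set b2 := ((_ && _)%:R : R).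
set s1 := \sum_(_ < _) _; set s2 := \sum_(_ < _) _; rewrite /wt => hc.
have -> : c = c' y + v + b2 * v^-1 - b1 * v by rewrite -hc addrK.
ring.
Qed.

End TwoLevel.
Arguments branch {R} k m' v g z.
Arguments nbsum {R} m F z.

(** * The right edge of a pattern *)

Section Edge.
Variables (R : realType) (k : nat) (a : nat -> R).
Hypothesis a_gt0 : forall i, 0 < a i.

(* Levels are counted from 0, so that [vel n] is the jump rate to the right, and its
   inverse the jump rate to the left, of the edge coordinate of row x^(n+1). *)
Definition vel (n : nat) : R := if odd n then (a n./2)^-1 else a n./2.

(** On edges of patterns the maximum is just [b]. It matters when the lower level has jumped above
    [b], and it supplies the hypothesis on [g] in [two_level]. *)
Definition lift_edge (f : seq int -> R) (b : int) (x : seq int) : R :=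
  f (Num.max b (head 0 x) :: x).

Fixpoint edge_sum (n : nat) (f : seq int -> R) (z : parts) : R :=
  if n is n'.+1 then
    branch k (uphalf n') (vel n') (fun y b => edge_sum n' (lift_edge f b) y) z
  else f [::].

(* The edge is listed from its highest level down.  A coordinate jumping to the right
   pushes those above it ([lift_edge]), and one jumping to the left is blocked by the
   coordinate below it. *)
Fixpoint edge_gen (n : nat) (f : seq int -> R) (x : seq int) : R :=
  match n, x with
  | n'.+1, b :: x' => edge_gen n' (lift_edge f b) x'
      + vel n' * (f (b + 1 :: x') - f (b :: x'))
      + (vel n')^-1 * (f (Num.max (b - 1) (head 0 x') :: x') - f (b :: x'))
  | _, _ => 0
  end.

Fixpoint is_edge (n : nat) (x : seq int) : bool :=
  match n, x with
  | 0, [::] => true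
  | n'.+1, b :: x' => (head 0 x' <= b) && is_edge n' x'
  | _, _ => false
  end.

Lemma vel_gt0 n : 0 < vel n.
Proof. by rewrite /vel; case: ifP => _ //; rewrite invr_gt0. Qed.

Lemma eq_branch m v (g g' : parts -> int -> R) z :
  (forall y, lower m z y -> g y (z 0%N) = g' y (z 0%N)) ->
  branch k m v g z = branch k m v g' z.
Proof. by move=> e; apply: eq_fsbigr => y; rewrite inE => /e ->. Qed.

Lemma finite_lower m z : finite_set (lower m z).
Proof. by apply: sub_finite_set (@lower_box _ _) _; exact: finite_box. Qed.

(** Along a pattern the largest entries increase with the level and end in z_0, so other values of
    [f] are never read. This is the support property of Gamma. *)
Lemma eq_edge_sum n f f' z : strip (uphalf n) z ->
  (forall x, is_edge n x -> head 0 x = z 0%N -> f x = f' x) ->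
  edge_sum n f z = edge_sum n f' z.
Proof.
elim: n f f' z => [|n IH] f f' z hz e /=; first by apply: e => //=; rewrite (hz 0%N).2.
apply: eq_branch => y [hy yz]; apply: IH => // x ex hx; apply: e => /=.
  by rewrite ex le_max lexx orbT.
by rewrite hx; case/andP: (yz 0%N) => _ ?; rewrite max_l.
Qed.

Lemma edge_sumD n f g z :
  edge_sum n (fun x => f x + g x) z = edge_sum n f z + edge_sum n g z.
Proof.
elim: n f g z => [|n IH] f g z //=.
rewrite /branch !fsbig_finite /=; try exact: finite_lower.
rewrite -big_split /=; apply: eq_bigr => y _; rewrite -mulrDr; congr (_ * _).
exact: (IH (lift_edge f _) (lift_edge g _)).
Qed.

Lemma edge_sumZ n c f z : edge_sum n (fun x => c * f x) z = c * edge_sum n f z.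
Proof.
elim: n f z => [|n IH] f z //=.
rewrite /branch !fsbig_finite /=; try exact: finite_lower.
rewrite mulr_sumr; apply: eq_bigr => y _; rewrite mulrCA; congr (_ * _).
exact: (IH (lift_edge f _)).
Qed.

Lemma edge_sumB n f g z :
  edge_sum n (fun x => f x - g x) z = edge_sum n f z - edge_sum n g z.
Proof.
rewrite edge_sumD; congr (_ + _); rewrite -mulN1r -edge_sumZ.
by congr (edge_sum _ _ _); apply/funext => x; rewrite mulN1r.
Qed.

Lemma edge_sum_ge0 n f z : (forall x, 0 <= f x) -> 0 <= edge_sum n f z.
Proof.
elim: n f z => [|n IH] f z f0 //=.
apply: fsumr_ge0 => y _; rewrite mulr_ge0 ?IH //; last by move=> x; exact: f0.
by rewrite exprz_ge0 // ltW // vel_gt0.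
Qed.

Lemma edge_sum_gt0 n f z : (forall x, 0 < f x) -> strip (uphalf n) z -> 0 < edge_sum n f z.
Proof.
elim: n f z => [|n IH] f z f0 hz //=.
have pos y : lower (uphalf n) z y -> 0 < vel n ^ (wsum k z - wsum k y) *
  edge_sum n (lift_edge f (z 0%N)) y.
  move=> [hy _]; rewrite mulr_gt0 ?exprz_gt0 ?vel_gt0 // IH // => x; exact: f0.
(* Cutting [z] to the length of the row below gives one admissible row, hence one strictly positive
   term. *)
pose y : parts := fun i => if (i < uphalf n)%N then z i else 0.
have ly : lower (uphalf n) z y.
  split=> i; rewrite /y; have [d1 _] := hz i; have ? := strip_ge0 _ _ i hz.
    split; last by rewrite leqNgt => /negPf ->.
    have ? := strip_ge0 _ _ i.+1 hz.
    by case: ifP; case: ifP; lia.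
  have [_ d2] := hz i.+1; case: ifP => h; first by lia.
  by rewrite d2 ?lexx //; move: h; rewrite /= !uphalfE; lia.
rewrite /branch (fsbigD1 y _ _ (finite_lower _ _) ly).
by apply: ltr_pwDl (pos y ly) _; apply: fsumr_ge0 => u [/pos/ltW].
Qed.

Definition leave_sum i : R := \sum_(j < i) (a j + (a j)^-1).
(** The factor by which [nbsum] multiplies the sum of the weights. At odd levels the last entry
    cannot go down from 0, so it depends on the row; at even levels it is constant, as the leaving
    rate of the h-transform has to be. *)
Definition leave n (z : parts) : R :=
  leave_sum n./2 + (odd n)%:R * (a n./2 + (0 < z n./2)%R%:R * (a n./2)^-1).

Lemma edge_intertwining n f z : (n <= k.*2)%N -> strip (uphalf n) z ->
  nbsum (uphalf n) (edge_sum n f) z - leave n z * edge_sum n f z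
  = edge_sum n (edge_gen n f) z.
Proof.
elim: n f z => [|n IH] f z nk hz.
  by rewrite /nbsum /leave /leave_sum !big_ord0 /= !mul0r addr0 mul0r subr0.
have v0 : vel n != 0 by rewrite gt_eqF // vel_gt0.
rewrite /= (@two_level R k (uphalf n.+1) (uphalf n) (vel n) (leave n.+1 z) (leave n)) //.
- apply: eq_fsbigr => y; rewrite inE => -[hy yz]; congr (_ * _).
  rewrite IH //; last exact: ltnW.
  have yz0 : y 0%N <= z 0%N by case/andP: (yz 0%N).
  rewrite -edge_sumB -edge_sumZ -edge_sumB -edge_sumZ -!edge_sumD.
  apply: eq_edge_sum => // x ex hx; rewrite /lift_edge hx (max_l yz0) /=.
  rewrite (max_l (_ : y 0%N <= z 0%N + 1)); last by lia.
  rewrite -mulrA; congr (_ + _ * _).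
  (* If y_0 = z_0 the left jump is blocked: the maximum gives back z_0 and the difference
     vanishes. *)
  have [lt|ge] := ltP; first by rewrite mul1r.
  have -> : z 0%N = y 0%N by lia.
  by rewrite mul0r max_r ?subrr //; lia.
- by rewrite /= !uphalfE /=; case: (odd n) (odd_double_half n) => /=; lia.
- by rewrite /=; lia.
- move=> y hy; apply: eq_edge_sum => // x ex hx; rewrite /lift_edge hx.
  by rewrite maxxx max_r //; lia.
- move=> y [hy yz]; rewrite /leave /vel /=.
  have := odd_double_half n; case E: (odd n) => /= e.
    have -> : uphalf n = (n./2).+1 by rewrite uphalfE; lia.
    rewrite eqxx (ltn_eqF (ltnSn _)) /= !mul0r !addr0.
    by rewrite /leave_sum big_ord_recr /= mul1r; ring.
  have -> : uphalf n = n./2 by rewrite uphalfE; lia.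
  by rewrite eqxx (gtn_eqF (ltnSn _)) /= !mul0r !addr0 mul1r; ring.
Qed.

End Edge.

(** * Invariance under inversion of the weights *)

Section Symmetry.
Variables (R : realType) (k : nat).

Definition sp_sum (a : nat -> R) (n : nat) : parts -> R := edge_sum R k a n (fun=> 1).

Definition between (i : nat) (u z : parts) : set parts :=
  [set y | lower i.+1 z y /\ ilace u y].

Definition transfer (i : nat) (b : R) (u z : parts) : R :=
  \sum_(y \in between i u z) b ^ (2 * wsum k y - wsum k u - wsum k z).

(** Two levels are taken together because the involution keeps the even rows and reflects only the
    odd row between them. *)
Lemma sp_sumSS a i z : (forall j, a j != 0) -> strip i.+1 z ->
  sp_sum a i.+1.*2 z
  = \sum_(u <- fset_set (box i (z 0%N))) transfer i (a i) u z * sp_sum a i.*2 u.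
Proof.
move=> a0 hz; rewrite /sp_sum doubleS /=.
have -> : uphalf i.*2 = i by rewrite uphalf_double.
rewrite doubleK /vel /= odd_double /= uphalf_double doubleK.
rewrite /branch fsbig_finite; last exact: finite_lower.
under eq_big_seq => y.
  rewrite in_fset_set; last exact: finite_lower.
  rewrite inE => -[hy yz]; rewrite (@sum_box R i (z 0%N)); last first.
    move=> u /lower_box; apply: box_le; by case/andP: (yz 0%N).
  rewrite mulr_sumr; over.
rewrite exchange_big /=; apply: eq_big_seq => u /mem_box hu.
rewrite /transfer (@sum_box R i.+1 (z 0%N)); last first.
  by move=> y [/lower_box].
have finl := finite_lower i.+1 z.
rewrite -fsbig_finite // (@sum_box R i.+1 (z 0%N)); last by move=> y /lower_box.
rewrite mulr_suml; apply: eq_bigr => y _.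
rewrite /between /= asbool_and -mulnb natrM.
have -> : `[< lower i y u >] = `[< ilace u y >].
  by apply: asbool_equiv_eq; split=> [[]|].
rewrite -!mulrA; congr (_ * _); rewrite mulrCA; congr (_ * _).
rewrite mulrA; congr (_ * _).
rewrite exprz_inv -expfzDr //; congr (_ ^ _); ring.
Qed.

(* Given the rows [u] below and [z] above, the j-th entry of the row between them ranges
   over an interval with sum of end points [mirror u z j]; reflecting all entries is the
   Bender-Knuth involution. *)
Definition mirror (u z : parts) : parts := fun j =>
  Num.max (u j) (z j.+1) + (if j is j'.+1 then Num.min (z j) (u j') else z 0%N).

(** The end points of neighbouring intervals pair up, as max(u_j, z_{j+1}) + min(u_j, z_{j+1}) = u_j
    + z_{j+1}. *)
Lemma wsum_mirror i u z : (i < k)%N -> strip i u -> strip i.+1 z ->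
  wsum k (mirror u z) = wsum k u + wsum k z.
Proof.
move=> ik hu hz; case: k ik => // k' ik; rewrite /wsum big_split /=.
rewrite big_ord_recr /= (hz k'.+1).2 // max_l; last exact: strip_ge0 hu.
rewrite [X in _ + X = _]big_ord_recl /= [\sum_(j < k'.+1) u j]big_ord_recr /=.
rewrite [\sum_(j < k'.+1) z j]big_ord_recl /=.
have -> : \sum_(j < k') Num.max (u j) (z j.+1)
   = \sum_(j < k') u j + \sum_(j < k') z j.+1 - \sum_(j < k') Num.min (z (lift ord0 j)) (u j).
  rewrite -big_split -sumrB; apply: eq_bigr => j _ /=.
  by rewrite /bump /= add1n; lia.
rewrite [\sum_(j < k') z _](_ : _ = \sum_(j < k') z (lift ord0 j)); last first.
  by apply: eq_bigr => j _; rewrite /= /bump add1n.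
ring.
Qed.

Lemma between_mirror i u z y : strip i u -> strip i.+1 z ->
  between i u z y -> between i u z (fun j => mirror u z j - y j).
Proof.
move=> hu hz [[hy yz] uy].
have key j : Num.max (u j) (z j.+1) <= mirror u z j - y j <=
   (if j is j'.+1 then Num.min (z j) (u j') else z 0%N).
  rewrite /mirror; case: j => [|j].
    by have := yz 0%N; have := uy 0%N; lia.
  by have := yz j.+1; have := uy j.+1; have := uy j; lia.
have key' j : Num.max (u j) (z j.+1) <= mirror u z j - y j <= z j.
  by have := key j; case: j => // j; lia.
have key'' j : mirror u z j.+1 - y j.+1 <= u j by have := key j.+1; lia.
split; first split.
- move=> j; split; first by have := key' j; have := key'' j; lia.
  move=> ij; have := key' j; rewrite (hz j).2 // (hz j.+1).2; last exact: leqW.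
  by rewrite (hu j).2; [lia | exact: ltnW].
- by move=> j; have := key' j; lia.
- by move=> j; have := key' j; have := key'' j; lia.
Qed.

(** Reflection sends |y| to |u| + |z| - |y|, hence changes the sign of the exponent of [b]. *)
Lemma transfer_inv i (b : R) u z : (i < k)%N -> b != 0 -> strip i u -> strip i.+1 z ->
  transfer i b^-1 u z = transfer i b u z.
Proof.
move=> ik b0 hu hz; rewrite /transfer.
have inv y : (fun j => mirror u z j - (mirror u z j - y j)) = y.
  by apply/funext => j; ring.
rewrite (reindex_fsbig (fun (y : parts) j => mirror u z j - y j) (between i u z) (between i u z)).
  apply: eq_fsbigr => y _; rewrite exprz_inv; congr (_ ^ _).
  rewrite [wsum k (fun _ => _)](_ : _ = wsum k (mirror u z) - wsum k y); last first.
    by rewrite /wsum -sumrB.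
  by rewrite (wsum_mirror i) //; ring.
split=> [y|y y' _ _ e|y hy]; first exact: between_mirror.
  by apply/funext => j; have /= := congr1 (@^~ j) e; lia.
by exists (fun j => mirror u z j - y j); [exact: between_mirror|exact: inv].
Qed.

Lemma sp_sum_inv a i z : (forall j, a j != 0) -> (i <= k)%N -> strip i z ->
  sp_sum (fun j => (a j)^-1) i.*2 z = sp_sum a i.*2 z.
Proof.
move=> a0; elim: i z => // i IH z ik hz.
rewrite !sp_sumSS //; last by move=> j; rewrite invr_eq0.
apply: eq_big_seq => u /mem_box hu.
by rewrite IH ?transfer_inv // ltnW.
Qed.

End Symmetry.

(** * Symplectic Schur functions *)

Definition rev_row (s : seq int) : parts := fun i => nth 0 (rev s) i.

Lemma rev_row_ge (s : seq int) i : (size s <= i)%N -> rev_row s i = 0.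
Proof. by move=> h; rewrite /rev_row nth_default // size_rev. Qed.

Lemma rev_rowE (s : seq int) i : (i < size s)%N -> rev_row s i = nth 0 s (size s - i.+1).
Proof. by move=> h; rewrite /rev_row nth_rev. Qed.

Lemma rev_row_inj (s t : seq int) : size s = size t -> rev_row s = rev_row t -> s = t.
Proof.
move=> st e; apply: (can_inj revK); apply: (@eq_from_nth _ 0); rewrite ?size_rev //.
by move=> i _; exact: (congr1 (@^~ i) e).
Qed.

Definition nat_row (s : seq nat) : parts := rev_row (map Posz s).

Lemma nat_rowE s i : (i < size s)%N -> nat_row s i = (nth 0%N s (size s - i.+1))%:Z.
Proof.
move=> h; rewrite /nat_row rev_rowE size_map // (nth_map 0%N) //.
by rewrite ltn_subrL; case: (size s) h.
Qed.

Lemma nat_row_ge s i : (size s <= i)%N -> nat_row s i = 0.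
Proof. by move=> h; rewrite /nat_row rev_row_ge // size_map. Qed.

Lemma nat_row_ge0 s i : 0 <= nat_row s i.
Proof.
by have [h|h] := ltnP i (size s); [rewrite nat_rowE | rewrite nat_row_ge].
Qed.

Lemma wsum_rev_row k s : (size s <= k)%N -> wsum k (rev_row s) = \sum_(x <- s) x.
Proof.
move=> sk; rewrite -[RHS](@big_rev _ 0 +%R) /= /wsum.
rewrite -(@big_mkord _ _ _ k xpredT (rev_row s)) (big_cat_nat (n := size s)) //=.
rewrite [X in _ + X](_ : _ = 0) ?addr0; last first.
  by rewrite big_nat_cond big1 // => i; rewrite andbT => /andP[h _]; rewrite rev_row_ge.
by rewrite [RHS](big_nth 0) size_rev.
Qed.

Lemma wsum_nat_row k s : (size s <= k)%N -> wsum k (nat_row s) = (sumn s)%:Z.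
Proof.
move=> sk; rewrite /nat_row wsum_rev_row ?size_map // big_map.
by elim: s {sk} => [|x s IH]; rewrite ?big_nil // big_cons IH.
Qed.

(** For reversed rows padded by zeros, the two interlacing relations of a symplectic pattern become
    the single relation [ilace]; the parity of the level enters only through the length of the
    row. *)
Definition pattern_chain (n : nat) (x : seq (seq nat)) : Prop :=
  size x = n /\ forall j, (j < n)%N ->
    size (level x j.+1) = uphalf j.+1
    /\ ilace (nat_row (level x j)) (nat_row (level x j.+1)).

Lemma interlace_eqP (s t : seq nat) : size s = size t ->
  interlace_eq s t <-> ilace (nat_row s) (nat_row t).
Proof.
move=> st; split=> [[h1 h2] j|h].
  have [js|sj] := ltnP j (size s); last by rewrite !nat_row_ge -?st // ltnW.
  rewrite (nat_rowE s) // (nat_rowE t j) -?st //.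
  have [js1|] := ltnP j.+1 (size s); last first.
    by move=> h; rewrite nat_row_ge -?st //=; rewrite lez_nat h1 //; lia.
  rewrite nat_rowE -?st // !lez_nat h1 ?andbT; last by lia.
  by have := h2 (size s - j.+2)%N; rewrite (_ : (_ - _).+1 = (size s - j.+1)%N); [apply|]; lia.
split=> i hi.
  have := h (size s - i.+1)%N; rewrite (nat_rowE s) ?(@nat_rowE t (_ - _)) -?st; try lia.
  by rewrite (_ : (size s - (size s - i.+1).+1)%N = i); lia.
have := h (size s - i.+2)%N; rewrite (nat_rowE s) ?(@nat_rowE t) -?st; try lia.
rewrite (_ : (size s - (size s - i.+2).+1)%N = i.+1); last by lia.
by rewrite (_ : (size s - (size s - i.+2).+2)%N = i); lia.
Qed.

Lemma interlace_ltP (s t : seq nat) : size t = (size s).+1 ->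
  interlace_lt s t <-> ilace (nat_row s) (nat_row t).
Proof.
move=> st; split=> [h j|h i hi].
  have [js|sj] := ltnP j (size s); last first.
    by rewrite (nat_row_ge s) // (nat_row_ge t) ?st ?nat_row_ge0.
  rewrite !nat_rowE ?st //; last exact: leqW.
  have := h (size s - j.+1)%N; rewrite (_ : (_ - _).+1 = ((size s).+1 - j.+1)%N); last by lia.
  by rewrite (_ : ((size s).+1 - j.+2)%N = (size s - j.+1)%N); lia.
have := h (size s - i.+1)%N; rewrite (nat_rowE s) ?(@nat_rowE t) ?st; try lia.
rewrite (_ : (size s - (size s - i.+1).+1)%N = i); last by lia.
rewrite (_ : ((size s).+1 - (size s - i.+1).+2)%N = i); last by lia.
by rewrite (_ : ((size s).+1 - (size s - i.+1).+1)%N = i.+1); lia.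
Qed.

Lemma symplectic_patternP k x : symplectic_pattern k x <-> pattern_chain k.*2 x.
Proof.
split=> [[sx h1 h2 h3]|[sx h]].
  split=> // j; have [[i ->] jk|[i ->] jk] : (exists i, j = i.*2.+1) \/ (exists i, j = i.*2).
    by have := odd_double_half j; case: (odd j) => e; [left|right]; exists j./2; lia.
    have [s1 s2] := h1 i.+1 ltac:(lia); have := h2 i.+1 ltac:(lia).
    move: s1 s2; rewrite doubleS => s1 s2.
    rewrite interlace_eqP; last by rewrite s1.
    by move=> il; split=> //; rewrite s2 /= uphalf_double.
  have [s1 _] := h1 i.+1 ltac:(lia); rewrite doubleS /= in s1.
  split; first by rewrite s1 /= doubleK.
  have [i0|i0] := posnP i.
    rewrite i0 in s1 *; apply/interlace_ltP; first by rewrite s1.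
    by move=> l.
  have [_ s2] := h1 i ltac:(lia).
  by apply/interlace_ltP; rewrite ?s2 ?s1 //; apply: h3; lia.
have sz i : (0 < i <= k)%N -> size (level x i.*2.-1) = i /\ size (level x i.*2) = i.
  case: i => // i /= hi; rewrite doubleS /=; split.
    by have [-> _] := h i.*2 ltac:(lia); rewrite /= doubleK.
  by have [-> _] := h i.*2.+1 ltac:(lia); rewrite /= uphalf_double.
split=> //.
- move=> i hi; have [s1 s2] := sz i hi; apply/interlace_eqP; first by rewrite s1 s2.
  by case: i hi {s1 s2} => // i hi; have [_] := h i.*2.+1 ltac:(lia).
- move=> i hi; have [_ s2] := sz i ltac:(lia); have [s1 _] := sz i.+1 ltac:(lia).
  apply/interlace_ltP; first by rewrite s2 s1.
  by have [_] := h i.*2 ltac:(lia).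
Qed.

Lemma level_rcons x r j : (j <= size x)%N -> level (rcons x r) j = level x j.
Proof. by case: j => // j h; rewrite /level /= nth_rcons h. Qed.

Lemma level_rcons_last x r : level (rcons x r) (size x).+1 = r.
Proof. by rewrite /level /= nth_rcons ltnn eqxx. Qed.

Lemma strip_chain n x : pattern_chain n x -> strip (uphalf n) (nat_row (level x n)).
Proof.
case: n => [|n] [sx h]; first by move=> i; rewrite !nat_row_ge.
have [sz il] := h n (ltnSn n); move=> i; split.
  by case/andP: (il i); exact: le_trans.
by move=> ni; rewrite nat_row_ge // sz.
Qed.

Definition unrow (m : nat) (z : parts) : seq nat := rev (mkseq (absz \o z) m).

Lemma unrowK m z : strip m z -> nat_row (unrow m z) = z.
Proof.
move=> hz; apply/funext => i; rewrite /nat_row /rev_row /unrow map_rev revK.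
have [im|mi] := ltnP i m.
  by rewrite (nth_map 0%N) ?size_mkseq // nth_mkseq //=; have := strip_ge0 _ _ i hz; lia.
by rewrite nth_default ?size_map ?size_iota // (hz i).2.
Qed.

Section Chains.
Variables (R : realType) (k : nat) (a : nat -> R).
Hypothesis a_gt0 : forall i, 0 < a i.

Definition chain_weight (n : nat) (x : seq (seq nat)) : R :=
  \prod_(j < n) vel R a j ^ ((sumn (level x j.+1))%:Z - (sumn (level x j))%:Z).

Definition chains (n : nat) (z : parts) : set (seq (seq nat)) :=
  [set x | pattern_chain n x /\ nat_row (level x n) = z].

Definition subchains (n : nat) (z : parts) : set (seq (seq nat)) :=
  [set x | pattern_chain n x /\ ilace (nat_row (level x n)) z].

Definition extend (n : nat) (z : parts) (x : seq (seq nat)) := rcons x (unrow (uphalf n.+1) z).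

Lemma level_extend n z x : size x = n -> level (extend n z x) n.+1 = unrow (uphalf n.+1) z.
Proof. by move=> <-; exact: level_rcons_last. Qed.

Lemma extend_surj n z : chains n.+1 z `<=` extend n z @` subchains n z.
Proof.
move=> x [cx lx]; have sx := cx.1; have := strip_chain _ _ cx; rewrite lx => hz.
case/lastP: x cx lx sx => // x r cx lx; rewrite size_rcons => -[sx].
have [_ h] := cx.
have lr : level (rcons x r) n.+1 = r by rewrite -sx level_rcons_last.
rewrite lr in lx; exists x.
  split; first split => //.
    move=> j jn; have := h j (leqW jn).
    by rewrite !level_rcons ?sx // ltnW.
  by have [_] := h n (ltnSn n); rewrite lr lx level_rcons ?sx.
rewrite /extend; congr rcons.
have Posz_inj : injective Posz by move=> m m' [].
apply: (inj_map Posz_inj); apply: rev_row_inj.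
  by rewrite !size_map size_rev size_mkseq; have [<- _] := h n (ltnSn n); rewrite lr.
by rewrite -/(nat_row _) unrowK // -lx.
Qed.

Lemma finite_chains n z : finite_set (chains n z).
Proof.
elim: n z => [|n IH] z.
  apply: (@sub_finite_set _ _ [set [::]]); last exact: finite_set1.
  by move=> x [[/size0nil]].
apply: sub_finite_set (@extend_surj n z) _; apply: finite_image.
apply: (@sub_finite_set _ _ (\bigcup_(y in lower (uphalf n) z) chains n y)).
  move=> x [cx il]; exists (nat_row (level x n)) => //.
  by split => //; exact: strip_chain.
by apply: bigcup_finite => // ; exact: finite_lower.
Qed.

Lemma finite_subchains n z : finite_set (subchains n z).
Proof.
apply: (@sub_finite_set _ _ (\bigcup_(y in lower (uphalf n) z) chains n y)).
  move=> x [cx il]; exists (nat_row (level x n)) => //.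
  by split => //; exact: strip_chain.
by apply: bigcup_finite => [|y _]; [exact: finite_lower | exact: finite_chains].
Qed.

Lemma extend_bij n z : strip (uphalf n.+1) z ->
  set_bij (subchains n z) (chains n.+1 z) (extend n z).
Proof.
move=> hz; split; last exact: extend_surj; last first.
  by move=> x x' _ _ /rcons_inj[].
move=> x [[sx h] il] /=; have e := level_extend n z x sx.
split; last by rewrite e unrowK.
split=> [|j]; first by rewrite size_rcons sx.
rewrite ltnS leq_eqVlt => /orP[/eqP ->|jn].
  by rewrite e unrowK // level_rcons ?sx // /unrow size_rev size_mkseq.
by rewrite /extend !level_rcons ?sx //; [exact: h | exact: ltnW].
Qed.

(** Removing the last row is a bijection ([extend_bij]), so the sum over patterns unfolds into the
    recursion of [edge_sum]. *)
Lemma sum_chains n z : (n <= k.*2)%N -> strip (uphalf n) z ->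
  \sum_(x \in chains n z) chain_weight n x = sp_sum R k a n z.
Proof.
elim: n z => [|n IH] z nk hz.
  rewrite (_ : chains 0 z = [set [::]]) ?fsbig_set1 /chain_weight ?big_ord0 //.
  apply/seteqP; split=> [x [[/size0nil]] //|x -> /=]; split; first by split.
  by apply/funext => i; rewrite nat_row_ge // (hz i).2.
rewrite (reindex_fsbig (extend n z) (subchains n z)); last exact: extend_bij.
rewrite /sp_sum /= /branch.
have v0 : vel R a n != 0 by rewrite gt_eqF // vel_gt0.
(* Truncated patterns are sorted by their own last row [y]; for each of them one term of the inner
   sum is nonzero. *)
transitivity (\sum_(x \in subchains n z) \sum_(y \in lower (uphalf n) z)
   (if x \in chains n y then vel R a n ^ (wsum k z - wsum k y) * chain_weight n x else 0)).
  apply: eq_fsbigr => x; rewrite inE => -[cx il].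
  have [sx h] := cx.
  rewrite (fsbigD1 (nat_row (level x n))); first last.
  - by split=> //; exact: strip_chain.
  - exact: finite_lower.
  rewrite ifT ?inE // fsbig1 ?addr0 => [|y [_ /= ny]]; last first.
    by rewrite ifF //; apply/negP; rewrite inE => -[_ e]; apply: ny.
  rewrite /chain_weight big_ord_recr /= addr0 mulrC; congr (_ * _).
    rewrite level_extend // /extend level_rcons ?sx //.
    rewrite -(@wsum_nat_row k) ?unrowK ?size_rev ?size_mkseq //; last first.
      by move: nk; rewrite /= ; lia.
    rewrite -(@wsum_nat_row k) //; case: n {IH v0} cx nk h sx il hz => // n _ nk h _ _ _.
    by have [-> _] := h n (ltnSn n); move: nk; rewrite /=; lia.
  apply: eq_bigr => j _; rewrite /extend !level_rcons ?sx //; exact: ltnW.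
rewrite exchange_fsbig; [|exact: finite_subchains|exact: finite_lower].
apply: eq_fsbigr => y; rewrite inE => -[hy yz].
rewrite -[edge_sum _ _ _ _ _ _]/(sp_sum R k a n y) -IH //; last exact: ltnW.
rewrite mulr_fsumr -fsbig_mkcondr; apply: eq_fsbigl.
by apply/seteqP; split=> [x [_] //|x cx]; split=> //; case: cx => cx e; split=> //; rewrite e.
Qed.

End Chains.

Lemma pattern_weightE (R : realType) k (q : 'I_k -> R) (a : nat -> R) x :
  (forall i, a i != 0) -> (forall i : 'I_k, a i = q i) ->
  pattern_weight q x = chain_weight R a k.*2 x.
Proof.
move=> a0 aq; rewrite /pattern_weight /chain_weight.
transitivity (\prod_(i < k) a i ^ (2 * (sumn (level x i.*2.+1))%:Z
                       - (sumn (level x i.*2))%:Z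
                       - (sumn (level x i.*2.+2))%:Z)).
  by apply: eq_bigr => i _; rewrite aq.
elim: k {q aq} => [|k IH]; first by rewrite !big_ord0.
rewrite big_ord_recr doubleS !big_ord_recr /= {}IH -mulrA; congr (_ * _).
rewrite /vel /= odd_double /= uphalf_double doubleK exprz_inv -expfzDr //.
by congr (_ ^ _); ring.
Qed.

Definition chamber_row k (z : {ffun 'I_k -> int}) : parts := rev_row (codom z).

Lemma SpE (R : realType) k (q : 'I_k -> R) (a : nat -> R) (z : {ffun 'I_k -> int}) :
  (forall i, 0 < a i) -> (forall i : 'I_k, a i = q i) -> strip k (chamber_row k z) ->
  Sp q z = sp_sum R k a k.*2 (chamber_row k z).
Proof.
move=> a0 aq hz; rewrite /Sp -sum_chains ?uphalf_double //.
rewrite (eq_fsbigr (chain_weight R a k.*2)); last first.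
  by move=> x _; apply: pattern_weightE => // i; rewrite gt_eqF.
apply: eq_fsbigl; apply/seteqP; split=> x /=.
  by move=> [/symplectic_patternP cx e]; split=> //; rewrite /nat_row e.
move=> [cx e]; split; first exact/symplectic_patternP.
apply: rev_row_inj => //; rewrite size_map size_codom card_ord.
case: k q aq z hz cx e => // k q aq z hz cx _.
by have [-> _] := cx.2 k.*2.+1 ltac:(lia); rewrite /= uphalf_double.
Qed.

(** * Points of the chamber as rows, and their neighbours *)

Section ChamberRows.
Variable k : nat.
Implicit Type z : {ffun 'I_k -> int}.

Lemma chamber_rowE z (i : 'I_k) : chamber_row k z i = z (rev_ord i).
Proof.
rewrite /chamber_row rev_rowE size_codom card_ord //.
have h : (k - i.+1 < #|'I_k|)%N by rewrite card_ord; have := ltn_ord i; lia.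
by rewrite (nth_codom 0 z (Ordinal h)) enum_val_ord; congr (z _); apply: val_inj.
Qed.

Lemma chamber_row_ge z i : (k <= i)%N -> chamber_row k z i = 0.
Proof. by move=> h; rewrite /chamber_row rev_row_ge // size_codom card_ord. Qed.

Lemma strip_chamber_row z : in_chamber z <-> strip k (chamber_row k z).
Proof.
split=> [/andP[/forallP z0 /forallP zle] i|h].
  split; last exact: chamber_row_ge.
  have [ik|ki] := ltnP i k; last by rewrite !chamber_row_ge // ltnW.
  rewrite (chamber_rowE z (Ordinal ik)).
  have [ik1|ki1] := ltnP i.+1 k; last by rewrite chamber_row_ge.
  rewrite (chamber_rowE z (Ordinal ik1)).
  have /forallP/(_ (rev_ord (Ordinal ik)))/implyP := zle (rev_ord (Ordinal ik1)).
  by apply => /=; lia.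
have mono i j : (i <= j)%N -> chamber_row k z j <= chamber_row k z i.
  by move=> /subnK <-; elim: (j - i)%N => // n; apply: le_trans; exact: (h _).1.
apply/andP; split; apply/forallP => i.
  by rewrite -(rev_ordK i) -chamber_rowE (strip_ge0 k).
apply/forallP => j; apply/implyP => ij.
rewrite -(rev_ordK i) -(rev_ordK j) -!chamber_rowE; apply: mono => /=; lia.
Qed.

Lemma chamber_row_add z i :
  chamber_row k (z + basis_vec i) = up (rev_ord i) (chamber_row k z).
Proof.
apply/funext => j; rewrite /up.
have [jk|kj] := ltnP j k.
  rewrite !(chamber_rowE _ (Ordinal jk)) !ffunE; congr (_ + _).
  rewrite -natz; congr (_%:R); congr nat_of_bool.
  by rewrite -(inj_eq rev_ord_inj) rev_ordK -val_eqE.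
rewrite !chamber_row_ge //; case: eqP => //= e; move: kj; rewrite e.
by have := ltn_ord i; rewrite /=; lia.
Qed.

Lemma chamber_row_sub z i :
  chamber_row k (z - basis_vec i) = dn (rev_ord i) (chamber_row k z).
Proof. by rewrite -{2}(subrK (basis_vec i) z) chamber_row_add upK. Qed.

Definition nbrs (z : chamber k) : seq (chamber k) :=
  pmap insub ([seq val z + basis_vec i | i <- enum 'I_k]
              ++ [seq val z - basis_vec i | i <- enum 'I_k]).

Lemma mem_nbrs (z y : chamber k) : (y \in nbrs z) = neighbours (val z) (val y).
Proof.
rewrite mem_pmap_sub mem_cat /neighbours.
apply/orP/existsP => [[]/mapP[i _ e]|[i /orP[/eqP e|/eqP e]]].
- by exists i; rewrite e eqxx.
- by exists i; rewrite e eqxx orbT.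
- by left; apply/mapP; exists i; rewrite ?mem_enum.
- by right; apply/mapP; exists i; rewrite ?mem_enum.
Qed.

Lemma uniq_nbrs (z : chamber k) : uniq (z :: nbrs z).
Proof.
rewrite /= mem_nbrs; apply/andP; split.
  apply/existsP => -[i /orP[]/eqP/ffunP/(_ i)]; rewrite !ffunE eqxx mulr1n; move: (val z i) => x; lia.
apply: pmap_sub_uniq; rewrite cat_uniq; apply/and3P; split.
- by rewrite map_inj_uniq ?enum_uniq // => i j /addrI/basis_vec_inj.
- apply/hasPn => u /mapP[i _ ->]; apply/negP => /mapP[j _ /addrI /eqP].
  by rewrite eq_sym (negPf (basis_vec_neqN _ _)).
- by rewrite map_inj_uniq ?enum_uniq // => i j /addrI/oppr_inj/basis_vec_inj.
Qed.

(** Points outside the chamber are dropped by [insub] on the left and by the indicator of [strip] on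
    the right; chambers increase while rows decrease, whence [rev_ord]. *)
Lemma sum_nbrs (R : realType) (F : parts -> R) (z : chamber k) :
  \sum_(y <- nbrs z) F (chamber_row k (val y)) = nbsum k F (chamber_row k (val z)).
Proof.
have big_insub (s : seq {ffun 'I_k -> int}) :
  \sum_(y <- pmap insub s : seq (chamber k)) F (chamber_row k (val y))
  = \sum_(y <- s) `[< strip k (chamber_row k y) >]%:R * F (chamber_row k y).
  elim: s => [|y s IH]; rewrite ?big_nil //= big_cons.
  case: insubP => [u yu e|ny] /=.
    by rewrite big_cons IH e asboolT ?mul1r //; apply/strip_chamber_row.
  by rewrite asboolF ?mul0r ?add0r // => /strip_chamber_row; exact/negP.
rewrite big_insub big_cat /= !big_map -!enumT /nbsum big_split /=; congr (_ + _).
  rewrite big_enum (reindex_inj rev_ord_inj) /=; apply: eq_bigr => i _.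
  by rewrite chamber_row_add rev_ordK.
rewrite big_enum (reindex_inj rev_ord_inj) /=; apply: eq_bigr => i _.
by rewrite chamber_row_sub rev_ordK.
Qed.

End ChamberRows.
Arguments nbrs {k} z.

(** * The kernel Gamma and the generator of the h-transform *)

Section Dagger.
Variables (R : realType) (k : nat) (q : 'I_k -> R).
Hypothesis q_gt0 : forall i, 0 < q i.

(** The value 1 beyond the range keeps every parameter positive. *)
Definition drift (i : nat) : R := if insub i is Some j then (q j)^-1 else 1.

Lemma drift_gt0 i : 0 < drift i.
Proof. by rewrite /drift; case: insub => // j; rewrite invr_gt0. Qed.

Lemma driftE (i : 'I_k) : drift i = (q i)^-1.
Proof. by rewrite /drift valK. Qed.

Lemma Sp_drift (z : chamber k) :
  Sp q (val z) = sp_sum R k drift k.*2 (chamber_row k (val z)).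
Proof.
have hz : strip k (chamber_row k (val z)) by apply/strip_chamber_row; exact: valP.
rewrite -sp_sum_inv //; last by move=> j; rewrite gt_eqF // drift_gt0.
by apply: SpE => // i; rewrite ?invr_gt0 ?drift_gt0 // driftE invrK.
Qed.

Definition gibbs (f : seq int -> R) (z : chamber k) : R :=
  edge_sum R k drift k.*2 f (chamber_row k (val z)) / Sp q (val z).

Lemma Sp_gt0 (z : chamber k) : 0 < Sp q (val z).
Proof.
rewrite Sp_drift; apply: edge_sum_gt0 => //; first exact: drift_gt0.
by rewrite uphalf_double; apply/strip_chamber_row; exact: valP.
Qed.

(** At level 2k the factor [leave] is the constant leaving rate, so dividing [edge_intertwining] by
    [Sp] turns [nbsum] into the generator. *)
Lemma gibbs_dagger f (z : chamber k) :
  \sum_(y <- z :: nbrs z) dagger_rates q z y * gibbs f y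
  = gibbs (edge_gen R drift k.*2 f) z.
Proof.
have hz : strip (uphalf k.*2) (chamber_row k (val z)).
  by rewrite uphalf_double; apply/strip_chamber_row; exact: valP.
have S0 (z' : chamber k) : Sp q (val z') != 0 by rewrite gt_eqF // Sp_gt0.
rewrite /gibbs -edge_intertwining //; last exact: drift_gt0.
rewrite mulrBl uphalf_double -sum_nbrs big_cons addrC mulr_suml; congr (_ + _).
  apply: eq_big_seq => y yz; have := uniq_nbrs k z; rewrite /= => /andP[nz _].
  rewrite /dagger_rates ifF; last by apply: contraNF nz => /eqP e; rewrite {1}e.
  by rewrite -mem_nbrs yz; field; rewrite !S0.
rewrite /dagger_rates eqxx mulrA !mulNr; congr (- (_ * _ / _)).
rewrite /leave odd_double mul0r addr0 doubleK /leave_sum.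
by apply: eq_bigr => i _; rewrite driftE invrK addrC.
Qed.

Lemma gibbs_cst c (z : chamber k) : gibbs (fun=> c) z = c.
Proof.
rewrite /gibbs -[X in edge_sum _ _ _ _ X]/(fun=> c) Sp_drift /sp_sum.
have -> : (fun=> c) = (fun x : seq int => c * 1) :> (seq int -> R) by apply/funext => x; rewrite mulr1.
by rewrite edge_sumZ mulfK // gt_eqF // -/(sp_sum R k drift k.*2 _) -Sp_drift Sp_gt0.
Qed.

(** [gibbs] preserves constants and [edge_gen] kills them, so the intertwining applied to 1 gives
    the harmonicity behind the h-transform. *)
Lemma sum_dagger_rates (z : chamber k) : \sum_(y <- z :: nbrs z) dagger_rates q z y = 0.
Proof.
have := gibbs_dagger (fun=> 1) z.
under eq_bigr do rewrite gibbs_cst mulr1.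
move=> ->.
have -> : edge_gen R drift k.*2 (fun=> 1) = fun=> 0; last by rewrite gibbs_cst.
apply/funext; elim: k.*2 => //= n IH [|b x] //.
by rewrite [lift_edge _ _ _](_ : _ = fun=> 1) // IH !subrr !mulr0 !addr0.
Qed.

Lemma gibbsD f g z : gibbs (fun x => f x + g x) z = gibbs f z + gibbs g z.
Proof. by rewrite /gibbs edge_sumD mulrDl. Qed.

Lemma gibbsB f g z : gibbs (fun x => f x - g x) z = gibbs f z - gibbs g z.
Proof. by rewrite /gibbs edge_sumB mulrBl. Qed.

Lemma gibbsZ c f z : gibbs (fun x => c * f x) z = c * gibbs f z.
Proof. by rewrite /gibbs edge_sumZ mulrA. Qed.

Lemma gibbs_ge0 f z : (forall x, 0 <= f x) -> 0 <= gibbs f z.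
Proof.
by move=> f0; rewrite divr_ge0 ?(ltW (Sp_gt0 _)) // edge_sum_ge0 //; exact: drift_gt0.
Qed.

Lemma eq_gibbs f f' z :
  (forall x, is_edge k.*2 x -> head 0 x = chamber_row k (val z) 0%N -> f x = f' x) ->
  gibbs f z = gibbs f' z.
Proof.
move=> e; rewrite /gibbs (@eq_edge_sum R k drift k.*2 f f') //.
by rewrite uphalf_double; apply/strip_chamber_row; exact: valP.
Qed.

End Dagger.

(** * Averages and transition functions *)

Section Averages.
Variables (R : realType) (S : choiceType).
Implicit Types (kap : S -> R) (f g : S -> R).

Definition prob_vec kap : Prop :=
  (forall s, 0 <= kap s) /\ \esum_(s in [set: S]) (kap s)%:E = 1%E.

(** Test functions will take values in [0, 1], so the extended sum is finite and [fine] loses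
    nothing. *)
Definition avg kap f : R := fine (\esum_(s in [set: S]) (kap s * f s)%:E).

(** One inequality for all factors suffices: used with 1 / c it gives the converse. *)
Lemma esumZl (A : set S) (c : R) f : 0 <= c -> (forall s, 0 <= f s) ->
  \esum_(s in A) (c * f s)%:E = (c%:E * \esum_(s in A) (f s)%:E)%E.
Proof.
have half (d : R) (u : S -> R) : 0 <= d -> (forall s, 0 <= u s) ->
  (\esum_(s in A) (d * u s)%:E <= d%:E * \esum_(s in A) (u s)%:E)%E.
  move=> d0 u0; apply: ge_ereal_sup => /= _ [X [finX XA] <-].
  rewrite fsbig_finite //=; under eq_bigr do rewrite EFinM.
  rewrite -ge0_sume_distrr; last by move=> i _; rewrite lee_fin.
  apply: lee_wpmul2l; first by rewrite lee_fin.
  by apply: esum_ge; exists X => //; rewrite fsbig_finite.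
move=> c0 f0; apply/eqP; rewrite eq_le half //=.
have [->|cn0] := eqVneq c 0.
  by rewrite mul0e; apply: esum_ge0 => s _; rewrite mul0r.
have cp : 0 < c by rewrite lt_neqAle eq_sym cn0.
have := half c^-1 (fun s => c * f s); rewrite invr_ge0 => /(_ c0 (fun s => mulr_ge0 c0 (f0 s))).
under eq_esum do rewrite mulrA mulVf // mul1r.
move=> h; apply: (le_trans (lee_wpmul2l (c0 : (0 <= c%:E)%E) h)).
by rewrite muleA -EFinM mulfV // mul1e.
Qed.

Lemma avgE kap f : prob_vec kap -> (forall s, 0 <= f s <= 1) ->
  (avg kap f)%:E = \esum_(s in [set: S]) (kap s * f s)%:E.
Proof.
move=> [k0 k1] f01; rewrite /avg fineK // ge0_fin_numE; last first.
  by apply: esum_ge0 => s _; rewrite lee_fin mulr_ge0 //; case/andP: (f01 s).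
apply: (@le_lt_trans _ _ 1%E); last exact: ltry.
rewrite -k1; apply: le_esum => s _; rewrite lee_fin ler_piMr //.
by case/andP: (f01 s).
Qed.

Lemma avg_ge0 kap f : prob_vec kap -> (forall s, 0 <= f s <= 1) -> 0 <= avg kap f.
Proof.
move=> hk f01; rewrite -lee_fin avgE //; apply: esum_ge0 => s _.
by rewrite lee_fin mulr_ge0 //; [exact: hk.1 | case/andP: (f01 s)].
Qed.

Lemma avg_le1 kap f : prob_vec kap -> (forall s, 0 <= f s <= 1) -> avg kap f <= 1.
Proof.
move=> hk f01; rewrite -lee_fin avgE // -hk.2; apply: le_esum => s _.
by rewrite lee_fin ler_piMr //; [exact: hk.1 | case/andP: (f01 s)].
Qed.

Lemma eq_avg kap f g : f =1 g -> avg kap f = avg kap g.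
Proof. by move=> e; rewrite /avg; congr fine; apply: eq_esum => s _; rewrite e. Qed.

(* Outside of a finite set [r] both averages are at most the missing mass. *)
Lemma avg_approx kap f (r : seq S) : prob_vec kap -> (forall s, 0 <= f s <= 1) -> uniq r ->
  0 <= avg kap f - \sum_(s <- r) kap s * f s <= 1 - \sum_(s <- r) kap s.
Proof.
move=> hk f01 ur; have [k0 k1] := hk.
have split_sum g : (forall s, 0 <= g s) -> \esum_(s in [set: S]) (g s)%:E =
   ((\sum_(s <- r) g s)%:E + \esum_(s in ~` [set` r]) (g s)%:E)%E.
  move=> g0; rewrite (esumID [set` r]) /=; last by move=> i _; rewrite lee_fin.
  rewrite !setTI; congr (_ + _)%E.
  rewrite esum_fset; [|exact: finite_seq|by move=> i _; rewrite lee_fin].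
  by rewrite -(@fsbig_seq _ _ _ _ r (fun s => (g s)%:E)) // sumEFin.
have kf0 s : 0 <= kap s * f s by rewrite mulr_ge0 //; case/andP: (f01 s).
have e1 := avgE kap f hk f01; rewrite split_sum // in e1.
have e2 := k1; rewrite split_sum // in e2.
have t1 : (0 <= \esum_(s in ~` [set` r]) (kap s * f s)%:E)%E.
  by apply: esum_ge0 => s _; rewrite lee_fin.
have t2 : (\esum_(s in ~` [set` r]) (kap s * f s)%:E <= \esum_(s in ~` [set` r]) (kap s)%:E)%E.
  by apply: le_esum => s _; rewrite lee_fin ler_piMr //; case/andP: (f01 s).
have e1' : \esum_(s in ~` [set` r]) (kap s * f s)%:E = (avg kap f - \sum_(s <- r) kap s * f s)%:E.
  by rewrite EFinB e1 [X in (X - _)%E]addeC addeK.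
have e2' : \esum_(s in ~` [set` r]) (kap s)%:E = (1 - \sum_(s <- r) kap s)%:E.
  by rewrite EFinB -e2 [X in (X - _)%E]addeC addeK.
by rewrite -!lee_fin -e1' -e2' t1.
Qed.

Lemma avg_tight kap (e : R) : prob_vec kap -> 0 < e ->
  exists2 r : seq S, uniq r & 1 - \sum_(s <- r) kap s <= e.
Proof.
move=> [k0 k1] e0.
have : ((1 - e)%:E < \esum_(s in [set: S]) (kap s)%:E)%E by rewrite k1 lte_fin; lra.
move=> /ereal_sup_gt[_ [X [finX _] <-]] h.
exists (fset_set X); first exact: finmap.fset_uniq.
move: h; rewrite fsbig_finite //= sumEFin lte_fin; lra.
Qed.

Lemma avg_dist kap f g (r : seq S) : prob_vec kap ->
  (forall s, 0 <= f s <= 1) -> (forall s, 0 <= g s <= 1) -> uniq r ->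
  `|avg kap f - avg kap g| <= \sum_(s <- r) `|f s - g s| + (1 - \sum_(s <- r) kap s).
Proof.
move=> hk f01 g01 ur.
have := avg_approx kap f r hk f01 ur; have := avg_approx kap g r hk g01 ur.
have le1 s : kap s <= 1.
  have := avg_approx kap f [:: s] hk f01 erefl; rewrite !big_seq1 => /andP[h1 h2].
  by rewrite -subr_ge0 (le_trans h1 h2).
have : `|\sum_(s <- r) kap s * f s - \sum_(s <- r) kap s * g s| <= \sum_(s <- r) `|f s - g s|.
  rewrite -sumrB; apply: le_trans (ler_norm_sum _ _ _) _; apply: ler_sum => s _.
  rewrite -mulrBr normrM ler_piMl // ger0_norm ?le1 //; exact: hk.1.
by rewrite !ler_norml; lra.
Qed.

Lemma avg_delta kap f x : prob_vec kap -> (forall s, kap s = (x == s)%:R) ->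
  (forall s, 0 <= f s <= 1) -> avg kap f = f x.
Proof.
move=> hk kE f01; have := avg_approx kap f [:: x] hk f01 erefl.
by rewrite !big_seq1 kE eqxx mul1r subrr -eq_le eq_sym subr_eq0 => /eqP.
Qed.

End Averages.
Arguments prob_vec {R S} kap.
Arguments avg {R S} kap f.

Lemma esum_swap (R : realType) (S T : choiceType) (F : S -> T -> \bar R) :
  (forall s t, 0 <= F s t)%E ->
  \esum_(s in [set: S]) \esum_(t in [set: T]) F s t
  = \esum_(t in [set: T]) \esum_(s in [set: S]) F s t.
Proof.
move=> F0; rewrite !esum_esum //.
rewrite (@reindex_esum R _ _ ([set: T] `*`` (fun=> [set: S])) _ (fun p : T * S => (p.2, p.1))) //.
split=> // [[a b] [c d] _ _ [-> ->] //|[a b] _].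
by exists (b, a).
Qed.

(* Chapman-Kolmogorov, tested against a function. *)
Lemma avg_comp (R : realType) (S T : choiceType) (kap : S -> R) (lam : S -> T -> R)
    (nu : T -> R) (f : T -> R) :
  prob_vec kap -> (forall s, prob_vec (lam s)) -> prob_vec nu ->
  (forall t, (nu t)%:E = \esum_(s in [set: S]) (kap s * lam s t)%:E) ->
  (forall t, 0 <= f t <= 1) ->
  avg nu f = avg kap (fun s => avg (lam s) f).
Proof.
move=> hk hl hn nuE f01.
have a01 s : 0 <= avg (lam s) f <= 1 by rewrite avg_ge0 ?avg_le1.
have f0 t : 0 <= f t by case/andP: (f01 t).
apply: EFin_inj; rewrite !avgE //.
transitivity (\esum_(t in [set: T]) \esum_(s in [set: S]) (kap s * lam s t * f t)%:E).
  apply: eq_esum => t _; rewrite EFinM nuE muleC -esumZl //; last first.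
    by move=> s; rewrite mulr_ge0 //; [exact: hk.1 | exact: (hl s).1].
  by apply: eq_esum => s _; rewrite mulrC.
rewrite esum_swap; last first.
  by move=> t s; rewrite lee_fin !mulr_ge0 //; [exact: hk.1 | exact: (hl s).1].
apply: eq_esum => s _; rewrite EFinM avgE // -esumZl.
- by apply: eq_esum => t _; rewrite mulrA.
- exact: hk.1.
- by move=> t; rewrite mulr_ge0 //; exact: (hl s).1.
Qed.

(** * A discrete Gronwall estimate with errors that are small only pointwise *)

Section Gronwall.
Variables (R : realType) (S : Type) (N : S -> seq S) (Q : S -> S -> R) (C t : R).
Variable (eta : R -> S -> R).
Hypotheses (C0 : 0 <= C) (t0 : 0 <= t).
Hypothesis QC : forall x, \sum_(y <- N x) `|Q x y| <= C.
Hypothesis eta0 : forall x, eta h x @[h --> 0^'+] --> (0 : R).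

(** The error collected in j iterations. It reads [eta] only at states fewer than j steps away from
    [x], finitely many, hence vanishes with [h] although [eta] is not uniformly small. *)
Fixpoint gronwall_err (j : nat) (h : R) (x : S) : R :=
  if j is j'.+1 then t * (\sum_(y <- N x) `|Q x y| * gronwall_err j' h y + `|eta h x|) else 0.

Lemma gronwall_err_ge0 j h x : 0 <= gronwall_err j h x.
Proof.
elim: j x => //= j IH x; rewrite mulr_ge0 // addr_ge0 // sumr_ge0 // => y _.
exact: mulr_ge0.
Qed.

Lemma gronwall_err_cvg j x : gronwall_err j h x @[h --> 0^'+] --> (0 : R).
Proof.
elim: j x => [|j IH] x /=; first exact: cvg_cst.
have eta_norm : `|eta h x| @[h --> 0^'+] --> `|0 : R| by apply: cvg_norm; exact: eta0.
rewrite normr0 in eta_norm.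
have sum0 : \sum_(y <- N x) `|Q x y| * gronwall_err j h y @[h --> 0^'+] --> (0 : R).
  elim: (N x) => [|y s IHs].
    under eq_fun do rewrite big_nil.
    exact: cvg_cst.
  under eq_fun do rewrite big_cons.
  have h : `|Q x y| * gronwall_err j h y + \sum_(y <- s) `|Q x y| * gronwall_err j h y
      @[h --> 0^'+] --> `|Q x y| * 0 + 0.
    by apply: cvgD => //; apply: cvgMl_tmp; exact: IH.
  by rewrite mulr0 addr0 in h.
have h : t * (\sum_(y <- N x) `|Q x y| * gronwall_err j h y + `|eta h x|)
   @[h --> 0^'+] --> t * (0 + 0) by apply: cvgMl_tmp; exact: cvgD.
by rewrite addr0 mulr0 in h.
Qed.

(** The first two terms of the binomial expansion; they carry the bound (C m h)^j from m to m +
    1. *)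
Lemma bernoulli_step (a b : R) j : 0 <= a -> 0 <= b ->
  a ^+ j.+1 + j.+1%:R * b * a ^+ j <= (a + b) ^+ j.+1.
Proof.
move=> a0 b0; elim: j => [|j IH]; first by rewrite !expr1 expr0 mul1r mulr1.
rewrite [X in _ <= X]exprS; apply: (@le_trans _ _ ((a + b) * (a ^+ j.+1 + j.+1%:R * b * a ^+ j))).
  rewrite -subr_ge0 -[j.+2%:R]natr1 !(exprS a) .
  have -> : (a + b) * (a * a ^+ j + j.+1%:R * b * a ^+ j)
     - (a * (a * a ^+ j) + (j.+1%:R + 1) * b * (a * a ^+ j)) = j.+1%:R * b ^+ 2 * a ^+ j.
    ring.
  by rewrite !mulr_ge0 // ?exprn_ge0.
by apply: ler_wpM2l => //; exact: addr_ge0.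
Qed.

(** A discrete iterated integral inequality, started from |e| <= 1: the induction on [j] inserts the
    previous bound into the one-step inequality, the induction on [m] sums it over time. *)
Lemma gronwall_bound j (h : R) (e : nat -> S -> R) m x : 0 <= h -> m%:R * h <= t ->
  (forall y, e 0%N y = 0) -> (forall m y, `|e m y| <= 1) ->
  (forall m y, `|e m.+1 y - e m y - h * \sum_(y' <- N y) Q y y' * e m y'| <= h * eta h y) ->
  `|e m x| <= (C * (m%:R * h)) ^+ j / j`!%:R + gronwall_err j h x.
Proof.
move=> h0 mt e0 e1 eS; elim: j m x mt => [|j IH] m x mt.
  by rewrite expr0 fact0 divr1 addr0.
set A := \sum_(y <- N x) `|Q x y| * gronwall_err j h y + `|eta h x|.
have A0 : 0 <= A.
  rewrite addr_ge0 // sumr_ge0 // => y _; rewrite mulr_ge0 //; exact: gronwall_err_ge0.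
suff : `|e m x| <= (C * (m%:R * h)) ^+ j.+1 / j.+1`!%:R + m%:R * h * A.
  by move=> /le_trans; apply; rewrite lerD2l /= -/A ler_wpM2r.
elim: m mt => [|m IHm] mt; first by rewrite e0 normr0 mul0r mulr0 expr0n mul0r mul0r addr0.
have mt' : m%:R * h <= t.
  by apply: le_trans mt; rewrite ler_wpM2r // ler_nat.
have {}IHm := IHm mt'.
have step : `|e m.+1 x| <= `|e m x| + h * (\sum_(y <- N x) `|Q x y| * `|e m y|) + h * `|eta h x|.
  have -> : e m.+1 x = (e m x + h * \sum_(y <- N x) Q x y * e m y)
     + (e m.+1 x - e m x - h * \sum_(y <- N x) Q x y * e m y) by ring.
  apply: le_trans (ler_normD _ _) _; apply: lerD.
    apply: le_trans (ler_normD _ _) _; rewrite lerD2l normrM (ger0_norm h0).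
    apply: ler_wpM2l => //; apply: le_trans (ler_norm_sum _ _ _) _.
    by apply: ler_sum => y _; rewrite normrM.
  by apply: le_trans (eS m x) _; apply: ler_wpM2l => //; exact: ler_norm.
apply: le_trans step _.
set a := C * (m%:R * h) in IHm *.
have a0 : 0 <= a by rewrite !mulr_ge0.
have sumle : \sum_(y <- N x) `|Q x y| * `|e m y| <=
    C * (a ^+ j / j`!%:R) + \sum_(y <- N x) `|Q x y| * gronwall_err j h y.
  apply: (@le_trans _ _ (\sum_(y <- N x) (`|Q x y| * (a ^+ j / j`!%:R)
     + `|Q x y| * gronwall_err j h y))).
    by apply: ler_sum => y _; rewrite -mulrDr ler_wpM2l //; exact: IH.
  rewrite big_split /= lerD2r -mulr_suml ler_wpM2r // divr_ge0 // exprn_ge0 //.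
have pow : a ^+ j.+1 / j.+1`!%:R + h * (C * (a ^+ j / j`!%:R))
    <= (C * (m.+1%:R * h)) ^+ j.+1 / j.+1`!%:R.
  have -> : C * (m.+1%:R * h) = a + C * h by rewrite -natr1 /a; ring.
  apply: (@le_trans _ _ ((a ^+ j.+1 + j.+1%:R * (C * h) * a ^+ j) / j.+1`!%:R)); last first.
    rewrite ler_pM2r ?invr_gt0 ?ltr0n ?fact_gt0 //.
    by apply: bernoulli_step => //; exact: mulr_ge0.
  have d0 : j`!%:R != 0 :> R by rewrite pnatr_eq0 -lt0n fact_gt0.
  have n0 : j.+1%:R != 0 :> R by rewrite pnatr_eq0.
  rewrite factS natrM; move: d0 n0 (a ^+ j.+1) (a ^+ j); move: (j`!%:R) (j.+1%:R) => d n d0 n0 u w.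
  by rewrite le_eqVlt; apply/orP; left; apply/eqP; field; rewrite d0.
have -> : m.+1%:R * h * A = m%:R * h * A + h * A by rewrite -natr1; ring.
have : h * \sum_(y <- N x) `|Q x y| * `|e m y| <= h * (C * (a ^+ j / j`!%:R) +
  \sum_(y <- N x) `|Q x y| * gronwall_err j h y) by apply: ler_wpM2l.
move: IHm pow; rewrite /A !mulrDr; lra.
Qed.

(** The range of [h] is chosen before the sequence [e], because in the applications [e] depends on
    [h]. *)
Lemma gronwall x (eps : R) : 0 < eps ->
  \forall h \near 0^'+, forall n (e : nat -> S -> R), n%:R * h <= t ->
    (forall y, e 0%N y = 0) -> (forall m y, `|e m y| <= 1) ->
    (forall m y, `|e m.+1 y - e m y - h * \sum_(y' <- N y) Q y y' * e m y'| <= h * eta h y) ->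
    `|e n x| <= eps.
Proof.
move=> eps0.
have [j _ /(_ j (leqnn j)) hj] : \forall j \near \oo, (C * t) ^+ j / j`!%:R <= eps / 2.
  have := @cvg_exp_coeff R (C * t).
  move=> /cvgr0_norm_le /(_ (eps / 2)); rewrite divr_gt0 // => /(_ isT).
  apply: filterS => j; rewrite /exp_coeff /= ger0_norm //.
  by rewrite divr_ge0 // exprn_ge0 // mulr_ge0.
near=> h.
move=> n e nt e0 e1 eS.
have h0 : 0 < h by near: h; exact: nbhs_right_gt.
apply: le_trans (gronwall_bound j h e n x (ltW h0) nt e0 e1 eS) _.
have -> : eps = eps / 2 + eps / 2 by rewrite -splitr.
apply: lerD.
  apply: le_trans hj; rewrite ler_pM2r ?invr_gt0 ?ltr0n ?fact_gt0 //.
  apply: lerXn2r; rewrite ?nnegrE; last exact: ler_wpM2l.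
    by rewrite !mulr_ge0 // ltW.
  exact: mulr_ge0.
apply: le_trans (ler_norm _) _.
near: h.
have /cvgr0_norm_le := gronwall_err_cvg j x; apply; exact: divr_gt0.
Unshelve. all: by end_near.
Qed.

End Gronwall.

Lemma near_dyadic (R : realType) (P : R -> Prop) (t : R) : 0 < t ->
  (\forall h \near 0^'+, P h) -> \forall n \near \oo, P (t / (2 ^ n)%:R).
Proof.
move=> t0 [/= e e0 he].
have c : (2^-1 : R) ^+ n @[n --> \oo] --> (0 : R).
  by apply: cvg_expr; rewrite ger0_norm ?invr_ge0 // invf_lt1 // ltr1n.
have /cvgr0_norm_lt/(_ (e / t)) := c; rewrite divr_gt0 // => /(_ isT).
apply: filterS => n; rewrite ger0_norm ?exprn_ge0 ?invr_ge0 // ltr_pdivlMr // => hn.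
have tn : 0 < t / (2 ^ n)%:R by rewrite divr_gt0 // ltr0n expn_gt0.
apply: he => //=; rewrite sub0r normrN ger0_norm; last exact: ltW.
by rewrite natrX -exprVn mulrC.
Qed.

Lemma prob_vec_le1 (R : realType) (S : choiceType) (kap : S -> R) s :
  prob_vec kap -> kap s <= 1.
Proof.
move=> hk; have f01 (x : S) : 0 <= (fun=> 1 : R) x <= 1 by rewrite ler01 lexx.
have := avg_approx R S kap (fun=> 1) [:: s] hk f01 erefl; rewrite !big_seq1 => /andP[h1 h2].
by rewrite -subr_ge0 (le_trans h1 h2).
Qed.

(** * First-order expansion of averages at small times *)

Section Rates.
Variables (R : realType) (S : choiceType).
Implicit Types (kap : R -> S -> R) (x : S) (Q : S -> R) (r : seq S).

Definition rate_err r kap x Q (h : R) : R :=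
  2 * \sum_(y <- r) `|(kap h y - (x == y)%:R) / h - Q y|.

Lemma rate_err_cvg r kap x Q :
  {in r, forall y, (kap h y - (x == y)%:R) / h @[h --> 0^'+] --> Q y} ->
  rate_err r kap x Q h @[h --> 0^'+] --> (0 : R).
Proof.
move=> hr.
have s0 : \sum_(y <- r) `|(kap h y - (x == y)%:R) / h - Q y| @[h --> 0^'+] --> (0 : R).
  elim: r hr => [|y s IHs] hr.
    under eq_fun do rewrite big_nil.
    exact: cvg_cst.
  under eq_fun do rewrite big_cons.
  have {}IHs := IHs (fun y' y's => hr y' (mem_behead (y's : y' \in behead (y :: s)))).
  have h : `|(kap h y - (x == y)%:R) / h - Q y|
    + \sum_(y <- s) `|(kap h y - (x == y)%:R) / h - Q y| @[h --> 0^'+] --> `|Q y - Q y| + 0.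
    by apply: cvgD => //; apply: cvg_norm; apply: cvgB; [apply: hr; exact: mem_head | exact: cvg_cst].
  by rewrite subrr normr0 addr0 in h.
have h : rate_err r kap x Q h @[h --> 0^'+] --> 2 * (0 : R) by exact: cvgMl_tmp.
by rewrite mulr0 in h.
Qed.

Lemma sum_delta r x (f : S -> R) : uniq r -> x \in r ->
  \sum_(y <- r) (x == y)%:R * f y = f x.
Proof.
move=> ur xr; rewrite (bigD1_seq x) //= eqxx mul1r big1 ?addr0 // => y.
by rewrite eq_sym => /negPf ->; rewrite mul0r.
Qed.

(** Since [Q] sums to 0 over [r], the mass outside [r] is bounded by the same sum of |d| as the
    error inside. This accounts for the factor 2 in [rate_err] and avoids any control of the entries
    outside [r]. *)
Lemma avg_rate r kap x Q (h : R) (f : S -> R) : 0 < h -> prob_vec (kap h) ->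
  uniq r -> x \in r -> \sum_(y <- r) Q y = 0 -> (forall y, 0 <= f y <= 1) ->
  `|avg (kap h) f - f x - h * \sum_(y <- r) Q y * f y| <= h * rate_err r kap x Q h.
Proof.
move=> h0 hk ur xr Q0 f01.
pose d y := kap h y - (x == y)%:R - h * Q y.
have dE y : `|d y| = h * `|(kap h y - (x == y)%:R) / h - Q y|.
  rewrite -[X in X * _](gtr0_norm h0) -normrM; congr (`|_|).
  by rewrite /d mulrBr mulrCA mulfV ?gt_eqF // mulr1.
have sumd : \sum_(y <- r) d y = \sum_(y <- r) kap h y - 1.
  rewrite /d !sumrB -mulr_sumr Q0 mulr0 subr0; congr (_ - _).
  by rewrite -[RHS](sum_delta r x (fun=> 1)) //; apply: eq_bigr => y _; rewrite mulr1.
have sumdf : \sum_(y <- r) d y * f y =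
    \sum_(y <- r) kap h y * f y - f x - h * \sum_(y <- r) Q y * f y.
  under eq_bigr do rewrite /d !mulrBl.
  rewrite !sumrB sum_delta // mulr_sumr; congr (_ - _).
  by apply: eq_bigr => y _; rewrite mulrA.
have b1 : `|\sum_(y <- r) d y| <= \sum_(y <- r) `|d y| by exact: ler_norm_sum.
have b2 : `|\sum_(y <- r) d y * f y| <= \sum_(y <- r) `|d y|.
  apply: le_trans (ler_norm_sum _ _ _) _; apply: ler_sum => y _.
  rewrite normrM ler_piMr //; case/andP: (f01 y) => p0 p1; by rewrite ger0_norm.
have -> : h * rate_err r kap x Q h = 2 * \sum_(y <- r) `|d y|.
  rewrite /rate_err mulrCA; congr (_ * _); rewrite mulr_sumr; apply: eq_bigr => y _.
  by rewrite dE.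
have := avg_approx R S (kap h) f r hk f01 ur.
move: b1 b2; rewrite sumd sumdf !ler_norml; lra.
Qed.

End Rates.
Arguments rate_err {R S} r kap x Q h.

Definition bounded_rates (R : realType) (S : choiceType) (Q : S -> S -> R)
    (N : S -> seq S) (C : R) : Prop :=
  forall x, [/\ uniq (N x), x \in N x, \sum_(y <- N x) Q x y = 0
              & \sum_(y <- N x) `|Q x y| <= C].
Arguments bounded_rates {R S} Q N C.

(** * Uniqueness of transition functions, and their comparison with iterated kernels *)

Section Transition.
Variables (R : realType) (S : choiceType) (Q : S -> S -> R) (N : S -> seq S) (C : R).
Hypothesis QN : bounded_rates Q N C.
Implicit Type p : R -> S -> S -> R.

Lemma transition_prob p t x : transition_function Q p -> 0 <= t -> prob_vec (p t x).
Proof. by move=> [p0 p1 _ _ _] t0; split=> [y|]; [exact: p0 | exact: p1]. Qed.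

Lemma transition_le1 p t x y : transition_function Q p -> 0 <= t -> 0 <= p t x y <= 1.
Proof.
move=> hp t0; have h := transition_prob p t x hp t0.
by rewrite h.1 (prob_vec_le1 _ _ _ _ h).
Qed.

Lemma transition_avg p s t x f : transition_function Q p -> 0 <= s -> 0 <= t ->
  (forall z, 0 <= f z <= 1) -> avg (p (s + t) x) f = avg (p s x) (fun y => avg (p t y) f).
Proof.
move=> hp s0 t0 f01; apply: avg_comp => //.
- exact: transition_prob.
- by move=> y; exact: transition_prob.
- by apply: transition_prob => //; exact: addr_ge0.
- by move=> z; have [_ _ _ CK _] := hp; exact: CK.
Qed.

Lemma transition_step p s t x z : transition_function Q p -> 0 <= s -> 0 <= t ->
  p (s + t) x z = avg (p s x) (fun y => p t y z).
Proof.
move=> hp s0 t0; apply: EFin_inj; rewrite avgE; first last.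
- by move=> y; exact: transition_le1.
- exact: transition_prob.
- by have [_ _ _ CK _] := hp; exact: CK.
Qed.

Lemma transition_avg0 p x f : transition_function Q p -> (forall z, 0 <= f z <= 1) ->
  avg (p 0 x) f = f x.
Proof.
move=> hp f01; apply: avg_delta => //; first exact: transition_prob.
by move=> y; have [_ _ p0 _ _] := hp; exact: p0.
Qed.

Lemma transition_rate p x (r : seq S) : transition_function Q p ->
  {in r, forall y, (p h x y - (x == y)%:R) / h @[h --> 0^'+] --> Q x y}.
Proof. by move=> [_ _ _ _ h] y _; exact: h. Qed.

Lemma bounded_rates_ge0 (x : S) : 0 <= C.
Proof. by have [_ _ _] := QN x; apply: le_trans; apply: sumr_ge0. Qed.

(** Both functions satisfy the same one-step relation up to o(h) at each state, so their difference
    obeys [gronwall]. *)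
Lemma transition_unique p p' t x z :
  transition_function Q p -> transition_function Q p' -> 0 <= t -> p t x z = p' t x z.
Proof.
move=> hp hp' t0; have C0 := bounded_rates_ge0 x.
have [->|tn0] := eqVneq t 0.
  by have [_ _ -> _ _] := hp; have [_ _ -> _ _] := hp'.
have {}t0 : 0 < t by rewrite lt_neqAle eq_sym tn0.
apply/eqP; rewrite -subr_eq0 -normr_le0; apply/ler_addgt0Pl => eps eps0; rewrite addr0.
pose eta h y := rate_err (N y) (p^~ y) y (Q y) h + rate_err (N y) (p'^~ y) y (Q y) h.
have eta0 y : eta h y @[h --> 0^'+] --> (0 : R).
  have h : eta h y @[h --> 0^'+] --> (0 + 0 : R).
    by apply: cvgD; apply: rate_err_cvg; exact: transition_rate.
  by rewrite addr0 in h.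
have QC y : \sum_(y' <- N y) `|Q y y'| <= C by have [] := QN y.
have := gronwall R S N Q C t eta C0 (ltW t0) QC eta0 x eps eps0.
move=> /(near_dyadic R _ t t0)[n _ /(_ n (leqnn n))].
set h := t / _ => H.
have h0 : 0 < h by rewrite divr_gt0 // ltr0n expn_gt0.
have nh : (2 ^ n)%:R * h = t by rewrite mulrC divfK // pnatr_eq0 -lt0n expn_gt0.
have mh (m : nat) : 0 <= m%:R * h by rewrite mulr_ge0 // ltW.
have := H (2 ^ n)%N (fun m y => p (m%:R * h) y z - p' (m%:R * h) y z).
rewrite nh; apply=> //.
- by move=> y; rewrite mul0r; have [_ _ -> _ _] := hp; have [_ _ -> _ _] := hp'; rewrite subrr.
- move=> m y; have := transition_le1 p _ y z hp (mh m); have := transition_le1 p' _ y z hp' (mh m).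
  by rewrite ler_norml; lra.
- move=> m y; have -> : m.+1%:R * h = h + m%:R * h by rewrite -natr1; ring.
  rewrite (transition_step p) ?(ltW h0) // (transition_step p') ?(ltW h0) //.
  have [ur xr Q0 _] := QN y.
  have b1 := avg_rate R S (N y) (p^~ y) y (Q y) h (fun w => p (m%:R * h) w z) h0
     (transition_prob p h y hp (ltW h0)) ur xr Q0 (fun w => transition_le1 p _ w z hp (mh m)).
  have b2 := avg_rate R S (N y) (p'^~ y) y (Q y) h (fun w => p' (m%:R * h) w z) h0
     (transition_prob p' h y hp' (ltW h0)) ur xr Q0 (fun w => transition_le1 p' _ w z hp' (mh m)).
  have -> : \sum_(y' <- N y) Q y y' * (p (m%:R * h) y' z - p' (m%:R * h) y' z)
   = \sum_(y' <- N y) Q y y' * p (m%:R * h) y' z - \sum_(y' <- N y) Q y y' * p' (m%:R * h) y' z.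
    by rewrite -sumrB; apply: eq_bigr => w _; rewrite mulrBr.
  move: b1 b2; rewrite /eta !mulrDr mulrN !ler_norml; lra.
Qed.

Section Limit.
Variables (p : R -> S -> S -> R) (E : Type).
Variables (Gam : (E -> R) -> S -> R) (K : R -> (E -> R) -> E -> R) (eta : R -> S -> R).
Hypothesis hp : transition_function Q p.
Hypothesis Gam01 : forall f z, (forall x, 0 <= f x <= 1) -> 0 <= Gam f z <= 1.
Hypothesis K01 : forall h f x, 0 < h -> (forall x, 0 <= f x <= 1) -> 0 <= K h f x <= 1.
Hypothesis eta0 : forall z, eta h z @[h --> 0^'+] --> (0 : R).
Hypothesis GamK : forall h f z, 0 < h -> (forall x, 0 <= f x <= 1) ->
  `|Gam (K h f) z - Gam f z - h * \sum_(y <- N z) Q z y * Gam f y| <= h * eta h z.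

(** Both terms start from [Gam f] and satisfy the same approximate recursion. The estimate is
    uniform in [f], because with several times [f] itself will depend on [n]. *)
Lemma semigroup_limit (t : R) (z : S) (eps : R) : 0 < t -> 0 < eps ->
  \forall n \near \oo, forall f, (forall x, 0 <= f x <= 1) ->
    `|avg (p t z) (Gam f) - Gam (iter (2 ^ n) (K (t / (2 ^ n)%:R)) f) z| <= eps.
Proof.
move=> t0 eps0; have C0 := bounded_rates_ge0 z.
pose eta' h y := rate_err (N y) (p^~ y) y (Q y) h + eta h y.
have eta'0 y : eta' h y @[h --> 0^'+] --> (0 : R).
  have h : eta' h y @[h --> 0^'+] --> (0 + 0 : R).
    by apply: cvgD; [apply: rate_err_cvg; exact: transition_rate | exact: eta0].
  by rewrite addr0 in h.
have QC y : \sum_(y' <- N y) `|Q y y'| <= C by have [] := QN y.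
have := gronwall R S N Q C t eta' C0 (ltW t0) QC eta'0 z eps eps0.
move=> /(near_dyadic R _ t t0); apply: filterS => n; set h := t / _ => H f f01.
have h0 : 0 < h by rewrite divr_gt0 // ltr0n expn_gt0.
have nh : (2 ^ n)%:R * h = t by rewrite mulrC divfK // pnatr_eq0 -lt0n expn_gt0.
have mh (m : nat) : 0 <= m%:R * h by rewrite mulr_ge0 // ltW.
have i01 m x : 0 <= iter m (K h) f x <= 1.
  by elim: m x => [|m IH] x //=; exact: K01.
have G01 y := Gam01 f y f01.
have a01 m y : 0 <= avg (p (m%:R * h) y) (Gam f) <= 1.
  by rewrite avg_ge0 ?avg_le1 //; exact: transition_prob.
have := H (2 ^ n)%N (fun m y => avg (p (m%:R * h) y) (Gam f) - Gam (iter m (K h) f) y).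
rewrite nh; apply=> //.
- by move=> y; rewrite mul0r transition_avg0 //= subrr.
- move=> m y; have := a01 m y; have := Gam01 _ y (i01 m).
  by rewrite ler_norml; lra.
- move=> m y; have -> : m.+1%:R * h = h + m%:R * h by rewrite -natr1; ring.
  rewrite transition_avg // ?(ltW h0) // iterS.
  have [ur xr Q0 _] := QN y.
  have b1 := avg_rate R S (N y) (p^~ y) y (Q y) h (fun w => avg (p (m%:R * h) w) (Gam f)) h0
     (transition_prob p h y hp (ltW h0)) ur xr Q0 (a01 m).
  have b2 := GamK h (iter m (K h) f) y h0 (i01 m).
  have -> : \sum_(y' <- N y) Q y y' * (avg (p (m%:R * h) y') (Gam f) - Gam (iter m (K h) f) y')
   = \sum_(y' <- N y) Q y y' * avg (p (m%:R * h) y') (Gam f)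
     - \sum_(y' <- N y) Q y y' * Gam (iter m (K h) f) y'.
    by rewrite -sumrB; apply: eq_bigr => w _; rewrite mulrBr.
  move: b1 b2; rewrite /eta' !mulrDr mulrN !ler_norml; lra.
Qed.

End Limit.
End Transition.

(** * Dynamics of the right edge *)

Fixpoint push (n : nat) (d : nat -> int) (x : seq int) : seq int :=
  match n, x with
  | n'.+1, b :: x' => let y := push n' d x' in Num.max (b + d n') (head 0 y) :: y
  | _, _ => [::]
  end.

Lemma eq_push n d d' x : (forall i, (i < n)%N -> d i = d' i) -> push n d x = push n d' x.
Proof.
elim: n x => [|n IH] [|b x] //= e.
by rewrite (IH x) ?e // => i ni; apply: e; exact: ltnW.
Qed.

Lemma push0 n x : is_edge n x -> push n (fun=> 0) x = x.
Proof.
by elim: n x => [|n IH] [|b x] //= /andP[hb ex]; rewrite IH // addr0 max_l.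
Qed.

Definition unit_inc (j i : nat) : int := ((i == j) : nat)%:Z.

(** Each jump of the edge is a [push] by one unit step; a downward step disturbs no higher level, as
    those already lie above it. *)
Lemma edge_genE (R : realType) (a : nat -> R) n f x : is_edge n x ->
  edge_gen R a n f x =
  \sum_(j < n) (vel R a j * (f (push n (unit_inc j) x) - f x)
    + (vel R a j)^-1 * (f (push n (fun i => - unit_inc j i) x) - f x)).
Proof.
elim: n f x => [|n IH] f [|b x] //=; first by rewrite big_ord0.
move=> /andP[hb ex]; rewrite big_ord_recr /= -addrA; congr (_ + _).
  rewrite IH //; apply: eq_bigr => j _; rewrite /lift_edge /unit_inc (gtn_eqF (ltn_ord j)).
  by rewrite oppr0 addr0 (max_l hb).
have e0 : push n (unit_inc n) x = x.
  rewrite -[RHS](push0 n) //; apply: eq_push => i ni; by rewrite /unit_inc ltn_eqF.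
have e1 : push n (fun i => - unit_inc n i) x = x.
  rewrite -[RHS](push0 n) //; apply: eq_push => i ni; by rewrite /unit_inc ltn_eqF.
rewrite e0 e1 /unit_inc eqxx; congr (_ * (f (_ :: _) - _) + _).
by rewrite max_l //; apply: le_trans hb _; rewrite lerDl.
Qed.

Section Increments.
Variables (R : realType) (n : nat) (v : 'I_n -> R).

Notation D := {ffun 'I_n -> int}.

Definition inc (d : D) (i : nat) : int := if insub i is Some j then d j else 0.

Lemma incE (d : D) (j : 'I_n) : inc d j = d j.
Proof. by rewrite /inc valK. Qed.

Definition unit_steps : seq D :=
  0 :: [seq basis_vec j | j <- enum 'I_n] ++ [seq - basis_vec j | j <- enum 'I_n].

Lemma basis_vec_neq0 (j : 'I_n) : (basis_vec j != 0) * (- basis_vec j != 0).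
Proof.
have h : basis_vec j != 0 by apply/eqP => /ffunP/(_ j); rewrite !ffunE eqxx.
by split=> //; rewrite oppr_eq0.
Qed.

Lemma uniq_unit_steps : uniq unit_steps.
Proof.
rewrite /= mem_cat negb_or cat_uniq; apply/andP; split; last apply/and3P; last split.
- apply/andP; split; apply/mapP => -[j _ /eqP]; rewrite eq_sym.
    by rewrite (negPf (basis_vec_neq0 j).1).
  by rewrite (negPf (basis_vec_neq0 j).2).
- by rewrite map_inj_uniq ?enum_uniq // => i j /basis_vec_inj.
- apply/hasPn => u /mapP[i _ ->]; apply/negP => /mapP[j _ /eqP].
  by rewrite eq_sym (negPf (basis_vec_neqN _ _)).
- by rewrite map_inj_uniq ?enum_uniq // => i j /oppr_inj/basis_vec_inj.
Qed.

Definition step_rate (d : D) : R :=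
  if d == 0 then - \sum_j (v j + (v j)^-1)
  else \sum_j ((d == basis_vec j)%:R * v j + (d == - basis_vec j)%:R * (v j)^-1).

Lemma step_rate_up j : step_rate (basis_vec j) = v j.
Proof.
rewrite /step_rate (negPf (basis_vec_neq0 j).1) (bigD1 j) //= eqxx mul1r.
rewrite (negPf (basis_vec_neqN j j)) mul0r addr0 big1 ?addr0 // => i ij.
rewrite (inj_eq (@basis_vec_inj n)) eq_sym (negPf ij) mul0r add0r.
by rewrite (negPf (basis_vec_neqN j i)) mul0r.
Qed.

Lemma step_rate_dn j : step_rate (- basis_vec j) = (v j)^-1.
Proof.
rewrite /step_rate (negPf (basis_vec_neq0 j).2) (bigD1 j) //= eqxx mul1r.
rewrite eq_sym (negPf (basis_vec_neqN j j)) mul0r add0r big1 ?addr0 // => i ij.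
rewrite (inj_eq oppr_inj) (inj_eq (@basis_vec_inj n)) [j == i]eq_sym (negPf ij) mul0r addr0.
by rewrite eq_sym (negPf (basis_vec_neqN i j)) mul0r.
Qed.

Lemma sum_step_rate (F : D -> R) :
  \sum_(d <- unit_steps) step_rate d * F d
  = \sum_j (v j * (F (basis_vec j) - F 0) + (v j)^-1 * (F (- basis_vec j) - F 0)).
Proof.
rewrite /unit_steps big_cons big_cat /= !big_map -!enumT !big_enum /= {1}/step_rate eqxx.
rewrite mulNr mulr_suml -sumrN -big_split -big_split /=; apply: eq_bigr => j _.
rewrite step_rate_up step_rate_dn; ring.
Qed.

Lemma inc_basis (j : 'I_n) x : push n (inc (basis_vec j)) x = push n (unit_inc j) x.
Proof.
apply: eq_push => i ni; rewrite -[i]/(nat_of_ord (Ordinal ni)) incE ffunE /unit_inc.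
by rewrite -val_eqE /= -natz.
Qed.

Lemma inc_basisN (j : 'I_n) x :
  push n (inc (- basis_vec j)) x = push n (fun i => - unit_inc j i) x.
Proof.
apply: eq_push => i ni; rewrite -[i]/(nat_of_ord (Ordinal ni)) incE !ffunE /unit_inc.
by rewrite -val_eqE /= -natz.
Qed.

Lemma inc0 x : is_edge n x -> push n (inc 0) x = x.
Proof.
move=> ex; rewrite -[RHS](push0 n) //; apply: eq_push => i ni.
by rewrite -[i]/(nat_of_ord (Ordinal ni)) incE ffunE.
Qed.

End Increments.

Lemma near_all_in (S : eqType) (r : seq S) (P : S -> nat -> Prop) :
  (forall s, s \in r -> \forall n \near \oo, P s n) ->
  \forall n \near \oo, forall s, s \in r -> P s n.
Proof.
elim: r => [|s r IH] h; first by apply: nearW.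
have h1 := h s (mem_head _ _).
have h2 : \forall n \near \oo, forall s', s' \in r -> P s' n.
  by apply: IH => s' sr; apply: h; rewrite inE sr orbT.
apply: filterS2 h1 h2 => n p1 p2 s'; rewrite inE => /orP[/eqP ->|] //; exact: p2.
Qed.

(** * The h-transform compared with the grid recursion *)

Section Coupling.
Variables (R : realType) (k : nat) (q : 'I_k -> R).
Hypothesis q_gt0 : forall i, 0 < q i.

Notation D := {ffun 'I_k.*2 -> int}.
Notation speed := (fun j : 'I_k.*2 => vel R (drift R k q) j).
Notation gibbs := (gibbs R k q).

Variable mu : R -> D -> R.
Hypothesis mu_prob : forall h, 0 <= h -> prob_vec (mu h).
Hypothesis mu0 : forall d, mu 0 d = (0 == d)%:R.
Hypothesis mu_rate : {in unit_steps k.*2, forall d,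
  (mu h d - (0 == d)%:R) / h @[h --> 0^'+] --> step_rate R k.*2 speed d}.

Definition grid_step (h : R) (f : seq int -> R) (x : seq int) : R :=
  avg (mu h) (fun d => f (push k.*2 (inc k.*2 d) x)).

Lemma grid_step01 h f x : 0 <= h -> (forall x, 0 <= f x <= 1) -> 0 <= grid_step h f x <= 1.
Proof. by move=> h0 f01; rewrite /grid_step avg_ge0 ?avg_le1 //; exact: mu_prob. Qed.

Lemma iter_grid_step01 h f m x : 0 <= h -> (forall x, 0 <= f x <= 1) ->
  0 <= iter m (grid_step h) f x <= 1.
Proof. by move=> h0 f01; elim: m x => [|m IH] x //=; exact: grid_step01. Qed.

Lemma gibbs01 f z : (forall x, 0 <= f x <= 1) -> 0 <= gibbs f z <= 1.
Proof.
move=> f01; rewrite gibbs_ge0 => [|//|x]; last by case/andP: (f01 x).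
rewrite -subr_ge0 -{1}(gibbs_cst R k q q_gt0 1 z) -gibbsB // gibbs_ge0 // => x.
by rewrite subr_ge0; case/andP: (f01 x).
Qed.

(** [u] is cut off outside the edges, where [gibbs] does not look, to get the bound at every list
    that [gibbs_ge0] asks for. *)
Lemma gibbs_norm_le u c z : 0 <= c -> (forall x, is_edge k.*2 x -> `|u x| <= c) ->
  `|gibbs u z| <= c.
Proof.
move=> c0 uc; pose w x := if is_edge k.*2 x then u x else 0.
rewrite (eq_gibbs R k q u w); last by move=> x ex _; rewrite /w ex.
have wc x : `|w x| <= c by rewrite /w; case: ifPn => [/uc //|_]; rewrite normr0.
have h1 : 0 <= gibbs (fun x => c - w x) z.
  by apply: gibbs_ge0 => // x; rewrite subr_ge0 (le_trans (ler_norm _)).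
have h2 : 0 <= gibbs (fun x => c + w x) z.
  apply: gibbs_ge0 => // x; have := wc x; rewrite ler_norml => /andP[+ _]; lra.
move: h1 h2; rewrite gibbsB gibbsD gibbs_cst // ler_norml; lra.
Qed.

(** To first order a grid step is the generator of the edge, which the intertwining turns into the
    rates of the h-transform. The error depends neither on [z] nor on [f]. *)
Lemma gibbs_grid_step h f z : 0 < h -> (forall x, 0 <= f x <= 1) ->
  `|gibbs (grid_step h f) z - gibbs f z
     - h * \sum_(y <- z :: nbrs z) dagger_rates q z y * gibbs f y|
  <= h * rate_err (unit_steps k.*2) mu 0 (step_rate R k.*2 speed) h.
Proof.
move=> h0 f01; rewrite gibbs_dagger // -gibbsZ -!gibbsB.
have err0 : 0 <= h * rate_err (unit_steps k.*2) mu 0 (step_rate R k.*2 speed) h.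
  by apply: mulr_ge0; [exact: ltW | apply: mulr_ge0 => //; exact: sumr_ge0].
apply: gibbs_norm_le => // x ex.
have Q0 : \sum_(d <- unit_steps k.*2) step_rate R k.*2 speed d = 0.
  have := sum_step_rate R k.*2 speed (fun=> 1).
  under eq_bigr do rewrite mulr1.
  by move=> ->; rewrite big1 // => j _; rewrite !subrr !mulr0 addr0.
have := avg_rate R D (unit_steps k.*2) mu 0 (step_rate R k.*2 speed) h
  (fun d => f (push k.*2 (inc k.*2 d) x)) h0 (mu_prob h (ltW h0)) (uniq_unit_steps _)
  (mem_head _ _) Q0 (fun d => f01 _).
rewrite sum_step_rate inc0 // edge_genE //.
congr (`| _ - _ * _ | <= _); apply: eq_bigr => j _.
by rewrite inc_basis inc_basisN.
Qed.

(** Covers repeated observation times, between which the steps have length 0. *)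
Lemma iter_grid_step0 f m x : (forall x, 0 <= f x <= 1) -> is_edge k.*2 x ->
  iter m (grid_step 0) f x = f x.
Proof.
move=> f01; elim: m x => //= m IH x ex; rewrite /grid_step.
rewrite (avg_delta _ _ _ _ 0) // ?inc0 ?IH //; first exact: mu_prob.
by move=> d; apply: iter_grid_step01.
Qed.

Variable p : R -> chamber k -> chamber k -> R.
Hypothesis hp : transition_function (dagger_rates q) p.

Lemma dagger_bounded : bounded_rates (dagger_rates q) (fun z => z :: nbrs z)
  (2 * \sum_(i < k) (q i + (q i)^-1)).
Proof.
move=> z; split; [exact: uniq_nbrs | exact: mem_head | exact: sum_dagger_rates |].
have := sum_dagger_rates R k q q_gt0 z; rewrite !big_cons /= {1 3}/dagger_rates eqxx.
set c := \sum_(i < k) _ => e.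
have c0 : 0 <= c by apply: sumr_ge0 => i _; rewrite addr_ge0 ?invr_ge0 // ltW.
have -> : \sum_(y <- nbrs z) `|dagger_rates q z y| = \sum_(y <- nbrs z) dagger_rates q z y.
  apply: eq_big_seq => y yz; rewrite ger0_norm //; have := uniq_nbrs k z; rewrite /= => /andP[nz _].
  rewrite /dagger_rates ifF; last by apply: contraNF nz => /eqP e'; rewrite {1}e'.
  by case: ifP => // _; rewrite divr_ge0 // ltW // Sp_gt0.
by rewrite normrN ger0_norm //; lra.
Qed.

Definition top_le (b : R) (i : int) : R := (i%:~R <= b)%R%:R.

(** [dagger_val] and [grid_val] are the probabilities that the top entry is at most b_i at each time
    t_i, for the h-transform and for the grid recursion. *)
Fixpoint dagger_val (l : seq (R * R)) (s : R) (z : chamber k) : R :=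
  if l is (t, b) :: l' then
    avg (p (t - s) z) (fun y => top_le b (chamber_row k (val y) 0%N) * dagger_val l' t y)
  else 1.

Fixpoint grid_val (n : nat) (l : seq (R * R)) (s : R) : seq int -> R :=
  if l is (t, b) :: l' then
    iter (2 ^ n) (grid_step ((t - s) / (2 ^ n)%:R))
      (fun x => top_le b (head 0 x) * grid_val n l' t x)
  else fun=> 1.

Lemma top_le01 b i x : 0 <= x <= 1 -> 0 <= top_le b i * x <= 1.
Proof. by move=> x01; rewrite /top_le; case: (i%:~R <= b) => /=; rewrite ?mulr1n ?mulr0n ?mul1r ?mul0r ?lexx ?ler01. Qed.

Lemma grid_val01 n l s x : path <=%R s (unzip1 l) -> 0 <= grid_val n l s x <= 1.
Proof.
elim: l s x => [|[t b] l IH] s x /=; first by rewrite ler01 lexx.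
move=> /andP[st tl]; apply: iter_grid_step01.
  by rewrite divr_ge0 // subr_ge0.
by move=> y; apply: top_le01; exact: IH.
Qed.

Lemma dagger_val01 l s x : path <=%R s (unzip1 l) -> 0 <= dagger_val l s x <= 1.
Proof.
elim: l s x => [|[t b] l IH] s x /=; first by rewrite ler01 lexx.
move=> /andP[st tl].
have h y : 0 <= top_le b (chamber_row k (val y) 0%N) * dagger_val l t y <= 1.
  by apply: top_le01; exact: IH.
have pv : prob_vec (p (t - s) x) by apply: transition_prob hp _; rewrite subr_ge0.
by rewrite avg_ge0 ?avg_le1.
Qed.

(** The support property of Gamma: under Gamma(z, .) the top entry is constant, so its indicator
    factors out. *)
Lemma gibbs_top b f z :
  gibbs (fun x => top_le b (head 0 x) * f x) z = top_le b (chamber_row k (val z) 0%N) * gibbs f z.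
Proof. by rewrite -gibbsZ; apply: eq_gibbs => x _ ->. Qed.

Lemma semigroup_step (t : R) z eps : 0 <= t -> 0 < eps ->
  \forall n \near \oo, forall f, (forall x, 0 <= f x <= 1) ->
    `|avg (p t z) (gibbs f) - gibbs (iter (2 ^ n) (grid_step (t / (2 ^ n)%:R)) f) z| <= eps.
Proof.
move=> t0 eps0; have [t00|tn0] := eqVneq t 0.
  apply: nearW => n f f01; rewrite t00 mul0r (transition_avg0 R _ _ p z _ hp); last first.
    by move=> y; exact: gibbs01.
  rewrite [X in _ - X](_ : _ = gibbs f z) ?subrr ?normr0 ?ltW //.
  by apply: eq_gibbs => x ex _; exact: iter_grid_step0.
have {}t0 : 0 < t by rewrite lt_neqAle eq_sym tn0.
apply: (semigroup_limit R _ _ _ _ dagger_bounded p _ gibbs grid_step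
  (fun h _ => rate_err (unit_steps k.*2) mu 0 (step_rate R k.*2 speed) h) hp) => //.
- by move=> f y f01; exact: gibbs01.
- by move=> h f x h0; apply: grid_step01; exact: ltW.
- by move=> y; apply: rate_err_cvg.
- by move=> h f y h0 f01; exact: gibbs_grid_step.
Qed.

(** The induction hypothesis is pointwise in the state, so it is used on a finite set carrying all
    but eps / 4 of the mass; it costs another eps / 4, and [semigroup_step], uniform in [f], costs
    eps / 2. *)
Lemma dagger_grid_limit l s z eps : path <=%R s (unzip1 l) -> 0 < eps ->
  \forall n \near \oo, `|dagger_val l s z - gibbs (grid_val n l s) z| <= eps.
Proof.
elim: l s z eps => [|[t b] l IH] s z eps /=.
  by move=> _ eps0; apply: nearW => n; rewrite gibbs_cst // subrr normr0 ltW.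
move=> /andP[st tl] eps0; have ts0 : 0 <= t - s by rewrite subr_ge0.
have e20 : 0 < eps / 2 by rewrite divr_gt0.
have e40 : 0 < eps / 4 by rewrite divr_gt0.
have pv := transition_prob R _ _ p _ z hp ts0.
have [r ur hr] := avg_tight R _ (p (t - s) z) (eps / 4) pv e40.
(* The successor keeps the divisor nonzero when [r] is empty. *)
have er0 : 0 < eps / 4 / (size r).+1%:R by rewrite divr_gt0 // ltr0n.
have n1 := near_all_in _ r (fun y n =>
   `|dagger_val l t y - gibbs (grid_val n l t) y| <= eps / 4 / (size r).+1%:R)
   (fun y _ => IH t y _ tl er0).
have n2 := semigroup_step (t - s) z (eps / 2) ts0 e20.
apply: filterS2 n1 n2 => n h1 h2.
pose F y := top_le b (chamber_row k (val y) 0%N) * dagger_val l t y.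
pose f x := top_le b (head 0 x) * grid_val n l t x.
have f01 x : 0 <= f x <= 1 by apply: top_le01; exact: grid_val01.
have F01 y : 0 <= F y <= 1 by apply: top_le01; exact: dagger_val01.
have G01 y : 0 <= gibbs f y <= 1 by exact: gibbs01.
have {}h2 := h2 f f01.
have h3 := avg_dist R _ (p (t - s) z) F (gibbs f) r pv F01 G01 ur.
have h4 : \sum_(y <- r) `|F y - gibbs f y| <= eps / 4.
  apply: (@le_trans _ _ (\sum_(y <- r) eps / 4 / (size r).+1%:R)).
    rewrite big_seq [X in _ <= X]big_seq; apply: ler_sum => y yr.
    rewrite /F /f gibbs_top -mulrBr normrM; apply: le_trans (h1 y yr).
    by rewrite ler_piMl // /top_le ger0_norm ?lern1 ?ler0n ?leq_b1.
  rewrite big_const_seq count_predT iter_addr addr0 -[X in X <= _]mulr_natr mulrAC ler_pdivrMr ?ltr0n //.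
  by apply: ler_wpM2l; [exact: ltW | rewrite ler_nat].
move: h2 h3 h4 hr; rewrite -/f -/F !ler_norml; lra.
Qed.

End Coupling.

(** * Last passage along a grid *)

Section Paths.
Variables (R : realType) (Y : nat -> R -> int).

Definition passage (n : nat) (s : nat -> R) : int :=
  \sum_(i < n) (Y i (s i.+1) - Y i (s i)).

Definition chain (G : seq R) (n : nat) (T : R) (s : nat -> R) : Prop :=
  [/\ forall i, (i < n)%N -> s i <= s i.+1, forall i, (i <= n)%N -> s i \in G & s n = T].

Definition best (G : seq R) (n : nat) (T : R) (b : int) : Prop :=
  (exists2 s, chain G n T s & b = passage n s) /\
  (forall s, chain G n T s -> passage n s <= b).

Fixpoint best_edge (G : seq R) (n : nat) (T : R) (x : seq int) : Prop :=
  match n, x with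
  | 0, [::] => best G 0 T 0
  | n'.+1, b :: x' => best G n'.+1 T b /\ best_edge G n' T x'
  | _, _ => False
  end.

Definition set_time (n : nat) (T : R) (s : nat -> R) : nat -> R :=
  fun i => if i == n then T else s i.

Lemma passage_set_time n T s :
  passage n.+1 (set_time n.+1 T s) = passage n s + (Y n T - Y n (s n)).
Proof.
rewrite /passage big_ord_recr /= /set_time eqxx ltn_eqF //; congr (_ + _).
apply: eq_bigr => i _; rewrite !ltn_eqF // ltnS; [exact: ltnW | exact: ltn_ord].
Qed.

Lemma passageS n s : passage n.+1 s = passage n s + (Y n (s n.+1) - Y n (s n)).
Proof. by rewrite /passage big_ord_recr. Qed.

Lemma chain_set_time (G G' : seq R) n T' s : {subset G <= G'} -> T' \in G' -> s n <= T' ->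
  chain G n (s n) s -> chain G' n.+1 T' (set_time n.+1 T' s).
Proof.
move=> sG TG sT [mono mem _]; split=> [i|i|]; rewrite /set_time ?eqxx //.
  rewrite ltnS leq_eqVlt => /orP[/eqP ->|lt]; first by rewrite eqxx ltn_eqF.
  by rewrite eqSS !ltn_eqF // ?mono // ltnW.
rewrite leq_eqVlt => /orP[/eqP ->|lt]; first by rewrite eqxx.
by rewrite ltn_eqF //; apply: sG; apply: mem.
Qed.

Lemma chainW G n T s : chain G n.+1 T s -> chain G n (s n) s.
Proof.
by move=> [mono mem _]; split=> // i h; [apply: mono | apply: mem]; exact: ltnW.
Qed.

Lemma chain_mono G n T s i j : chain G n T s -> (i <= j <= n)%N -> s i <= s j.
Proof.
move=> [mono _ _] /andP[/subnK <-]; elim: (j - i)%N => // m IH h.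
by apply: le_trans (IH _) (mono _ _); [exact: ltnW | rewrite -addSn].
Qed.

(** Split by the last switching time. If it is T', then Y_n contributes nothing and the optimum with
    one coordinate less remains; otherwise it lies in the old grid, and a chain ending at T is
    prolonged by the increment of Y_n. *)
Lemma best_step G n T T' b b' : T \in G -> (forall g, g \in G -> g <= T) -> T <= T' ->
  best G n.+1 T b -> best (T' :: G) n T' b' ->
  best (T' :: G) n.+1 T' (Num.max (b + (Y n T' - Y n T)) b').
Proof.
move=> TG GT TT' [[s sc ->] bb] [[s' sc' ->] bb'].
have sub : {subset G <= T' :: G} by move=> g; rewrite inE orbC => ->.
split.
  have [h|h] := leP (passage n.+1 s + (Y n T' - Y n T)) (passage n s').
    exists (set_time n.+1 T' s'); last by rewrite passage_set_time; have [_ _ ->] := sc'; rewrite subrr addr0.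
    have [_ _ e] := sc'; apply: (@chain_set_time (T' :: G) _ _ T') => //.
    - exact: mem_head.
    - by rewrite e.
    - by rewrite e.
  exists (set_time n.+1 T' s).
    have [_ mem _] := sc; apply: (@chain_set_time G _ _ T') => //.
    - exact: mem_head.
    - by apply: le_trans TT'; apply: GT; apply: mem.
    - exact: chainW sc.
  rewrite passage_set_time passageS; have [_ _ ->] := sc; ring.
move=> u uc; rewrite le_max; have [mono mem uT] := uc.
have [uT'|uT'] := eqVneq (u n) T'.
  apply/orP; right; rewrite passageS uT uT' subrr addr0; apply: bb'.
  by have := chainW _ _ _ _ uc; rewrite uT'.
have unG : u n \in G by have := mem n (leqnSn n); rewrite inE (negPf uT').
have unT : u n <= T := GT _ unG.
apply/orP; left; rewrite passageS uT.
have uc' : chain G n (u n) u.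
  split=> // i h; first by apply: mono; exact: ltnW.
  (* An earlier time equal to the new point T' is squeezed between T' and u_n <= T, hence equals T
     and is in the old grid. *)
  have := mem i (leqW h); rewrite inE => /orP[/eqP e|//].
  have h1 : u i <= u n by apply: chain_mono uc _; rewrite h leqnSn.
  have -> : u i = T by apply/eqP; rewrite eq_le (le_trans h1 unT) e TT'.
  by [].
have := bb _ (chain_set_time G G n T u (fun g h => h) TG unT uc').
rewrite passage_set_time; lia.
Qed.

Lemma best0 G T : T \in G -> best G 0 T 0.
Proof.
move=> TG; split; last by move=> s _; rewrite /passage big_ord0.
by exists (fun=> T); rewrite /passage ?big_ord0 //; split.
Qed.

Lemma best_edge_step G n T T' x : T \in G -> (forall g, g \in G -> g <= T) -> T <= T' ->
  best_edge G n T x -> best_edge (T' :: G) n T' (push n (fun i => Y i T' - Y i T) x).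
Proof.
move=> TG GT TT'; elim: n x => [|n IH] [|b x] //=.
  by move=> _; apply: best0; exact: mem_head.
move=> [hb hx]; have h := IH _ hx; split => //.
apply: best_step hb _ => //.
case: (n) (push n _ x) h => [|m] [|c y] //=; by [move=> _; exact: best0 (mem_head _ _) | case].
Qed.

Lemma best_edge_init n : best_edge [:: 0] n 0 (nseq n 0).
Proof.
elim: n => [|n IH] /=; first by apply: best0; exact: mem_head.
split=> //.
have z s : chain [:: 0] n.+1 0 s -> passage n.+1 s = 0.
  move=> [_ mem _]; rewrite /passage big1 // => i _.
  have := mem i (ltnW (ltn_ord i)); have := mem i.+1 (ltn_ord i).
  by rewrite !inE => /eqP -> /eqP ->; rewrite subrr.
have c0 : chain [:: 0] n.+1 0 (fun=> 0) by split=> // i _; exact: mem_head.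
by split=> [|s /z -> //]; exists (fun=> 0) => //; rewrite z.
Qed.

Fixpoint run (n : nat) (x : seq int) (s : R) (ts : seq R) : seq int :=
  if ts is t :: ts' then run n (push n (fun i => Y i t - Y i s) x) t ts' else x.

Lemma run_cat n x s ts ts' : run n x s (ts ++ ts') = run n (run n x s ts) (last s ts) ts'.
Proof. by elim: ts x s => //= t ts IH x s; rewrite IH. Qed.

Lemma best_run n ts : path <=%R 0 ts ->
  best_edge (rev (0 :: ts)) n (last 0 ts) (run n (nseq n 0) 0 ts).
Proof.
(* New times are put at the head of the grid while the list is consumed, hence [catrev]. *)
suff H G x s : s \in G -> (forall g, g \in G -> g <= s) -> best_edge G n s x ->
    path <=%R s ts -> best_edge (catrev ts G) n (last s ts) (run n x s ts).
  move=> h; rewrite rev_cons -cats1 -catrevE; apply: H => //; first exact: mem_head.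
    by move=> g; rewrite inE => /eqP ->.
  exact: best_edge_init.
elim: ts G x s => //= t ts IH G x s sG Gs bx /andP[st tts].
apply: IH => //; first exact: mem_head.
  by move=> g; rewrite inE => /orP[/eqP -> //|/Gs h]; exact: le_trans st.
exact: best_edge_step.
Qed.

Lemma best_head n ts : path <=%R 0 ts ->
  best (0 :: ts) n (last 0 ts) (head 0 (run n (nseq n 0) 0 ts)).
Proof.
move=> pts; have := best_run n ts pts.
have eqG s : chain (rev (0 :: ts)) n (last 0 ts) s <-> chain (0 :: ts) n (last 0 ts) s.
  by split=> -[h1 h2 h3]; split=> // i hi; have := h2 i hi; rewrite mem_rev.
case: n eqG (run _ _ _ _) => [|n] eqG [|b x] //=.
  by move=> _; apply: best0; exact: mem_last.
move=> [[[s sc ->] bb] _]; split; first by exists s => //; apply/eqG.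
by move=> u /eqG; exact: bb.
Qed.

(** Dyadic subdivision makes the grids nested in [N] and keeps every observation time as a grid
    point. *)
Fixpoint grid (N : nat) (s : R) (l : seq R) : seq R :=
  if l is t :: l' then
    [seq s + (t - s) / (2 ^ N)%:R * i.+1%:R | i <- iota 0 (2 ^ N)] ++ grid N t l'
  else [::].

Lemma last_grid_block N (s t : R) :
  last s [seq s + (t - s) / (2 ^ N)%:R * i.+1%:R | i <- iota 0 (2 ^ N)] = t.
Proof.
have : (0 < 2 ^ N)%N by rewrite expn_gt0.
case E : (2 ^ N)%N => [//|m] _.
have -> : iota 0 m.+1 = rcons (iota 0 m) m by rewrite -[in LHS]addn1 iotaD cats1.
by rewrite map_rcons last_rcons divfK ?pnatr_eq0 // addrC subrK.
Qed.

Lemma last_grid N s l : last s (grid N s l) = last s l.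
Proof. by elim: l s => //= t l IH s; rewrite last_cat last_grid_block IH. Qed.

Lemma path_grid N s l : path <=%R s l -> path <=%R s (grid N s l).
Proof.
elim: l s => //= t l IH s /andP[st tl]; rewrite cat_path last_grid_block IH // andbT.
set d := (t - s) / _; have d0 : 0 <= d by rewrite divr_ge0 // subr_ge0.
suff H m j : path <=%R (s + d * j%:R) [seq s + d * i.+1%:R | i <- iota j m].
  by have := H (2 ^ N)%N 0%N; rewrite mulr0 addr0.
by elim: m j => //= m IHm j; rewrite IHm andbT lerD2l ler_wpM2l // ler_nat.
Qed.

Lemma sub_grid N s l : {subset grid N s l <= grid N.+1 s l}.
Proof.
elim: l s => //= t l IH s u; rewrite !mem_cat => /orP[/mapP[i]|/IH ->]; last by rewrite orbT.
(* Index i stands for the multiple i + 1 of the mesh, so in the halved grid the point has index 2i +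
   1. *)
rewrite mem_iota add0n => /andP[_ iN] ->; apply/orP; left; apply/mapP; exists (i.*2.+1).
  by rewrite mem_iota expnS /=; lia.
congr (_ + _); rewrite expnS natrM -doubleS -muln2 natrM.
by field; rewrite pnatr_eq0 -lt0n expn_gt0.
Qed.

Lemma grid_dense N s l u : path <=%R s l -> s <= u <= last s l ->
  exists2 g, g \in s :: grid N s l & u <= g <= u + (last s l - s) / (2 ^ N)%:R.
Proof.
have N0 : 0 < (2 ^ N)%:R :> R by rewrite ltr0n expn_gt0.
elim: l s => [|t l IH] s /=.
  move=> _ us; exists s; first exact: mem_head.
  by rewrite subrr mul0r addr0 andbC.
move=> /andP[st tl] /andP[su ul].
have tl' : t <= last t l.
  have := mem_last t l; rewrite inE => /orP[/eqP -> //|].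
  by move: tl; rewrite (path_sortedE le_trans) => /andP[/allP h _] /h.
have [tu|ut] := ltP t u.
  have [g gG /andP[ug gu]] := IH t tl ltac:(by rewrite (ltW tu) ul).
  exists g.
    have := mem_last s [seq s + (t - s) / (2 ^ N)%:R * i.+1%:R | i <- iota 0 (2 ^ N)].
    rewrite last_grid_block in_cons => h.
    move: gG; rewrite !inE mem_cat => /orP[/eqP ->|->]; last by rewrite !orbT.
    by rewrite orbA h.
  rewrite ug (le_trans gu) // lerD2l ler_pM2r ?invr_gt0 // lerD2l lerN2 //.
pose d := (t - s) / (2 ^ N)%:R.
have d0 : 0 <= d by rewrite divr_ge0 ?subr_ge0 // ltW.
have ex : exists i, (i <= 2 ^ N)%N && (u <= s + d * i%:R).
  by exists (2 ^ N)%N; rewrite leqnn /d divfK ?gt_eqF // addrC subrK.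
case: (ex_minnP ex) => i /andP[iN ui] imin; exists (s + d * i%:R).
  case: i iN {ui imin} => [|i] iN; first by rewrite mulr0 addr0 mem_head.
  rewrite inE mem_cat; apply/orP; right; apply/orP; left; apply/mapP; exists i => //.
  by rewrite mem_iota.
rewrite ui /=; apply: (@le_trans _ _ (u + d)); last first.
  by rewrite lerD2l ler_pM2r ?invr_gt0 // lerD2r.
case: i iN ui imin => [|i] iN ui imin; first by rewrite mulr0 addr0 (le_trans su) // lerDl.
have : ~~ ((i <= 2 ^ N)%N && (u <= s + d * i%:R)) by apply/negP => /imin; rewrite ltnn.
rewrite (ltnW iN) /= -ltNge => h.
by rewrite -natr1 mulrDr mulr1 addrA lerD2r ltW.
Qed.

(** Times are rounded up: this is monotone, and right-continuity controls the path on that side. *)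
Definition next_point (G : seq R) (T u : R) : R := \big[Num.min/T]_(g <- G | u <= g) g.

Lemma next_pointP (G : seq R) (T u : R) : u <= T ->
  [/\ (next_point G T u == T) || (next_point G T u \in G), u <= next_point G T u,
      next_point G T u <= T & forall g, g \in G -> u <= g -> next_point G T u <= g].
Proof.
move=> uT; rewrite /next_point; elim: G => [|g G [h1 h2 h3 h4]].
  by rewrite big_nil eqxx uT lexx.
rewrite big_cons; case: ifPn => [ug|nug]; last first.
  split=> // [|y]; first by rewrite inE; case/orP: h1 => ->; rewrite ?orbT.
  by rewrite inE => /orP[/eqP ->|/h4 //] ug; rewrite ug in nug.
split.
- rewrite minEle inE; case: ifP => _; first by rewrite eqxx orbT.
  by case/orP: h1 => ->; rewrite ?orbT.
- by rewrite le_min ug h2.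
- by rewrite ge_min h3 orbT.
- by move=> y; rewrite inE ge_min => /orP[/eqP ->|/h4 h /h ->]; rewrite ?lexx ?orbT.
Qed.

Lemma right_constant n (s : nat -> R) :
  (forall i t, (i < n)%N -> 0 <= t -> \forall u \near t^'+, Y i u = Y i t) ->
  (forall i, (i <= n)%N -> 0 <= s i) ->
  \forall d \near 0^'+, forall i j u, (i <= n)%N -> (j < n)%N -> s i <= u <= s i + d ->
    Y j u = Y j (s i).
Proof.
move=> rc s0.
have one i j : (i <= n)%N -> (j < n)%N ->
    \forall d \near 0^'+, forall u, s i <= u <= s i + d -> Y j u = Y j (s i).
  move=> hi hj; have [/= e e0 he] := rc j (s i) hj (s0 i hi).
  near=> d.
  have d0 : 0 < d by near: d; exact: nbhs_right_gt.
  have de : d < e by near: d; exact: nbhs_right_lt.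
  move=> u /andP[]; rewrite le_eqVlt => /orP[/eqP -> //|su us].
  by apply: he => //=; rewrite ltr0_norm; lra.
have all_ij : \forall d \near 0^'+, forall (i : 'I_n.+1) (j : 'I_n) u,
    s i <= u <= s i + d -> Y j u = Y j (s i).
  apply: filter_forall => i; apply: filter_forall => j.
  by apply: one => //; rewrite -ltnS.
apply: filterS all_ij => d h i j u hi hj; rewrite -ltnS in hi.
exact: (h (Ordinal hi) (Ordinal hj)).
Unshelve. all: by end_near.
Qed.

(** Right-continuous integer paths are constant just after each of the finitely many times, so
    rounding up to a fine grid leaves the passage value exactly unchanged. *)
Lemma grid_approx n l s :
  (forall i t, (i < n)%N -> 0 <= t -> \forall u \near t^'+, Y i u = Y i t) ->
  path <=%R 0 l -> 0 <= s 0%N -> (forall i, (i < n)%N -> s i <= s i.+1) -> s n = last 0 l ->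
  exists N s', chain (0 :: grid N 0 l) n (last 0 l) s' /\ passage n s' = passage n s.
Proof.
move=> rc pl s0 mono sT; set T := last 0 l.
have le i j : (i <= j <= n)%N -> s i <= s j.
  move=> /andP[/subnK <-]; elim: (j - i)%N => // m IH h.
  by apply: le_trans (IH _) (mono _ _); [exact: ltnW | rewrite -addSn].
have s_ge0 i : (i <= n)%N -> 0 <= s i by move=> h; apply: le_trans s0 (le _ _ _).
have s_leT i : (i <= n)%N -> s i <= T by move=> h; rewrite /T -sT; apply: le; rewrite h /=.
(* T may be 0, and [near_dyadic] needs a positive length; the mesh is at most (T + 1) / 2^N
   anyway. *)
have T1 : 0 < T + 1 by rewrite ltr_wpDl // /T -sT s_ge0.
have [N _ /(_ N (leqnn N)) HN] := near_dyadic R _ _ T1 (right_constant n s rc s_ge0).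
pose G := 0 :: grid N 0 l.
have TG : T \in G by rewrite /T -(last_grid N); exact: mem_last.
pose s' i := next_point G T (s i).
have s'G i : (i <= n)%N -> s' i \in G.
  by move=> /s_leT/(next_pointP G)[/orP[/eqP e|//] _ _ _]; rewrite /s' e.
have near_s i j : (i <= n)%N -> (j < n)%N -> Y j (s' i) = Y j (s i).
  move=> hi hj; apply: HN => //; have [_ h2 _ h4] := next_pointP G T (s i) (s_leT i hi).
  rewrite h2 /=.
  have [g gG /andP[ug gu]] := grid_dense N 0 l (s i) pl ltac:(by rewrite s_ge0 // s_leT).
  apply: le_trans (h4 g gG ug) (le_trans gu _).
  by rewrite lerD2l ler_pM2r ?invr_gt0 ?ltr0n ?expn_gt0 // subr0 lerDl.
exists N, s'; split; first split.
- move=> i hi; have [_ _ _ h4] := next_pointP G T (s i) (s_leT i (ltnW hi)).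
  have [_ h2 _ _] := next_pointP G T (s i.+1) (s_leT i.+1 hi).
  by apply: h4; [exact: s'G | exact: le_trans (mono i hi) h2].
- exact: s'G.
- have [_ h2 h3 _] := next_pointP G T (s n) (s_leT n (leqnn n)).
  by apply/eqP; rewrite eq_le h3 /s' -/T; move: h2; rewrite {1}sT.
- by apply: eq_bigr => i _; rewrite !near_s //; [exact: ltnW | exact: ltn_ord ..].
Qed.

End Paths.

Section LastPassage.
Variables (R : realType) (k : nat) (T : Type) (Z Zt : R -> T -> {ffun 'I_k -> int}) (w : T).

Definition drive (i : nat) (t : R) : int := inc k.*2 [ffun j => interleaved Z Zt j t w] i.

Definition grid_top (N : nat) (l : seq R) : int :=
  head 0 (run R drive k.*2 (nseq k.*2 0) 0 (grid R N 0 l)).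

Lemma grid_top_le N l : path <=%R 0 l -> grid_top N l <= grid_top N.+1 l.
Proof.
move=> pl; rewrite /grid_top; have [[s [mono mem sT] ->] _] := best_head R drive k.*2 _ (path_grid R N 0 l pl).
have [_] := best_head R drive k.*2 _ (path_grid R N.+1 0 l pl); apply.
split=> //; last by rewrite sT !last_grid.
move=> i hi; have := mem i hi; rewrite !inE => /orP[-> //|/sub_grid ->].
by rewrite orbT.
Qed.

Hypothesis rcZ : forall t, 0 <= t -> \forall u \near t^'+, forall i, Z u w i = Z t w i.
Hypothesis rcZt : forall t, 0 <= t -> \forall u \near t^'+, Zt u w = Zt t w.

Lemma drive_right i t : 0 <= t -> \forall u \near t^'+, drive i u = drive i t.
Proof.
move=> t0; apply: filterS2 (rcZ t t0) (rcZt t t0) => u e1 e2.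
rewrite /drive /inc; case: insub => // j; rewrite !ffunE /interleaved.
by case: ifP => _; rewrite ?e1 ?e2.
Qed.

Lemma last_passage_le (l : seq R) (a : R) : path <=%R 0 l ->
  (last_passage (interleaved Z Zt) (last 0%R l) w <= a%:E)%E <->
  forall N, (grid_top N l)%:~R <= a.
Proof.
move=> pl.
have sumE (s : nat -> R) : \sum_(i < k.*2) (interleaved Z Zt i (s i.+1) w - interleaved Z Zt i (s i) w)
    = passage R drive k.*2 s.
  by apply: eq_bigr => i _; rewrite /drive !incE !ffunE.
split=> [h N|h].
  have [[s [mono mem sT] e] _] := best_head R drive k.*2 _ (path_grid R N 0 l pl).
  rewrite -lee_fin; apply: le_trans h; apply: ereal_sup_ubound; exists s; split => //.
  - have := mem 0%N (leq0n _); rewrite inE => /orP[/eqP -> //|].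
    have := path_grid R N 0 l pl; rewrite (path_sortedE le_trans) => /andP[/allP p0 _].
    exact: p0.
  - by rewrite sT last_grid.
  - by rewrite /grid_top e sumE.
apply: ge_ereal_sup => /= _ [s [s0 mono sT ->]].
have [N [s' [sc e]]] := grid_approx R drive k.*2 l s (fun i t _ => drive_right i t) pl s0 mono sT.
rewrite lee_fin sumE -e; apply: le_trans (h N); rewrite ler_int.
have [_ bb] := best_head R drive k.*2 _ (path_grid R N 0 l pl).
by apply: bb; rewrite last_grid.
Qed.

End LastPassage.

(** * Increments of the walks *)

Section Decomposition.
Context d (T : measurableType d) (R : realType) (P : probability T R) (S : countType).

(** Total probability; [pickle] transports the fibres to the natural numbers, where countable
    additivity applies. *)
Lemma prob_decomposition (A : set T) (X : T -> S) : measurable A ->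
  (forall s, measurable (X @^-1` [set s])) ->
  P A = \esum_(s in [set: S]) P (A `&` X @^-1` [set s]).
Proof.
move=> mA mX; pose F (n : nat) := A `&` [set w | choice.pickle (X w) = n].
have FE s : F (choice.pickle s) = A `&` X @^-1` [set s].
  by apply/seteqP; split=> w [Aw] /= => [/(pcan_inj choice.pickleK)|] e; split=> //=; rewrite e.
have mF n : measurable (F n).
  have [[s <-]|nex] := pselect (exists s : S, choice.pickle s = n); first by rewrite FE; exact: measurableI.
  rewrite (_ : F n = set0); first exact: measurable0.
  by apply/seteqP; split=> // w [_ /= e]; apply: nex; exists (X w).
have tF : trivIset setT F by move=> i j _ _ [w [[_ <-] [_ <-]]].
have UF : \bigcup_n F n = A.
  by apply/seteqP; split=> [w [n _ []]|w Aw] //; exists (choice.pickle (X w)).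
rewrite -{1}UF (measure_bigcup P setT F (fun n _ => mF n) tF).
transitivity (\esum_(n in [set: nat]) P (F n)).
  rewrite -nneseries_esumT; last by move=> n; exact: measure_ge0.
  by apply: eq_eseriesl => n; rewrite in_setT.
rewrite (esumID (range (@choice.pickle S))); last by move=> n _; exact: measure_ge0.
rewrite [X in (_ + X)%E]esum1 ?adde0 ?setTI; last first.
  move=> n nr; rewrite (_ : F n = set0) ?measure0 //.
  by apply/seteqP; split=> // w [_ /= e]; case: nr; exists (X w).
have bij : set_bij [set: S] (range (@choice.pickle S)) (@choice.pickle S).
  split=> [s _|s s' _ _ e|n //]; first by exists s.
  exact: (pcan_inj choice.pickleK).
rewrite (reindex_esum _ _ _ _ bij).
by apply: eq_esum => s _; rewrite FE.
Qed.

Lemma measurable_fibers (X : T -> S) (B : S -> set T) :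
  (forall s, measurable (X @^-1` [set s])) -> (forall s, measurable (B s)) ->
  measurable [set w | B (X w) w].
Proof.
move=> mX mB; rewrite (_ : [set _ | _] = \bigcup_s (X @^-1` [set s] `&` B s)).
  by apply: countable_bigcupT_measurable => // s; exact: measurableI.
by apply/seteqP; split=> [w h|w [s _ [<-]]] //; exists (X w).
Qed.

End Decomposition.

(** * Sequential tests of a chain driven by random variables of known joint law *)

Section ChainLaw.
Context d (T : measurableType d) (R : realType) (P : probability T R).
Variables (E : Type) (D : countType) (phi : E -> D -> E).

Definition chain_step : Type := ((T -> D) * (E -> D -> R) * (E -> bool))%type.

(* The state after a step is [phi] of the previous state and the value of the
   random variable of that step; every state has to satisfy its test. *)
Fixpoint chain_ok (l : seq chain_step) (x : E) (w : T) : bool :=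
  if l is (X, _, c) :: l' then c (phi x (X w)) && chain_ok l' (phi x (X w)) w else true.

Fixpoint chain_eq (l : seq chain_step) (ds : seq D) (w : T) : bool :=
  match l, ds with
  | (X, _, _) :: l', e :: ds' => (X w == e) && chain_eq l' ds' w
  | _, _ => true
  end.

Fixpoint chain_wt (l : seq chain_step) (x : E) (ds : seq D) : R :=
  match l, ds with
  | (_, kap, _) :: l', e :: ds' => kap x e * chain_wt l' (phi x e) ds'
  | _, _ => 1
  end.

Fixpoint chain_val (l : seq chain_step) (x : E) : R :=
  if l is (_, kap, c) :: l' then
    avg (kap x) (fun e => (c (phi x e))%:R * chain_val l' (phi x e))
  else 1.

Fixpoint chain_reg (l : seq chain_step) : Prop :=
  if l is (X, kap, _) :: l' then
    [/\ forall s, measurable (X @^-1` [set s]), forall x, prob_vec (kap x) & chain_reg l']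
  else True.

Lemma chain_val01 l x : chain_reg l -> 0 <= chain_val l x <= 1.
Proof.
elim: l x => [|[[X kap] c] l IH] x /=; first by rewrite ler01 lexx.
move=> [_ hk hl].
have f01 e : 0 <= (c (phi x e))%:R * chain_val l (phi x e) <= 1.
  by have := IH (phi x e) hl; case: (c _); rewrite ?mul1r ?mul0r ?lexx ?ler01.
by rewrite avg_ge0 ?avg_le1.
Qed.

Lemma measurable_chain_ok l x : chain_reg l -> measurable [set w | chain_ok l x w].
Proof.
elim: l x => [|[[X kap] c] l IH] x /=.
  by move=> _; rewrite (_ : [set _ | _] = setT); [exact: measurableT | apply/seteqP; split].
move=> [mX hk hl].
apply: (@measurable_fibers _ _ _ X (fun s => [set w | c (phi x s) && chain_ok l (phi x s) w])) => // s.
case: (c _) => /=; first exact: IH.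
by rewrite (_ : [set _ | _] = set0); [exact: measurable0 | apply/seteqP; split].
Qed.

(** Summing over one value at a time turns the joint law into iterated averages; [B] holds the
    values already fixed and [b] their weight. It serves the edge, with [phi] given by [push], and
    the h-transform, with [phi] keeping the new state. *)
Lemma chain_prob l x (B : set T) (b : R) : chain_reg l -> measurable B -> 0 <= b ->
  (forall ds, size ds = size l ->
    P (B `&` [set w | chain_eq l ds w]) = (b * chain_wt l x ds)%:E) ->
  P (B `&` [set w | chain_ok l x w]) = (b * chain_val l x)%:E.
Proof.
elim: l x B b => [|[[X kap] c] l IH] x B b /=.
  by move=> _ _ _ h; have := h [::] erefl.
move=> [mX hk hl] mB b0 hB.
have mok : measurable [set w | c (phi x (X w)) && chain_ok l (phi x (X w)) w].
  by apply: (@measurable_chain_ok ((X, kap, c) :: l)).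
rewrite (@prob_decomposition d T R P D _ X) //; last exact: measurableI.
have v01 e := chain_val01 l (phi x e) hl.
have f01 e : 0 <= (c (phi x e))%:R * chain_val l (phi x e) <= 1.
  by have := v01 e; case: (c _); rewrite ?mul1r ?mul0r ?lexx ?ler01.
rewrite EFinM avgE // -esumZl //; last first.
  by move=> e; rewrite mulr_ge0 //; [exact: (hk x).1 | case/andP: (f01 e)].
apply: eq_esum => e _.
have mBe : measurable (B `&` X @^-1` [set e]) by exact: measurableI.
have := IH (phi x e) (B `&` X @^-1` [set e]) (b * kap x e) hl mBe.
rewrite mulr_ge0 //; last exact: (hk x).1.
move=> /(_ isT) {}IH.
have {}IH : P (B `&` X @^-1` [set e] `&` [set w | chain_ok l (phi x e) w])
    = (b * kap x e * chain_val l (phi x e))%:E.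
  apply: IH => ds sds; rewrite -mulrA -(hB (e :: ds)) /= ?sds //; congr (P _).
  by apply/seteqP; split=> [w [[Bw /= ->] ->]|w [Bw /andP[/eqP Xw h]]] //=; rewrite eqxx.
case ce: (c (phi x e)).
  rewrite mul1r mulrA -IH; congr (P _).
  by apply/seteqP; split=> [w [[Bw /= h] Xw]|w [[Bw Xw] h]] /=; move: h; rewrite Xw ce.
rewrite mul0r !mulr0 (_ : _ `&` _ = set0) ?measure0 //.
by apply/seteqP; split=> // w [[Bw /= h] Xw]; move: h; rewrite Xw ce.
Qed.

End ChainLaw.
Arguments chain_step {d} T R E D.
Arguments chain_ok {d T R E D} phi l x w.
Arguments chain_eq {d T R E D} l ds w.
Arguments chain_wt {d T R E D} phi l x ds.
Arguments chain_val {d T R E D} phi l x.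
Arguments chain_reg {d T R E D} l.
Arguments measurable_chain_ok {d T R E D} phi l x.
Arguments chain_prob {d T R} P {E D} phi l x B b.

(** * Spatial homogeneity of the walks *)

Section WalkShift.
Variables (R : realType) (a b : R).
Hypotheses (a0 : 0 <= a) (b0 : 0 <= b).

Lemma walk_rates_bounded :
  bounded_rates (walk_rates a b) (fun x => [:: x; x + 1; x - 1]) (2 * (a + b)).
Proof.
move=> x.
have n1 : (x == x + 1) = false by lia.
have n2 : (x == x - 1) = false by lia.
have n3 : (x - 1 == x + 1) = false by lia.
split; rewrite ?inE ?eqxx //=.
- by rewrite !inE n1 n2 /= eq_sym n3.
- by rewrite !big_cons big_nil /walk_rates n1 n2 n3 !eqxx; ring.
- rewrite !big_cons big_nil /walk_rates n1 n2 n3 !eqxx normrN !ger0_norm ?addr_ge0 //.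
  by rewrite le_eqVlt; apply/orP; left; apply/eqP; ring.
Qed.

Lemma transition_shift p (c : int) : transition_function (walk_rates a b) p ->
  transition_function (walk_rates a b) (fun t x y => p t (x + c) (y + c)).
Proof.
move=> [p0 p1 pid CK rate].
have bij : set_bij [set: int] [set: int] (fun y => y + c).
  split=> [//|y y' _ _ /addIr //|y _]; by exists (y - c); rewrite ?subrK.
split.
- by move=> t x y; exact: p0.
- by move=> t x t0; have := p1 t (x + c) t0; rewrite (reindex_esum _ _ _ _ bij).
- by move=> x y; rewrite pid (inj_eq (addIr c)).
- move=> s t x z s0 t0; rewrite CK //.
  by rewrite (@reindex_esum R _ _ [set: int] [set: int] (fun y => y + c) _ bij).
- move=> x y; have := rate (x + c) (y + c); rewrite (inj_eq (addIr c)).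
  suff -> : walk_rates a b (x + c) (y + c) = walk_rates a b x y by [].
  rewrite /walk_rates.
  have -> : (y + c == x + c + 1) = (y == x + 1) by lia.
  have -> : (y + c == x + c - 1) = (y == x - 1) by lia.
  by have -> : (y + c == x + c) = (y == x) by lia.
Qed.

(** A translate of [p] is a transition function for the same rates, hence equals [p]. *)
Lemma walk_transition_shift p t x y : transition_function (walk_rates a b) p -> 0 <= t ->
  p t x y = p t 0 (y - x).
Proof.
move=> hp t0; have h := transition_shift p x hp.
rewrite -[LHS](_ : p t (0 + x) ((y - x) + x) = _); last by rewrite add0r subrK.
exact: (transition_unique R _ _ _ _ walk_rates_bounded _ _ t 0 (y - x) h hp t0).
Qed.

End WalkShift.

(** The product rule at h = 0 for factors tending to 1. *)
Lemma cvg_prod1 (R : realType) (I : Type) (r : seq I) (rho : I -> R -> R) (c : I -> R) :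
  (forall i, (rho i h - 1) / h @[h --> 0^'+] --> c i) ->
  \prod_(i <- r) rho i h @[h --> 0^'+] --> (1 : R) /\
  ((\prod_(i <- r) rho i h) - 1) / h @[h --> 0^'+] --> \sum_(i <- r) c i.
Proof.
move=> hc.
have id0 : (h : R) @[h --> 0^'+] --> (0 : R) by exact: cvg_at_right_filter.
have h1 i : rho i h @[h --> 0^'+] --> (1 : R).
  have e : 1 + h * ((rho i h - 1) / h) @[h --> 0^'+] --> 1 + 0 * c i.
    by apply: cvgD; [exact: cvg_cst | exact: cvgM].
  rewrite mul0r addr0 in e; apply: cvg_trans e; apply: near_eq_cvg.
  near=> h; have h0 : h != 0 by rewrite gt_eqF //; near: h; exact: nbhs_right_gt.
  by field.
elim: r => [|i s [IH1 IH2]].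
  rewrite big_nil (_ : (fun h => \prod_(i <- [::]) rho i h) = fun=> 1); last first.
    by apply/funext => h; rewrite big_nil.
  rewrite (_ : (fun h => (\prod_(i <- [::]) rho i h - 1) / h) = fun=> 0); last first.
    by apply/funext => h; rewrite big_nil subrr mul0r.
  by split; exact: cvg_cst.
split; under eq_fun do rewrite big_cons.
  have e : rho i h * \prod_(j <- s) rho j h @[h --> 0^'+] --> (1 * 1 : R) by exact: cvgM.
  by rewrite mulr1 in e.
rewrite big_cons.
have e : (rho i h - 1) / h * \prod_(j <- s) rho j h + (\prod_(j <- s) rho j h - 1) / h
   @[h --> 0^'+] --> c i * 1 + \sum_(j <- s) c j.
  by apply: cvgD => //; apply: cvgM.
rewrite mulr1 in e; apply: cvg_trans e; apply: near_eq_cvg; near=> h; ring.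
Unshelve. all: by end_near.
Qed.

(** * The law of the joint increments and its rates at time 0 *)

Section IncrementLaw.
Variables (R : realType) (k : nat) (q : 'I_k -> R).
Hypothesis q_gt0 : forall i, 0 < q i.
Variable pw : 'I_k -> R -> int -> int -> R.
Hypothesis hpw : forall i, transition_function (walk_rates (q i)^-1 (q i)) (pw i).

Notation D := {ffun 'I_k.*2 -> int}.
Notation speed := (fun j : 'I_k.*2 => vel R (drift R k q) j).

(** Odd positions carry the components of [Zt], which has the law of -Z. *)
Definition flip (j : nat) (x : int) : int := if odd j then - x else x.

Definition inc_law (h : R) (d : D) : R :=
  \prod_(j < k.*2) pw (half_ord j) h 0 (flip j (d j)).

Lemma speedE (j : 'I_k.*2) :
  speed j = if odd j then q (half_ord j) else (q (half_ord j))^-1.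
Proof. by rewrite /vel -[j./2]/(nat_of_ord (half_ord j)) driftE invrK. Qed.

Lemma flip_rate0 (j : 'I_k.*2) :
  (pw (half_ord j) h 0 0 - 1) / h @[h --> 0^'+] --> - (speed j + (speed j)^-1).
Proof.
have [_ _ _ _ /(_ 0 0)] := hpw (half_ord j); rewrite eqxx.
suff -> : walk_rates (q (half_ord j))^-1 (q (half_ord j)) 0 0 = - (speed j + (speed j)^-1) by [].
by rewrite /walk_rates /= speedE; case: (odd j); rewrite ?invrK // addrC.
Qed.

Lemma flip_rate_up (j : 'I_k.*2) :
  pw (half_ord j) h 0 (flip j 1) / h @[h --> 0^'+] --> speed j.
Proof.
have [_ _ _ _ /(_ 0 (flip j 1))] := hpw (half_ord j).
have -> : (0 == flip j 1) = false by rewrite /flip; case: ifP.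
have -> : walk_rates (q (half_ord j))^-1 (q (half_ord j)) 0 (flip j 1) = speed j.
  by rewrite /walk_rates /flip speedE; case: (odd j).
by under eq_fun do rewrite subr0.
Qed.

Lemma flip_rate_dn (j : 'I_k.*2) :
  pw (half_ord j) h 0 (flip j (- 1)) / h @[h --> 0^'+] --> (speed j)^-1.
Proof.
have [_ _ _ _ /(_ 0 (flip j (- 1)))] := hpw (half_ord j).
have -> : (0 == flip j (- 1)) = false by rewrite /flip; case: ifP.
have -> : walk_rates (q (half_ord j))^-1 (q (half_ord j)) 0 (flip j (- 1)) = (speed j)^-1.
  by rewrite /walk_rates /flip speedE; case: (odd j); rewrite //= ?invrK.
by under eq_fun do rewrite subr0.
Qed.

Lemma flip0 j : flip j 0 = 0. Proof. by rewrite /flip oppr0; case: ifP. Qed.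

Lemma inc_law0 d : inc_law 0 d = (0 == d)%:R.
Proof.
rewrite /inc_law; have [<-|d0] := eqVneq 0 d.
  rewrite big1 // => j _; rewrite ffunE flip0.
  by have [_ _ -> _ _] := hpw (half_ord j); rewrite eqxx.
have [j dj] : exists j, d j != 0.
  apply/existsP; apply: contraNT d0; rewrite negb_exists => /forallP h.
  by apply/eqP/ffunP => j; rewrite ffunE; have := h j; rewrite negbK => /eqP ->.
rewrite (bigD1 j) //=; have [_ _ -> _ _] := hpw (half_ord j).
by rewrite /flip eq_sym; case: ifP => _; rewrite ?oppr_eq0 (negPf dj) mul0r.
Qed.

(** Dividing by [h] uses up the factor of the moving coordinate; those of the coordinates at rest
    tend to 1. *)
Lemma inc_law_single (j0 : 'I_k.*2) (x : int) (v : R) (d : D) :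
  d j0 = x -> (forall j, j != j0 -> d j = 0) ->
  pw (half_ord j0) h 0 (flip j0 x) / h @[h --> 0^'+] --> v ->
  inc_law h d / h @[h --> 0^'+] --> v.
Proof.
move=> dx d0 hv.
have [c1 _] := @cvg_prod1 R _ [seq j <- index_enum 'I_k.*2 | j != j0]
  (fun j h => pw (half_ord j) h 0 0) (fun j => - (speed j + (speed j)^-1)) flip_rate0.
have e : pw (half_ord j0) h 0 (flip j0 x) / h *
   \prod_(j <- [seq j <- index_enum 'I_k.*2 | j != j0]) pw (half_ord j) h 0 0
   @[h --> 0^'+] --> v * 1 by exact: cvgM.
rewrite mulr1 in e; apply: cvg_trans e; apply: near_eq_cvg; near=> h.
rewrite /inc_law (bigD1 j0) //= dx big_filter mulrAC; congr (_ * _ / _).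
by apply: eq_bigr => j /d0 ->; rewrite flip0.
Unshelve. all: by end_near.
Qed.

Lemma inc_law_rate : {in unit_steps k.*2, forall d,
  (inc_law h d - (0 == d)%:R) / h @[h --> 0^'+] --> step_rate R k.*2 speed d}.
Proof.
move=> d; rewrite inE mem_cat => /or3P[/eqP ->|/mapP[j _ ->]|/mapP[j _ ->]].
- rewrite eqxx /step_rate eqxx -sumrN.
  have [_] := @cvg_prod1 R _ (index_enum 'I_k.*2)
    (fun j h => pw (half_ord j) h 0 0) (fun j => - (speed j + (speed j)^-1)) flip_rate0.
  suff -> : (fun h => (inc_law h 0 - true%:R) / h) =
     (fun h => ((\prod_(j <- index_enum 'I_k.*2) pw (half_ord j) h 0 0) - 1) / h) by [].
  apply/funext => h; congr ((_ - _) / _); apply: eq_bigr => j _.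
  by rewrite ffunE flip0.
- rewrite eq_sym (negPf (basis_vec_neq0 k.*2 j).1) step_rate_up.
  under eq_fun do rewrite subr0.
  apply: (inc_law_single j 1 _ _ _ _ (flip_rate_up j)); first by rewrite ffunE eqxx.
  by move=> i /negPf ij; rewrite ffunE ij.
- rewrite eq_sym (negPf (basis_vec_neq0 k.*2 j).2) step_rate_dn.
  under eq_fun do rewrite subr0.
  apply: (inc_law_single j (- 1) _ _ _ _ (flip_rate_dn j)); first by rewrite !ffunE eqxx.
  by move=> i /negPf ij; rewrite !ffunE ij oppr0.
Qed.

Lemma inc_law_ge0 h d : 0 <= h -> 0 <= inc_law h d.
Proof.
by move=> h0; apply: prodr_ge0 => j _; have [p0 _ _ _ _] := hpw (half_ord j); exact: p0.
Qed.

Lemma prod_shift t (d d' : D) : 0 <= t ->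
  \prod_(j < k.*2) pw (half_ord j) t (flip j (d j)) (flip j (d' j)) = inc_law t (d' - d).
Proof.
move=> t0; apply: eq_bigr => j _.
rewrite (walk_transition_shift R (q (half_ord j))^-1 (q (half_ord j)) _ _ (pw (half_ord j)) t) //.
- by congr (pw _ _ _ _); rewrite !ffunE /flip; case: ifP => _ //; rewrite opprB opprK addrC.
- by rewrite invr_ge0 ltW.
- exact: ltW.
Qed.

End IncrementLaw.

Lemma sigma_algebra_full (U : Type) (M : set (set U)) :
  sigma_algebra [set: U] M -> M [set: U].
Proof. by move=> [M0 MC _]; rewrite -(setD0 setT); exact: MC. Qed.

Lemma sigma_algebra_inter (U : Type) (M : set (set U)) (A B : set U) :
  sigma_algebra [set: U] M -> M A -> M B -> M (A `&` B).
Proof.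
move=> [M0 MC MU] MA MB.
rewrite (_ : A `&` B = setT `\` \bigcup_n (if n == 0%N then setT `\` A else setT `\` B)).
  by apply: (MC); apply: MU => n; case: ifP => _; exact: MC.
apply/seteqP; split=> x /=.
  by move=> [Ax Bx]; split=> // -[[|n] _ /= []].
move=> [_ nU]; split; apply: contrapT => nx; apply: nU.
  by exists 0%N.
by exists 1%N.
Qed.

Lemma path_sigma_sigma (R : realType) (S : Type) (M : set (set S)) :
  sigma_algebra [set: R -> S] (path_sigma M).
Proof. exact: smallest_sigma_algebra. Qed.

Lemma path_sigma_all (R : realType) (S : eqType) (l : seq (R * S)) : all (fun t => 0 <= t) (unzip1 l) ->
  path_sigma discrete_measurable [set f : R -> S | all (fun te => f te.1 == te.2) l].
Proof.
elim: l => [|[t e] l IH] /=.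
  move=> _; rewrite (_ : [set _ | _] = setT); first exact: sigma_algebra_full (path_sigma_sigma _ _ _).
  by apply/seteqP; split.
move=> /andP[t0 tl].
rewrite (_ : [set _ | _] = [set f | f t = e] `&` [set f : R -> S | all (fun te => f te.1 == te.2) l]).
  apply: sigma_algebra_inter (path_sigma_sigma _ _ _) _ _; last exact: IH.
  by apply: sub_sigma_algebra; exists t, [set e]; split.
by apply/seteqP; split=> f /= [] => [/andP[/eqP ? ?]|-> ->] //; rewrite eqxx.
Qed.

Lemma path_ge0 (R : realType) (s : seq R) : path <=%R 0 s -> all (fun t => 0 <= t) s.
Proof. by rewrite (path_sortedE le_trans) => /andP[]. Qed.

Lemma prod_half (R : realType) k (F : 'I_k -> bool -> R) :
  \prod_(j < k.*2) F (half_ord j) (odd j) = \prod_(i < k) (F i false * F i true).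
Proof.
have lt (i : 'I_k) (b : bool) : (b + i.*2 < k.*2)%N by have := ltn_ord i; case: b; lia.
pose mk (p : 'I_k * bool) : 'I_k.*2 := Ordinal (lt p.1 p.2).
rewrite (reindex mk) /=; last first.
  exists (fun j => (half_ord j, odd j)) => [[i b] _|j _] /=.
    by congr pair; [apply: val_inj; rewrite /= halfD odd_double andbF add0n doubleK; case: b
                   | rewrite oddD odd_double addbF; case: b].
  by apply: val_inj; rewrite /= odd_double_half.
have mkE p : F (half_ord (mk p)) (odd (mk p)) = F p.1 p.2.
  case: p => i b /=; congr F; last by rewrite oddD odd_double addbF; case: b.
  by apply: val_inj; rewrite /= halfD odd_double andbF add0n doubleK; case: b.
under eq_bigr do rewrite mkE.
rewrite -(pair_bigA _ (fun i b => F i b)) /=; apply: eq_bigr => i _.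
by rewrite big_bool /= mulrC.
Qed.

(** * Finite-dimensional laws of the driving walks and of the last passage functional *)

Section Joint.
Variables (R : realType) (k : nat) (q : 'I_k -> R).
Hypothesis q_gt0 : forall i, 0 < q i.
Variables (d : measure_display) (T : measurableType d) (P : probability T R).
Variables (Z Zt : R -> T -> {ffun 'I_k -> int}).
Hypothesis hZind : mutually_indep_processes P discrete_measurable (fun i t w => Z t w i).
Hypothesis hZtlaw : same_law discrete_measurable P Zt P (fun t w => - Z t w).
Hypothesis hZZt : indep_processes P discrete_measurable discrete_measurable Z Zt.
Hypothesis hZm : forall i, measurable_process discrete_measurable (fun t w => Z t w i).
Variable pw : 'I_k -> R -> int -> int -> R.
Hypothesis hpw : forall i, transition_function (walk_rates (q i)^-1 (q i)) (pw i).
Hypothesis hfdd : forall i (l : seq (R * int)), path <=%R 0 (unzip1 l) ->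
  P [set w | all (fun ty => Z ty.1 w i == ty.2) l] = (fdd (pw i) 0 0 l)%:E.

Notation V := {ffun 'I_k -> int}.
Notation D := {ffun 'I_k.*2 -> int}.

Lemma Z_joint (l : seq (R * V)) : path <=%R 0 (unzip1 l) ->
  P [set w | all (fun te => Z te.1 w == te.2) l]
  = (\prod_i fdd (pw i) 0 0 [seq (te.1, te.2 i) | te : (R * V)%type <- l])%:E.
Proof.
move=> pl; have l0 := path_ge0 _ _ pl.
pose A i := [set f : R -> int | all (fun te => f te.1 == te.2) [seq (te.1, te.2 i) | te : (R * V)%type <- l]].
have u1 i : unzip1 [seq (te.1, te.2 i) | te : (R * V)%type <- l] = unzip1 l by rewrite /unzip1 -map_comp.
have hA i : path_sigma discrete_measurable (A i) by apply: path_sigma_all; rewrite u1.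
have := hZind A hA.
under eq_bigr => i _ do rewrite [path_event _ _](_ : _ =
  [set w | all (fun ty => Z ty.1 w i == ty.2) [seq (te.1, te.2 i) | te : (R * V)%type <- l]]) // hfdd ?u1 //.
move=> <-; congr (P _); apply/seteqP; split=> w /=.
  by move=> h i _; rewrite /path_event /A /= all_map; apply: sub_all h => te /= /eqP ->.
move=> h; apply/allP => te tel; apply/eqP/ffunP => i.
have := h i I; rewrite /path_event /A /= all_map => /allP/(_ te tel)/eqP; exact.
Qed.

Lemma Zt_joint (l : seq (R * V)) : path <=%R 0 (unzip1 l) ->
  P [set w | all (fun te => Zt te.1 w == te.2) l]
  = (\prod_i fdd (pw i) 0 0 [seq (te.1, - te.2 i) | te : (R * V)%type <- l])%:E.
Proof.
move=> pl; have l0 := path_ge0 _ _ pl.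
have [_ _ /(_ _ (path_sigma_all _ _ _ l0)) e] := hZtlaw.
rewrite /path_event /= in e; rewrite e.
have u1 : unzip1 [seq (te.1, - te.2) | te : (R * V)%type <- l] = unzip1 l by rewrite /unzip1 -map_comp.
rewrite [X in P X](_ : _ = [set w | all (fun te => Z te.1 w == te.2) [seq (te.1, - te.2) | te : (R * V)%type <- l]]).
  rewrite Z_joint ?u1 //; congr (_%:E); apply: eq_bigr => i _; congr fdd.
  by rewrite -map_comp; apply: eq_map => te /=; rewrite ffunE.
apply/seteqP; split=> w /=; rewrite all_map; apply: sub_all => te /=.
  by move=> /eqP <-; rewrite opprK.
by move=> /eqP ->; rewrite opprK.
Qed.

Definition driver (t : R) (w : T) : D := [ffun j => interleaved Z Zt j t w].

Definition pick_half (b : bool) (e : D) : V :=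
  [ffun i : 'I_k => inc k.*2 e (b + i.*2)].

Lemma pick_halfE (e : D) (j : 'I_k.*2) : e j = pick_half (odd j) e (half_ord j).
Proof. by rewrite ffunE /= odd_double_half incE. Qed.

Lemma driver_eq t w e :
  (driver t w == e) = (Z t w == pick_half false e) && (Zt t w == pick_half true e).
Proof.
apply/eqP/andP => [<-|[/eqP h1 /eqP h2]].
  have lt (i : 'I_k) (b : bool) : (b + i.*2 < k.*2)%N by have := ltn_ord i; case: b; lia.
  have hh (i : 'I_k) b : half_ord (Ordinal (lt i b)) = i.
    by apply: val_inj; rewrite /= halfD odd_double andbF add0n doubleK; case: b.
  split; apply/eqP/ffunP => i; rewrite ffunE.
    rewrite -[(_ + _)%N]/(nat_of_ord (Ordinal (lt i false))) incE ffunE /interleaved hh /=.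
    by rewrite odd_double.
  rewrite -[(_ + _)%N]/(nat_of_ord (Ordinal (lt i true))) incE ffunE /interleaved hh /=.
  by rewrite odd_double.
by apply/ffunP => j; rewrite ffunE /interleaved (pick_halfE e) h1 h2; case: (odd j).
Qed.

Lemma driver_joint (l : seq (R * D)) : path <=%R 0 (unzip1 l) ->
  P [set w | all (fun te => driver te.1 w == te.2) l]
  = (\prod_(j < k.*2) fdd (pw (half_ord j)) 0 0 [seq (te.1, flip j (te.2 j)) | te : (R * D)%type <- l])%:E.
Proof.
move=> pl; have l0 := path_ge0 _ _ pl.
pose half b := [seq (te.1, pick_half b te.2) | te : (R * D)%type <- l].
have u1 b : unzip1 (half b) = unzip1 l by rewrite /unzip1 /half -map_comp.
rewrite [X in P X](_ : _ = path_event Z [set f | all (fun te => f te.1 == te.2) (half false)]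
   `&` path_event Zt [set f | all (fun te => f te.1 == te.2) (half true)]); last first.
  apply/seteqP; split=> w; rewrite /path_event /= !all_map.
    by move=> h; split; apply: sub_all h => te /=; rewrite driver_eq => /andP[].
  move=> [/allP h1 /allP h2]; apply/allP => te tel; rewrite driver_eq.
  by apply/andP; split; [exact: h1 te tel | exact: h2 te tel].
rewrite hZZt; [|by apply: path_sigma_all; rewrite u1..].
rewrite /path_event /= Z_joint ?u1 // Zt_joint ?u1 // -EFinM; congr (_%:E).
pose F (i : 'I_k) (b : bool) := fdd (pw i) 0 0
   [seq (te.1, if b then - pick_half b te.2 i else pick_half b te.2 i) | te : (R * D)%type <- l].
rewrite (eq_bigr (fun j : 'I_k.*2 => F (half_ord j) (odd j))); last first.
  move=> j _; rewrite /F; congr fdd; apply: eq_map => te; congr pair.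
  by rewrite /flip pick_halfE; case: (odd j).
rewrite prod_half big_split /=; congr (_ * _); apply: eq_bigr => i _;
  by rewrite /F /half -map_comp.
Qed.

Fixpoint partial_sums (y : D) (ts : seq R) (ds : seq D) : seq (R * D) :=
  match ts, ds with
  | t :: ts', e :: ds' => (t, y + e) :: partial_sums (y + e) ts' ds'
  | _, _ => [::]
  end.

Fixpoint inc_prod (s : R) (ts : seq R) (ds : seq D) : R :=
  match ts, ds with
  | t :: ts', e :: ds' => inc_law R k pw (t - s) e * inc_prod t ts' ds'
  | _, _ => 1
  end.

Lemma prod_fdd (s : R) (y : D) (ts : seq R) (ds : seq D) : path <=%R s ts ->
  \prod_(j < k.*2) fdd (pw (half_ord j)) s (flip j (y j))
     [seq (te.1, flip j (te.2 j)) | te : (R * D)%type <- partial_sums y ts ds]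
  = inc_prod s ts ds.
Proof.
elim: ts s y ds => [|t ts IH] s y [|e ds] /=; try by rewrite big1.
move=> /andP[st pts]; rewrite big_split /= IH //; congr (_ * _).
rewrite (prod_shift R k q) ?subr_ge0 //.
by congr inc_law; rewrite addrC addKr.
Qed.

(** The entry (0, 0) fixes the start, so that values and increments determine each other. *)
Lemma driver_increments ts ds : path <=%R 0 ts ->
  P [set w | all (fun te => driver te.1 w == te.2) ((0, 0) :: partial_sums 0 ts ds)]
  = (inc_prod 0 ts ds)%:E.
Proof.
move=> pts; rewrite driver_joint; last first.
  rewrite /= lexx /=; move: pts; move: (0 : D); move: (0 : R).
  elim: ts ds => [|t ts IH] [|e ds] s y //= /andP[-> h] /=; exact: IH.
rewrite -(prod_fdd 0 0) //; congr (_%:E); apply: eq_bigr => j _ /=.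
rewrite ffunE flip0 subrr; have [_ _ -> _ _] := hpw (half_ord j).
by rewrite eqxx mul1r.
Qed.

Lemma measurable_Z t v : 0 <= t -> measurable [set w | Z t w = v].
Proof.
move=> t0; rewrite (_ : [set _ | _] = \bigcap_(i in [set: 'I_k]) ((fun w => Z t w i) @^-1` [set v i])).
  by apply: fin_bigcap_measurable => [|i _]; [exact: finite_finset | exact: hZm].
by apply/seteqP; split=> w /= h; [move=> i _; rewrite /= h | apply/ffunP => i; exact: (h i I)].
Qed.

Lemma measurable_driver t e : 0 <= t -> measurable (driver t @^-1` [set e]).
Proof.
move=> t0; rewrite (_ : _ @^-1` _ = [set w | Z t w = pick_half false e] `&`
   Zt t @^-1` [set pick_half true e]).
  by apply: measurableI; [exact: measurable_Z | have [m _ _] := hZtlaw; exact: m].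
apply/seteqP; split=> w /= => [/eqP|[h1 h2]].
  by rewrite driver_eq => /andP[/eqP -> /eqP ->].
by apply/eqP; rewrite driver_eq h1 h2 !eqxx.
Qed.

Lemma driver0 : P [set w | driver 0 w = 0] = 1%E.
Proof.
have := driver_increments [::] [::] isT; rewrite /= => <-; congr (P _).
by apply/seteqP; split=> w /= => [->|/andP[/eqP -> _]] //; rewrite eqxx.
Qed.

(** The total mass is read off the probability space: the almost sure event {driver 0 = 0} is split
    by the value of [driver h]. *)
Lemma inc_law_prob h : 0 <= h -> prob_vec (inc_law R k pw h).
Proof.
move=> h0; split=> [e|]; first exact: (inc_law_ge0 R k q).
rewrite -driver0 (@prob_decomposition d T R P D _ (driver h)); first last.
- by move=> e; exact: measurable_driver.
- exact: measurable_driver.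
apply: eq_esum => e _; have := driver_increments [:: h] [:: e].
rewrite /= h0 subr0 mulr1 add0r => /(_ isT) <-; congr (P _).
apply/seteqP; split=> w /= => [/and3P[/eqP -> /eqP -> _]|[-> ->]] //.
by rewrite !eqxx.
Qed.

Notation mu := (inc_law R k pw).
Notation drive w := (drive R k T Z Zt w).
Notation phi := (fun (x : seq int) (e : D) => push k.*2 (inc k.*2 e) x).

Fixpoint timed_steps (s : R) (l : seq (R * (seq int -> bool))) : seq (chain_step T R (seq int) D) :=
  if l is (t, c) :: l' then
    ((fun w => driver t w - driver s w), (fun _ => mu (t - s)), c) :: timed_steps t l'
  else [::].

(** Only the last time of a block is an observation time; at the others the test is true. *)
Fixpoint end_test (b : R) (ts : seq R) : seq (R * (seq int -> bool)) :=
  match ts with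
  | [::] => [::]
  | t :: ts' => (t, fun x => (ts' != [::]) || ((head 0 x)%:~R <= b)) :: end_test b ts'
  end.

Fixpoint grid_tests (N : nat) (s : R) (l : seq (R * R)) : seq (R * (seq int -> bool)) :=
  if l is (t, b) :: l' then
    end_test b [seq s + (t - s) / (2 ^ N)%:R * i.+1%:R | i <- iota 0 (2 ^ N)]
      ++ grid_tests N t l'
  else [::].

Lemma unzip1_end_test b ts : unzip1 (end_test b ts) = ts.
Proof. by elim: ts => //= t ts ->. Qed.

Lemma unzip1_grid_tests N s l : unzip1 (grid_tests N s l) = grid R N s (unzip1 l).
Proof.
elim: l s => //= -[t b] l IH s /=.
by rewrite /unzip1 map_cat -!/(unzip1 _) unzip1_end_test IH.
Qed.

Lemma timed_steps_reg s l : 0 <= s -> path <=%R s (unzip1 l) ->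
  chain_reg (timed_steps s l).
Proof.
elim: l s => //= -[t c] l IH s /= s0 /andP[st pl].
have t0 : 0 <= t by exact: le_trans st.
split; last exact: IH.
- move=> e; rewrite (_ : _ @^-1` _ = [set w | driver t w - driver s w = e]) //.
  apply: (@measurable_fibers d T D (driver s) (fun y => [set w | driver t w - y = e])).
    by move=> y; apply: measurable_driver.
  move=> y; rewrite (_ : [set _ | _] = driver t @^-1` [set e + y]).
    by apply: measurable_driver.
  by apply/seteqP; split=> w /= => [<-|->]; rewrite ?subrK ?addrK.
- by move=> x; apply: inc_law_prob => //; rewrite subr_ge0.
Qed.

Lemma timed_steps_eq s y l ds w : driver s w = y -> size ds = size l ->
  chain_eq (timed_steps s l) ds w
  = all (fun te => driver te.1 w == te.2) (partial_sums y (unzip1 l) ds).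
Proof.
elim: l s y ds => [|[t c] l IH] s y [|e ds] //= sy [sd].
rewrite sy subr_eq addrC; case: eqP => //= h; exact: IH.
Qed.

Lemma timed_steps_wt s l x ds : size ds = size l ->
  chain_wt phi (timed_steps s l) x ds = inc_prod s (unzip1 l) ds.
Proof. by elim: l s x ds => [|[t c] l IH] s x [|e ds] //= [sd]; rewrite IH. Qed.

(** The product law is known jointly with the start at 0, so the event is intersected with that
    almost sure event. *)
Lemma prob_timed_steps l x : path <=%R 0 (unzip1 l) ->
  P [set w | chain_ok phi (timed_steps 0 l) x w]
  = (chain_val phi (timed_steps 0 l) x)%:E.
Proof.
move=> pl; have reg := timed_steps_reg 0 l (lexx _) pl.
have m0 : measurable [set w | driver 0 w = 0] by exact: measurable_driver.
have mok := measurable_chain_ok phi _ x reg.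
have size_steps s l' : size (timed_steps s l') = size l' by elim: l' s => //= -[t c] l' IH s /=; rewrite IH.
have := chain_prob P phi (timed_steps 0 l) x [set w | driver 0 w = 0] 1 reg m0 ler01.
rewrite mul1r => <-.
- rewrite (measureDI P mok m0) [X in (X + _)%E](_ : _ = 0%E) ?add0e 1?setIC //.
  have full : P (~` [set w | driver 0 w = 0]) = 0%E.
    by rewrite probability_setC // driver0 subee.
  apply/eqP; rewrite eq_le measure_ge0 andbT -full; apply: le_measure => //.
  - by rewrite inE; exact: measurableD.
  - by rewrite inE; exact: measurableC.
- move=> ds; rewrite size_steps => sd; rewrite mul1r timed_steps_wt //.
  rewrite -driver_increments //; congr (P _).
  apply/seteqP; split=> w /=.
    by move=> [h]; rewrite (timed_steps_eq 0 0) // h eqxx.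
  by move=> /andP[/eqP h]; rewrite (timed_steps_eq 0 0).
Qed.

Lemma chain_val_block (h s b : R) (m j : nat) (l : seq (R * (seq int -> bool))) x :
  (0 < m)%N ->
  chain_val phi
    (timed_steps (s + h * j%:R) (end_test b [seq s + h * i.+1%:R | i <- iota j m] ++ l)) x
  = iter m (grid_step R k mu h) (fun y => top_le R b (head 0 y) *
      chain_val phi (timed_steps (s + h * (j + m)%:R) l) y) x.
Proof.
have hE i : s + h * i.+1%:R - (s + h * i%:R) = h by rewrite -natr1; ring.
elim: m j x => // -[|m] IH j x _.
  rewrite /= /grid_step hE addn1; apply: eq_avg => e; by [].
have {}IH := fun y => IH j.+1 y isT; rewrite addSnnS in IH.
rewrite iterS; move: IH; set F := iter m.+1 _ _ => IH.
by rewrite /= /grid_step hE; apply: eq_avg => e; rewrite -IH /= mul1r.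
Qed.

Lemma chain_val_grid N s l x :
  chain_val phi (timed_steps s (grid_tests N s l)) x
  = grid_val R k mu N l s x.
Proof.
elim: l s x => //= -[t b] l IH s x /=.
have := chain_val_block ((t - s) / (2 ^ N)%:R) s b (2 ^ N) 0 (grid_tests N t l) x.
rewrite mulr0 addr0 expn_gt0 => -> //.
have e : s + (t - s) / (2 ^ N)%:R * (2 ^ N)%:R = t.
  by rewrite divfK ?pnatr_eq0 -?lt0n ?expn_gt0 // addrC subrK.
rewrite add0n e.
by congr (iter _ _ _ _); apply/funext => y; rewrite IH.
Qed.

Lemma inc_sub (e e' : D) i : inc k.*2 (e - e') i = inc k.*2 e i - inc k.*2 e' i.
Proof. by rewrite /inc; case: insub => [j|]; rewrite ?ffunE ?subr0. Qed.

Lemma chain_ok_block s b ts l x w : ts != [::] ->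
  chain_ok phi (timed_steps s (end_test b ts ++ l)) x w
  = ((head 0 (run R (drive w) k.*2 x s ts))%:~R <= b)
    && chain_ok phi (timed_steps (last s ts) l) (run R (drive w) k.*2 x s ts) w.
Proof.
have step t s' y : phi y (driver t w - driver s' w)
    = push k.*2 (fun i => drive w i t - drive w i s') y.
  by congr push; apply/funext => i; rewrite inc_sub.
elim: ts s x => // t [|t' ts] IH s x _; first by rewrite /= step.
rewrite -[LHS]/(chain_ok phi (timed_steps t (end_test b (t' :: ts) ++ l))
  (phi x (driver t w - driver s w)) w).
by rewrite IH // step.
Qed.

Lemma chain_ok_grid N s l x w :
  chain_ok phi (timed_steps s (grid_tests N s l)) x w <->
  forall j, (j < size l)%N ->
    (head 0 (run R (drive w) k.*2 x s (grid R N s (take j.+1 (unzip1 l)))))%:~R <= nth 0 (unzip2 l) j.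
Proof.
elim: l s x => [|[t b] l IH] s x //=.
rewrite chain_ok_block; last by rewrite -size_eq0 size_map size_iota -lt0n expn_gt0.
rewrite last_grid_block; split=> [/andP[h0 /IH h] [|j] //= jl|h].
- by rewrite take0 /= cats0.
- by rewrite run_cat last_grid_block; exact: h.
apply/andP; split; first by have := h 0%N isT; rewrite take0 /= cats0.
apply/IH => j jl; have := h j.+1 jl; rewrite /= run_cat last_grid_block; exact.
Qed.

Hypothesis rcZ : forall w t, 0 <= t -> \forall u \near t^'+, forall i, Z u w i = Z t w i.
Hypothesis rcZt : forall w t, 0 <= t -> \forall u \near t^'+, Zt u w = Zt t w.

Definition passage_event (l : seq (R * R)) : set T :=
  [set w | all (fun tb => (last_passage (interleaved Z Zt) tb.1 w <= tb.2%:E)%E) l].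

Definition grid_event (N : nat) (l : seq (R * R)) : set T :=
  [set w | chain_ok phi (timed_steps 0 (grid_tests N 0 l)) (nseq k.*2 0) w].

Lemma path_take (s : R) (ts : seq R) j : path <=%R s ts -> path <=%R s (take j ts).
Proof. by elim: ts s j => [|t ts IH] s [|j] //= /andP[-> h] /=; exact: IH. Qed.

Lemma last_take (s : R) (ts : seq R) j : (j < size ts)%N -> last s (take j.+1 ts) = nth 0 ts j.
Proof. by elim: ts s j => [|t ts IH] s [|j] //= h; [rewrite take0 | exact: IH]. Qed.

Lemma passage_grid_event l : path <=%R 0 (unzip1 l) ->
  passage_event l = \bigcap_N grid_event N l.
Proof.
move=> pl; apply/seteqP; split=> w /=.
  move=> /allP h N _; apply/chain_ok_grid => j jl.
  have jl1 : (j < size (unzip1 l))%N by rewrite size_map.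
  have pj := path_take 0 _ j.+1 pl.
  have [+ _] := last_passage_le R k T Z Zt w (rcZ w) (rcZt w) (take j.+1 (unzip1 l)) (nth 0 (unzip2 l) j) pj.
  apply; rewrite last_take //.
  have := h (nth (0, 0) l j) (mem_nth _ jl).
  by rewrite (nth_map (0, 0)) // (nth_map (0, 0)).
move=> h; apply/allP => tb /(nthP (0, 0))[j jl <-].
have jl1 : (j < size (unzip1 l))%N by rewrite size_map.
have pj := path_take 0 _ j.+1 pl.
have [_] := last_passage_le R k T Z Zt w (rcZ w) (rcZt w) (take j.+1 (unzip1 l)) (nth 0 (unzip2 l) j) pj.
rewrite last_take // (nth_map (0, 0)) // (nth_map (0, 0)) //; apply => N.
have /chain_ok_grid := h N I; move=> /(_ j jl).
by rewrite (nth_map (0, 0)).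
Qed.

Lemma grid_event_measurable N l : path <=%R 0 (unzip1 l) -> measurable (grid_event N l).
Proof.
move=> pl; apply: measurable_chain_ok; apply: timed_steps_reg => //.
by rewrite unzip1_grid_tests; exact: path_grid.
Qed.

Lemma passage_event_measurable l : path <=%R 0 (unzip1 l) -> measurable (passage_event l).
Proof.
move=> pl; rewrite passage_grid_event //; apply: bigcapT_measurable => N.
exact: grid_event_measurable.
Qed.

(** Refining the grid raises the grid values, so the grid events decrease to the passage event:
    continuity from above. *)
Lemma passage_event_limit l : path <=%R 0 (unzip1 l) ->
  (grid_val R k mu N l 0 (nseq k.*2 0))%:E @[N --> \oo] --> P (passage_event l).
Proof.
move=> pl; rewrite passage_grid_event //.
have -> : (fun N => (grid_val R k mu N l 0 (nseq k.*2 0))%:E) = P \o (fun N => grid_event N l).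
  apply/funext => N /=; rewrite -chain_val_grid -prob_timed_steps //.
  by rewrite unzip1_grid_tests; exact: path_grid.
apply: nonincreasing_cvg_mu.
- by apply: le_lt_trans (probability_le1 _ _) (ltry _); exact: grid_event_measurable.
- by move=> N; exact: grid_event_measurable.
- by apply: bigcapT_measurable => N; exact: grid_event_measurable.
apply/nonincreasing_seqP => N; apply/subsetPset => w /chain_ok_grid h.
apply/chain_ok_grid => j jl; apply: le_trans (h j jl); rewrite ler_int.
by apply: (grid_top_le R k T Z Zt w N); exact: path_take.
Qed.

End Joint.

(** * Laws on path space *)

Section RayLaw.
Variables (R : realType) (d d' : measure_display).
Variables (T : measurableType d) (T' : measurableType d').
Variables (P : probability T R) (P' : probability T' R).
Variables (X : R -> T -> \bar R) (Y : R -> T' -> \bar R).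

Definition ray_event (U : Type) (V : R -> U -> \bar R) (l : seq (R * R)) : set U :=
  [set w | all (fun tb => (V tb.1 w <= tb.2%:E)%E) l].

(** A pi-system generating the path sigma-algebra. Upper bounds suit a supremum: it is at most b
    exactly when all grid values are. *)
Definition rays : set (set (R -> \bar R)) :=
  [set C | exists2 l : seq (R * R), all (fun t => 0 <= t) (unzip1 l)
     & C = ray_event _ (fun t f => f t) l].

Lemma setI_closed_rays : setI_closed rays.
Proof.
move=> A B [l pl ->] [l' pl' ->]; exists (l ++ l').
  by rewrite /unzip1 map_cat all_cat pl pl'.
apply/seteqP; split=> f; rewrite /ray_event /= all_cat.
  by move=> [-> ->].
by move=> /andP.
Qed.

Lemma path_sigma_rays : path_sigma (measurable : set (set (\bar R))) `<=` <<s rays >>.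
Proof.
have srays : sigma_algebra setT <<s rays >> by exact: smallest_sigma_algebra.
apply: smallest_sub; first exact: smallest_sigma_algebra.
move=> _ [t [B [t0 mB ->]]].
have {mB} : (@ErealGenOInfty.G R).-sigma.-measurable B.
  by rewrite -(ErealGenOInfty.measurableE R).
move: B; apply: smallest_sub.
  have [M0 MC MU] := srays; split=> /=.
  - exact: M0.
  - by move=> A MA; exact: MC _ MA.
  - by move=> A MA; exact: MU (fun i => [set f : R -> \bar R | A i (f t)]) MA.
move=> _ [r ->] /=; rewrite (_ : [set f | _] = setT `\` ray_event _ (fun t f => f t) [:: (t, r)]).
  have [_ MC _] := srays; apply: MC; apply: sub_sigma_algebra.
  by exists [:: (t, r)]; rewrite /= ?t0.
apply/seteqP; split=> f; rewrite /ray_event /= in_itv /= andbT.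
  by rewrite ltNge => h; split=> //; rewrite andbT; exact/negP.
by move=> [_]; rewrite andbT ltNge => /negP.
Qed.

Hypothesis rayE : forall l : seq (R * R), path <=%R 0 (unzip1 l) ->
  [/\ measurable (ray_event _ X l), measurable (ray_event _ Y l)
    & P (ray_event _ X l) = P' (ray_event _ Y l)].

Definition agree : set (set (R -> \bar R)) :=
  [set A | [/\ measurable (path_event X A), measurable (path_event Y A)
             & P (path_event X A) = P' (path_event Y A)]].

Lemma lambda_agree : lambda_system setT agree.
Proof.
split=> //.
- split; try exact: measurableT.
  by rewrite [LHS]probability_setT [RHS]probability_setT.
- move=> A B AB [mA1 mA2 eA] [mB1 mB2 eB].
  have sX : path_event X B `<=` path_event X A by move=> w; exact: AB.
  have sY : path_event Y B `<=` path_event Y A by move=> w; exact: AB.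
  split; [exact: measurableD | exact: measurableD |].
  rewrite [LHS](measureD (mu := P) mA1 mB1); last exact: le_lt_trans (probability_le1 _ mA1) (ltry _).
  rewrite [RHS](measureD (mu := P') mA2 mB2); last exact: le_lt_trans (probability_le1 _ mA2) (ltry _).
  by rewrite (setIidr sX) (setIidr sY); congr (_ - _)%E; [exact: eA | exact: eB].
- move=> F ndF HF.
  have mX : measurable (\bigcup_i path_event X (F i)).
    by apply: bigcupT_measurable => i; case: (HF i).
  have mY : measurable (\bigcup_i path_event Y (F i)).
    by apply: bigcupT_measurable => i; case: (HF i).
  have cX : P \o (fun i => path_event X (F i)) @ \oo --> P (\bigcup_i path_event X (F i)).
    apply: nondecreasing_cvg_mu => //; first by move=> i; case: (HF i).
    by move=> m n mn; apply/subsetPset => w; have /subsetPset h := ndF m n mn; exact: h.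
  have cY : P' \o (fun i => path_event Y (F i)) @ \oo --> P' (\bigcup_i path_event Y (F i)).
    apply: nondecreasing_cvg_mu => //; first by move=> i; case: (HF i).
    by move=> m n mn; apply/subsetPset => w; have /subsetPset h := ndF m n mn; exact: h.
  split=> //.
  apply: cvg_unique cX _ => //.
  rewrite (_ : P \o _ = P' \o (fun i => path_event Y (F i))) //.
  by apply/funext => i /=; case: (HF i).
Qed.

Lemma path_ray_event (U : Type) (V : R -> U -> \bar R) l :
  path_event V (ray_event _ (fun t f => f t) l) = ray_event _ V l.
Proof. by []. Qed.

Lemma rays_agree : rays `<=` agree.
Proof.
move=> _ [l l0 ->]; rewrite /agree /= !path_ray_event.
(* The times of a ray event come in any order, while [rayE] wants them increasing. *)
pose l' := sort (relpre fst <=%R) l.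
have permE (U : Type) (V : R -> U -> \bar R) : ray_event _ V l = ray_event _ V l'.
  by apply/seteqP; split=> w; rewrite /ray_event /= (perm_all _ (permEl (perm_sort _ _))).
rewrite !permE; apply: rayE.
rewrite (path_sortedE le_trans) /unzip1 sorted_map; apply/andP; split.
  by rewrite all_map (perm_all _ (permEl (perm_sort _ _))) -all_map.
by apply: sort_sorted => a b; exact: le_total.
Qed.

(** Dynkin's theorem. As [agree] includes measurability, the supremum over uncountably many chains
    is obtained as a measurable process on the way. *)
Lemma same_law_rays : same_law (measurable : set (set (\bar R))) P X P' Y.
Proof.
have key : path_sigma (measurable : set (set (\bar R))) `<=` agree.
  apply: subset_trans path_sigma_rays _.
  by apply: lambda_system_subset => //; [exact: setI_closed_rays | exact: lambda_agree | exact: rays_agree].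
have cyl t B : 0 <= t -> measurable B -> agree [set f | B (f t)].
  by move=> t0 mB; apply: key; apply: sub_sigma_algebra; exists t, B.
split.
- by move=> t B t0 mB; have [] := cyl t B t0 mB.
- by move=> t B t0 mB; have [] := cyl t B t0 mB.
- by move=> A /key[].
Qed.

End RayLaw.

Lemma is_edge_ge0 n x : is_edge n x -> 0 <= head 0 x.
Proof. by elim: n x => [|n IH] [|b x] //= /andP[h /IH]; move=> /le_trans; exact. Qed.

Lemma is_edge_nseq n x : is_edge n x -> head 0 x = 0 -> x = nseq n 0.
Proof.
elim: n x => [|n IH] [|b x] //= /andP[h ex] b0; rewrite b0 in h *; congr cons.
by apply: IH => //; apply/eqP; rewrite eq_le h (is_edge_ge0 n).
Qed.

(** A pattern with zero bottom row vanishes, so Gamma(0, .) is a point mass and the grid recursion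
    starts from zeros. *)
Lemma gibbs_chamber0 (R : realType) k (q : 'I_k -> R) f : (forall i, 0 < q i) ->
  gibbs R k q f (chamber0 k) = f (nseq k.*2 0).
Proof.
move=> q0; rewrite -[RHS](gibbs_cst R k q q0 _ (chamber0 k)).
apply: eq_gibbs => // x ex hx; rewrite (is_edge_nseq _ _ ex) // hx.
have [h|h] := ltnP 0 k; last exact: chamber_row_ge.
by rewrite -[LHS]/(chamber_row k (val (chamber0 k)) (Ordinal h)) chamber_rowE ffunE.
Qed.

(** * Finite-dimensional laws of the largest coordinate of the h-transform *)

Section DaggerLaw.
Variables (R : realType) (k : nat) (q : 'I_k -> R).
Variables (d : measure_display) (T : measurableType d) (P : probability T R).
Variable X : R -> T -> chamber k.
Hypothesis mX : measurable_process (@discrete_measurable (chamber k)) X.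
Variable p : R -> chamber k -> chamber k -> R.
Hypothesis hp : transition_function (dagger_rates q) p.
Hypothesis hfdd : forall l : seq (R * chamber k), path <=%R 0 (unzip1 l) ->
  P [set w | all (fun ty => X ty.1 w == ty.2) l] = (fdd p 0 (chamber0 k) l)%:E.

Notation phi := (fun (_ y : chamber k) => y).

Fixpoint dagger_steps (s : R) (l : seq (R * R)) : seq (chain_step T R (chamber k) (chamber k)) :=
  if l is (t, b) :: l' then
    (X t, p (t - s), fun y : chamber k => (chamber_row k (val y) 0%N)%:~R <= b) :: dagger_steps t l'
  else [::].

Lemma dagger_steps_reg s l : 0 <= s -> path <=%R s (unzip1 l) -> chain_reg (dagger_steps s l).
Proof.
elim: l s => //= -[t b] l IH s /= s0 /andP[st pl].
have t0 : 0 <= t by exact: le_trans st.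
split; last exact: IH.
- by move=> y; exact: mX.
- by move=> y; apply: (transition_prob R _ _ p) hp _; rewrite subr_ge0.
Qed.

Lemma dagger_chain_eq s l ys w : size ys = size l ->
  chain_eq (dagger_steps s l) ys w = all (fun ty => X ty.1 w == ty.2) (zip (unzip1 l) ys).
Proof. by elim: l s ys => [|[t b] l IH] s [|y ys] //= [sy]; rewrite IH. Qed.

Lemma dagger_chain_wt s z l ys : size ys = size l ->
  chain_wt phi (dagger_steps s l) z ys = fdd p s z (zip (unzip1 l) ys).
Proof. by elim: l s z ys => [|[t b] l IH] s z [|y ys] //= [sy]; rewrite IH. Qed.

Lemma dagger_chain_val s z l :
  chain_val phi (dagger_steps s l) z = dagger_val R k p l s z.
Proof.
by elim: l s z => //= -[t b] l IH s z /=; apply: eq_avg => y; rewrite IH.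
Qed.

Lemma dagger_chain_ok s z l w :
  chain_ok phi (dagger_steps s l) z w
  = all (fun tb => (chamber_row k (val (X tb.1 w)) 0%N)%:~R <= tb.2) l.
Proof. by elim: l s z => //= -[t b] l IH s z /=; rewrite IH. Qed.

Lemma dagger_prob l : path <=%R 0 (unzip1 l) ->
  measurable [set w | all (fun tb => (chamber_row k (val (X tb.1 w)) 0%N)%:~R <= tb.2) l] /\
  P [set w | all (fun tb => (chamber_row k (val (X tb.1 w)) 0%N)%:~R <= tb.2) l]
  = (dagger_val R k p l 0 (chamber0 k))%:E.
Proof.
move=> pl; have reg := dagger_steps_reg 0 l (lexx _) pl.
have eqS : [set w | all (fun tb => (chamber_row k (val (X tb.1 w)) 0%N)%:~R <= tb.2) l]
    = [set w | chain_ok phi (dagger_steps 0 l) (chamber0 k) w].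
  by apply/seteqP; split=> w /=; rewrite dagger_chain_ok.
rewrite eqS; split; first exact: measurable_chain_ok.
have size_steps s l' : size (dagger_steps s l') = size l'.
  by elim: l' s => //= -[t b] l' IH s /=; rewrite IH.
have := chain_prob P phi (dagger_steps 0 l) (chamber0 k) setT 1 reg measurableT ler01.
rewrite setTI mul1r dagger_chain_val; apply => ys; rewrite size_steps => sy.
have u1 : unzip1 (zip (unzip1 l) ys) = unzip1 l by rewrite unzip1_zip // size_map sy.
rewrite setTI mul1r dagger_chain_wt // -hfdd ?u1 //; congr (P _).
by apply/seteqP; split=> w /=; rewrite dagger_chain_eq.
Qed.

End DaggerLaw.

Theorem mainTheorem4 (R : realType) (k : nat) (hk : (0 < k)%N)
    (q : 'I_k -> R) (hq : forall i, 0 < q i < 1)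
    (d : measure_display) (T : measurableType d) (P : probability T R)
    (Z Zt : R -> T -> {ffun 'I_k -> int})
    (hZ : forall i, markov_jump_process P (walk_rates (q i)^-1 (q i)) 0
                      (fun t w => Z t w i))
    (hZind : mutually_indep_processes P discrete_measurable
               (fun i t w => Z t w i))
    (hZt : cadlag_paths Zt)
    (hZtlaw : same_law discrete_measurable P Zt P (fun t w => - Z t w))
    (hZZt : indep_processes P discrete_measurable discrete_measurable Z Zt)
    (d' : measure_display) (T' : measurableType d') (P' : probability T' R)
    (Zdag : R -> T' -> chamber k)
    (hZdag : markov_jump_process P' (dagger_rates q) (chamber0 k) Zdag) :
  same_law (measurable : set (set (\bar R)))
    P' (fun t w => ((largest_coord hk (Zdag t w))%:~R : R)%:E)
    P (last_passage (interleaved Z Zt)).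
Proof.
have q0 i : 0 < q i by case/andP: (hq i).
pose walk_law i p := transition_function (walk_rates (q i)^-1 (q i)) p /\
  forall l : seq (R * int), path <=%R 0 (unzip1 l) ->
    P [set w | all (fun ty => Z ty.1 w i == ty.2) l] = (fdd p 0 0 l)%:E.
have walk_lawP i : exists p, walk_law i p by have [_ _ [p h1 h2]] := hZ i; exists p.
have [pw hpw] := boolp.choice walk_lawP.
have mZ i : measurable_process discrete_measurable (fun t w => Z t w i) by have [] := hZ i.
have rcZ w t : 0 <= t -> \forall u \near t^'+, forall i, Z u w i = Z t w i.
  by move=> t0; apply: filter_forall => i; have [_ /(_ w t)[rc _] _] := hZ i; exact: rc.
have rcZt w t : 0 <= t -> \forall u \near t^'+, Zt u w = Zt t w.
  by move=> t0; have [rc _] := hZt w t; exact: rc.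
have [mX _ [p hp hpfdd]] := hZdag.
pose mu := inc_law R k pw.
have tf i := (hpw i).1.
have fd i := (hpw i).2.
apply: same_law_rays => l pl.
have topE (z : chamber k) : largest_coord hk z = chamber_row k (val z) 0%N.
  have h0 : (0 < k)%N by [].
  rewrite -[RHS]/(chamber_row k (val z) (Ordinal h0)) chamber_rowE /largest_coord.
  by congr (val z _); apply: val_inj; rewrite /= subn1.
have evX : ray_event R _ (fun t w => ((largest_coord hk (Zdag t w))%:~R : R)%:E) l
    = [set w | all (fun tb => (chamber_row k (val (Zdag tb.1 w)) 0%N)%:~R <= tb.2) l].
  by apply/seteqP; split=> w; apply: sub_all => tb /=; rewrite lee_fin topE.
have [mD PD] := dagger_prob R k q d' T' P' Zdag mX p hp hpfdd l pl.
split; first by rewrite evX.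
  exact: (passage_event_measurable R k q q0 d T P Z Zt hZind hZtlaw hZZt mZ pw tf fd rcZ rcZt l pl).
rewrite evX PD.
(* The same grid values converge to the probability for the last passage functional ([c1]) and to
   the one for the h-transform ([c2]). *)
have c1 := passage_event_limit R k q q0 d T P Z Zt hZind hZtlaw hZZt mZ pw tf fd rcZ rcZt l pl.
have mup h : 0 <= h -> prob_vec (mu h).
  exact: (inc_law_prob R k q q0 d T P Z Zt hZind hZtlaw hZZt mZ pw tf fd).
have c2 : (grid_val R k mu N l 0 (nseq k.*2 0)) @[N --> \oo] --> dagger_val R k p l 0 (chamber0 k).
  apply/cvgrPdist_le => eps eps0.
  have := dagger_grid_limit R k q q0 mu mup (inc_law0 R k q pw tf) (inc_law_rate R k q pw tf)
    p hp l 0 (chamber0 k) eps pl eps0.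
  by apply: filterS => N; rewrite gibbs_chamber0.
apply: cvg_unique c1 => //.
by apply: cvg_EFin => //; apply: nearW.
Qed.
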